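(* Let $s\in\mathbb{C}$ and $1\le k\le 2r$. Suppose that $\mathfrak{g}(1)$ is an irreducible $L$-module and that $V^*$ is an irreducible $L$-constituent of $\mathfrak{g}(-r+k)^*\otimes\mathfrak{g}(r)^*$. Let $X_h$ be a highest weight vector for $\mathfrak{g}(1)$ and $Y_l^*$ a lowest weight vector for $V^*$. If $$[\pi_s(X_h),\Omega_k(Y_l^* )]_e\in\mathrm{span}_{\mathbb{C}}\{\Omega_k(Y_1^* )_e,\dots,\Omega_k(Y_n^* )_e\}$$ with $\{Y_1^*,\dots,Y_n^*\}$ a basis for $V^*$, then for any $X\in\mathfrak{g}(1)$ and $Y^*\in V^*$, $$[\pi_s(X),\Omega_k(Y^* )]_e\in\mathrm{span}_{\mathbb{C}}\{\Omega_k(Y_1^* )_e,\dots,\Omega_k(Y_n^* )_e\}.$$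
   Context: $G$ is a complex, simple, connected, simply connected Lie group with Lie algebra $\mathfrak{g}$, $\mathfrak{b}=\mathfrak{h}\oplus\mathfrak{u}$ a Borel subalgebra with Cartan subalgebra $\mathfrak{h}$, simple roots $\Pi$, Killing form $\kappa$. $\mathfrak{q}=\mathfrak{l}\oplus\mathfrak{n}\supset\mathfrak{b}$ is a maximal parabolic subalgebra, determined by a simple root $\alpha_\mathfrak{q}$, with associated grading $\mathfrak{g}=\bigoplus_{j=-r}^r\mathfrak{g}(j)$ ($\mathfrak{g}(1)\neq0$, $\mathfrak{l}=\mathfrak{g}(0)$, $\mathfrak{n}=\bigoplus_{j>0}\mathfrak{g}(j)$, $\bar{\mathfrak{n}}=\bigoplus_{j>0}\mathfrak{g}(-j)$; eigenspaces of $\mathrm{ad}$ of a semisimple element of $\mathfrak{l}$). $Q=N_G(\mathfrak{q})=LN$, $L$ acting by $\mathrm{Ad}$; highest and lowest weights are with respect to the positive roots in $\mathfrak{l}$. $\mathfrak{g}_0$ is a real form of $\mathfrak{g}$ in which $\mathfrak{q}$ has a real form, $G_0\subset G$ its analytic subgroup, $Q_0=N_{G_0}(\mathfrak{q})=L_0N_0$, $\bar N_0$ the unipotent subgroup opposite to $N_0$. $\lambda_\mathfrak{q}$ is the fundamental weight of $\alpha_\mathfrak{q}$, $\chi_\mathfrak{q}$ the character of $L$ with differential $\lambda_\mathfrak{q}$, $\chi^s=|\chi_\mathfrak{q}|^s$ on $L_0$ extended trivially to $N_0$; $\mathcal{L}_s$ is the resulting line bundle restricted to $\bar N_0\subset G_0/Q_0$,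 with sections $C^\infty(\bar N_0,\mathbb{C}_{\chi^s})$. With $Y=Y_{\bar{\mathfrak{n}}}+Y_\mathfrak{q}$ along $\mathfrak{g}=\bar{\mathfrak{n}}\oplus\mathfrak{q}$ and $(R(X)f)(\bar n)=\frac{d}{dt}f(\bar n\exp(tX))|_{t=0}$ (extended to $\mathcal{U}(\bar{\mathfrak{n}})$), $\mathfrak{g}$ acts by $(\pi_s(Y)f)(\bar n)=s\lambda_\mathfrak{q}((\mathrm{Ad}(\bar n^{-1})Y)_\mathfrak{q})f(\bar n)-(R((\mathrm{Ad}(\bar n^{-1})Y)_{\bar{\mathfrak{n}}})f)(\bar n)$. For a differential operator $D$ on sections, $D_e$ is the functional $f\mapsto(Df)(e)$. $\omega=\sum_jX_j^*\otimes X_j\in\mathfrak{g}(-r)\otimes\mathfrak{g}(r)$ with $\{X_j\}$ a basis of $\mathfrak{g}(r)$ and $\{X_j^*\}$ its $\kappa$-dual basis of $\mathfrak{g}(-r)$; $\tau_k:\mathfrak{g}(1)\to\mathfrak{g}(-r+k)\otimes\mathfrak{g}(r)$, $\tau_k(X)=\frac1{k!}(\mathrm{ad}(X)^k\otimes\mathrm{Id})\omega$. For $Y^*\in\mathfrak{g}(-r+k)^*\otimes\mathfrak{g}(r)^*$ (duals taken via $\kappa$), $\tilde\tau_k(Y^* )(X)=Y^*(\tau_k(X))$ is a homogeneous polynomial of degree $k$ on $\mathfrak{g}(1)$, i.e. an element of $\mathrm{Sym}^k(\mathfrak{g}(-1))$ via $\kappa$, and $\Omega_k(Y^* )=R(\sigma(\tilde\tau_k(Y^*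 )))$ with $\sigma:\mathrm{Sym}^k(\mathfrak{g}(-1))\to\mathcal{U}(\bar{\mathfrak{n}})$ symmetrization. *)

(* Defs.v *)
From mathcomp Require Import all_boot all_order all_algebra all_fingroup.
From mathcomp Require Import complex.
From mathcomp Require Import all_classical all_reals all_analysis.
Set Implicit Arguments.
Unset Strict Implicit.
Unset Printing Implicit Defensive.
Import Order.TTheory GRing.Theory Num.Theory.
Import numFieldNormedType.Exports.

Local Open Scope classical_set_scope.
Local Open Scope ring_scope.
Local Open Scope complex_scope.

(** * Finite-dimensional Lie algebras *)

Record lieAlgebra (K : fieldType) := LieAlgebra {
  lie_sort :> vectType K;
  lie : lie_sort -> lie_sort -> lie_sort;
  lie_linl : forall y, linear (lie ^~ y);
  lie_linr : forall x, linear (lie x);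
  lie_alt : forall x, lie x x = 0;
  lie_jacobi : forall x y z,
    lie x (lie y z) + lie y (lie z x) + lie z (lie x y) = 0
}.

Definition ad (K : fieldType) (g : lieAlgebra K) (x : g) : 'End(g) :=
  linfun (lie x).

Definition ltrace (K : fieldType) (V : vectType K) (f : 'End(V)) : K :=
  \sum_(i < \dim {:V}) coord (vbasis {:V}) i (f (vbasis {:V})`_i).

Definition killing (K : fieldType) (g : lieAlgebra K) (x y : g) : K :=
  ltrace (ad x \o ad y)%VF.

Definition simple_lie (K : fieldType) (g : lieAlgebra K) : Prop :=
  (exists x y : g, lie x y != 0) /\
  (forall I : {vspace g},
     (forall x y, y \in I -> lie x y \in I) -> I = 0%VS \/ I = {:g}%VS).

Definition abelian_sub (K : fieldType) (g : lieAlgebra K) (a : {vspace g}) :=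
  forall x y, x \in a -> y \in a -> lie x y = 0.

Definition ad_semisimple (K : fieldType) (g : lieAlgebra K) (x : g) : Prop :=
  exists e : seq g, basis_of {:g} e /\
    forall y, y \in e -> exists c : K, lie x y = c *: y.

(* Cartan subalgebra of a complex semisimple Lie algebra: a maximal abelian
   subalgebra consisting of ad-semisimple elements *)
Definition cartan (K : fieldType) (g : lieAlgebra K) (h : {vspace g}) : Prop :=
  [/\ abelian_sub h,
      forall a : {vspace g}, abelian_sub a -> (h <= a)%VS -> a = h
    & forall x, x \in h -> ad_semisimple x].

Definition hdual (K : fieldType) (g : lieAlgebra K) (h : {vspace g}) :=
  'Hom(subvs_of h, K^o).

Definition in_rootspace (K : fieldType) (g : lieAlgebra K) (h : {vspace g})
    (a : hdual h) (x : g) : Prop :=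
  forall H : subvs_of h, lie (vsval H) x = (a H : K) *: x.

Definition is_root (K : fieldType) (g : lieAlgebra K) (h : {vspace g})
    (a : hdual h) : Prop :=
  a != 0 /\ exists2 x : g, x != 0 & in_rootspace a x.

Definition nat_comb (K : fieldType) (V : vectType K) (Pi : seq V) (a : V) :=
  exists c : V -> nat, a = \sum_(b <- Pi) b *+ c b.

(* Pi is a base of the root system; this is the same as the choice of a Borel
   subalgebra b containing h, namely h plus the root spaces of positive roots *)
Definition root_base (K : fieldType) (g : lieAlgebra K) (h : {vspace g})
    (Pi : seq (hdual h)) : Prop :=
  [/\ basis_of {:hdual h} Pi,
      forall a, a \in Pi -> is_root a
    & forall a, is_root a -> nat_comb Pi a \/ nat_comb Pi (- a)].

Definition positive_root (K : fieldType) (g : lieAlgebra K) (h : {vspace g})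
    (Pi : seq (hdual h)) (a : hdual h) : Prop :=
  is_root a /\ nat_comb Pi a.

Definition gr (K : fieldType) (g : lieAlgebra K) (H0 : g) (j : int)
    : {vspace g} := passmx.leigenspace (ad H0) j%:~R.

(** * Complex-valued limits, derivatives and smoothness *)

Definition limC (R : realType) (u : nat -> R[i]) : R[i] :=
  lim ((fun n => complex.Re (u n)) @ \oo) +i*
  lim ((fun n => complex.Im (u n)) @ \oo).

Definition derivC (R : realType) (u : R -> R[i]) (t : R) : R[i] :=
  derive1 (fun x => complex.Re (u x)) t +i*
  derive1 (fun x => complex.Im (u x)) t.

Definition vlim (R : realType) (V : vectType R[i]) (u : nat -> V) : V :=
  \sum_(i < \dim {:V})
    limC (fun n => coord (vbasis {:V}) i (u n)) *: (vbasis {:V})`_i.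

Definition lexp (R : realType) (V : vectType R[i]) (A : 'End(V)) : 'End(V) :=
  linfun (fun x => vlim (fun n => \sum_(k < n) (k`!)%:R^-1 *: iter k A x)).

Fixpoint times_diff (R : realType) (V : normedModType R) (U : set V) (n : nat)
    (F : V -> R) : Prop :=
  (forall x, U x -> differentiable F x) /\
  (if n is m.+1 then forall v, times_diff U m ('D_v F) else True).

Definition smooth_on (R : realType) (V : normedModType R) (U : set V)
    (F : V -> R[i]) : Prop :=
  forall n, times_diff U n (fun x => complex.Re (F x)) /\
            times_diff U n (fun x => complex.Im (F x)).

(* real coordinates on a finite-dimensional complex vector space *)
Definition rcoord_point (R : realType) (V : vectType R[i])
    (p : 'rV[R]_(\dim {:V}) * 'rV[R]_(\dim {:V})) : V :=
  \sum_(i < \dim {:V}) (p.1 0 i +i* p.2 0 i) *: (vbasis {:V})`_i.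

(* f is smooth on the (closed embedded) submanifold S of V: around every point
   of S it agrees on S with a smooth function on an open subset of V.
   The values of f outside S are irrelevant. *)
Definition smooth_along (R : realType) (V : vectType R[i]) (S : V -> Prop)
    (f : V -> R[i]) : Prop :=
  forall p, S (rcoord_point p) ->
  exists (U : set ('rV[R]_(\dim {:V}) * 'rV[R]_(\dim {:V})))
         (F : 'rV[R]_(\dim {:V}) * 'rV[R]_(\dim {:V}) -> R[i]),
  [/\ open U, U p, smooth_on U F
    & forall x, U x -> S (rcoord_point x) -> f (rcoord_point x) = F x].

(** * Groups, acting through Ad *)

(* image under Ad of the analytic (connected) subgroup with Lie algebra a *)
Inductive analytic_subgroup (R : realType) (g : lieAlgebra R[i]) (a : g -> Prop)
    : 'End(g) -> Prop :=
| analytic_id : analytic_subgroup a \1%VF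
| analytic_mul u x : analytic_subgroup a u -> a x ->
    analytic_subgroup a (u \o lexp (ad x))%VF.

(* a real form g0, with the (unique) projections of g = g0 + i g0 *)
Record realForm (R : realType) (g : lieAlgebra R[i]) := RealForm {
  rf_in :> g -> Prop;
  rf_re : g -> g;
  rf_im : g -> g;
  rf_lin : forall (a : R) x y, rf_in x -> rf_in y -> rf_in (a%:C *: x + y);
  rf_lie : forall x y, rf_in x -> rf_in y -> rf_in (lie x y);
  rf_reP : forall x, rf_in (rf_re x);
  rf_imP : forall x, rf_in (rf_im x);
  rf_dec : forall x, x = rf_re x + 'i *: rf_im x;
  rf_indep : forall x, rf_in x -> rf_in ('i *: x) -> x = 0
}.

Definition has_real_form (R : realType) (g : lieAlgebra R[i]) (g0 : realForm g)
    (W : {vspace g}) : Prop :=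
  forall x, x \in W -> exists y z,
    [/\ g0 y /\ y \in W, g0 z /\ z \in W & x = y + 'i *: z].

(** * Parabolic subalgebras *)

(* H0 is the element of h on which alq is 1 and the other simple roots vanish,
   so that q, l, n are the sums of the root spaces (and of h, for q and l) for
   which the coefficient of alq is >= 0, = 0, > 0 *)
Definition par_q (K : fieldType) (g : lieAlgebra K) (H0 : g) (r : nat)
    : {vspace g} := (\sum_(j < r.+1) gr H0 j%:Z)%VS.
Definition par_l (K : fieldType) (g : lieAlgebra K) (H0 : g)
    : {vspace g} := gr H0 0.
Definition par_n (K : fieldType) (g : lieAlgebra K) (H0 : g) (r : nat)
    : {vspace g} := (\sum_(j < r) gr H0 j.+1%:Z)%VS.
Definition par_nbar (K : fieldType) (g : lieAlgebra K) (H0 : g) (r : nat)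
    : {vspace g} := (\sum_(j < r) gr H0 (- j.+1%:Z))%VS.

(* 2 <lam, b> / <b, b> is 1 for b = alq and 0 for the other simple roots b,
   where b is represented by t in h through the Killing form *)
Definition fundamental_weight (K : fieldType) (g : lieAlgebra K)
    (h : {vspace g}) (Pi : seq (hdual h)) (alq lam : hdual h) : Prop :=
  forall b, b \in Pi -> forall t : subvs_of h,
    (forall H : subvs_of h, killing (vsval t) (vsval H) = b H) ->
    2%:R * (lam t : K) = (b == alq)%:R * killing (vsval t) (vsval t).

Record parabolicData (R : realType) := ParabolicData {
  pd_g :> lieAlgebra R[i];
  pd_h : {vspace pd_g};
  pd_Pi : seq (hdual pd_h);
  pd_alq : hdual pd_h;
  pd_H0 : subvs_of pd_h;
  pd_r : nat;
  pd_lam : hdual pd_h;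
  (* pd_lam extended to a character of q, as the differential of the character
     chi_q of L extended trivially to N; only its values on q are used *)
  pd_lamq : 'Hom(pd_g, R[i]^o);
  pd_g0 : realForm pd_g;

  pd_simple : simple_lie pd_g;
  pd_cartan : cartan pd_h;
  pd_base : root_base pd_Pi;
  pd_alqP : pd_alq \in pd_Pi;
  pd_H0P : forall b, b \in pd_Pi -> b pd_H0 = (b == pd_alq)%:R;
  pd_gr_top : gr (vsval pd_H0) pd_r%:Z != 0%VS;
  pd_gr_full : (par_nbar (vsval pd_H0) pd_r + par_q (vsval pd_H0) pd_r)%VS
               = {:pd_g}%VS;
  pd_lamP : fundamental_weight pd_Pi pd_alq pd_lam;
  pd_lamq_h : forall H : subvs_of pd_h, pd_lamq (vsval H) = pd_lam H;
  pd_lamq_l : forall x y, x \in par_l (vsval pd_H0) ->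
    y \in par_l (vsval pd_H0) -> pd_lamq (lie x y) = 0;
  pd_lamq_n : forall x, x \in par_n (vsval pd_H0) pd_r -> pd_lamq x = 0;
  pd_q_real : has_real_form pd_g0 (par_q (vsval pd_H0) pd_r);
  pd_l_real : has_real_form pd_g0 (par_l (vsval pd_H0))
}.

Section Operators.
Context {R : realType} (P : parabolicData R).

Definition grd (j : int) : {vspace P} := gr (vsval (pd_H0 P)) j.
Definition qq : {vspace P} := par_q (vsval (pd_H0 P)) (pd_r P).
Definition ll : {vspace P} := par_l (vsval (pd_H0 P)).
Definition nbar : {vspace P} := par_nbar (vsval (pd_H0 P)) (pd_r P).

Definition AdL : 'End(P) -> Prop := analytic_subgroup (fun x : P => x \in ll).

(* Ad is injective on the unipotent group Nbar_0, which is identified with its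
   image, a closed subgroup of GL(g); its identity element is \1 *)
Definition Nbar0 : 'End(P) -> Prop :=
  analytic_subgroup (fun x : P => x \in nbar /\ pd_g0 P x).

(* Functions on Nbar_0 are represented by total functions on End(g). All the
   operators below act on restrictions to Nbar_0. *)
Definition fsec := 'End(P) -> R[i].
Definition oper := fsec -> fsec.

Definition smooth_section (f : fsec) : Prop := smooth_along Nbar0 f.

Definition Rreal (x : P) : oper := fun f a =>
  derivC (fun t : R => f (a \o lexp (ad (t%:C *: x)))%VF) 0.

(* complex-linear extension from nbar_0 to nbar *)
Definition Rop (x : P) : oper := fun f a =>
  Rreal (rf_re (pd_g0 P) x) f a + 'i * Rreal (rf_im (pd_g0 P) x) f a.

Definition pi_s (s : R[i]) (y : P) : oper := fun f a =>
  let z := (a^-1)%VF y in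
  s * (pd_lamq P (daddv_pi qq nbar z) : R[i]) * f a
  - Rop (daddv_pi nbar qq z) f a.

Definition oper_comm (D E : oper) : oper := fun f a =>
  D (E f) a - E (D f) a.

(* D_e lies in the span of the (Ds i)_e, as functionals on smooth sections *)
Definition in_span_e (D : oper) (n : nat) (Ds : 'I_n -> oper) : Prop :=
  exists c : 'I_n -> R[i], forall f, smooth_section f ->
    D f \1%VF = \sum_(i < n) c i * Ds i f \1%VF.

(* R on a product y_1 ... y_k in the enveloping algebra *)
Definition Rprod (ys : seq P) : oper :=
  foldr (fun y (D : oper) => fun f => Rop y (D f)) id ys.

(* R (sigma (y_1 ... y_k)) *)
Definition Rsym (k : nat) (y : 'I_k -> P) : oper := fun f a =>
  (k`!)%:R^-1 * \sum_(w : 'S_k) Rprod [seq y (w t) | t <- enum 'I_k] f a.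

(* the symmetric k-linear form with polar p (x, ..., x) = p x, for p a
   homogeneous polynomial function of degree k *)
Definition polar (k : nat) (p : P -> R[i]) (x : 'I_k -> P) : R[i] :=
  (k`!)%:R^-1 *
  \sum_(S : {set 'I_k}) (-1) ^+ (k - #|S|) * p (\sum_(i in S) x i).

Definition dual_bases (U W : {vspace P}) (n : nat) (e e' : n.-tuple P) : Prop :=
  [/\ basis_of U e, basis_of W e'
    & forall i j : 'I_n, killing (tnth e i) (tnth e' j) = (i == j)%:R].

(* R (sigma p) for p a homogeneous polynomial function of degree k on g(1):
   with e, e' dual bases of g(1), g(-1), the element of Sym^k(g(-1)) given by p
   is the sum of the polar p (e_I1, ..., e_Ik) e'_I1 ... e'_Ik *)
Definition Rsigma (m : nat) (e e' : m.-tuple P) (k : nat) (p : P -> R[i])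
    : oper := fun f a =>
  \sum_(I : {ffun 'I_k -> 'I_m})
    polar p (fun t => tnth e (I t)) * Rsym (fun t => tnth e' (I t)) f a.

(* g(-r+k)^* (x) g(r)^*, as bilinear forms on g(-r+k) x g(r) *)
Definition bidual (k : nat) :=
  'Hom(subvs_of (grd (k%:Z - (pd_r P)%:Z)),
       'Hom(subvs_of (grd (pd_r P)%:Z), R[i]^o)).

Definition bival (k : nat) (Y : bidual k) (x z : P) : R[i] :=
  Y (vsproj _ x) (vsproj _ z).

Definition mkbidual (k : nat) (B : P -> P -> R[i]) : bidual k :=
  linfun (fun x => linfun (fun z => B (vsval x) (vsval z) : R[i]^o)).

Definition bidual_act (k : nat) (a : 'End(P)) (Y : bidual k) : bidual k :=
  mkbidual k (fun x z => bival Y ((a^-1)%VF x) ((a^-1)%VF z)).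

Definition bidual_lie (k : nat) (u : P) (Y : bidual k) : bidual k :=
  mkbidual k (fun x z => - bival Y (lie u x) z - bival Y x (lie u z)).

(* Y^*(tau_k(x)), with xs, xs' the bases (X_j), (X_j^* ) of g(r), g(-r) *)
Definition tautilde (n : nat) (xs xs' : n.-tuple P) (k : nat) (Y : bidual k)
    (x : P) : R[i] :=
  (k`!)%:R^-1 *
  \sum_(j < n) bival Y (iter k (ad x) (tnth xs' j)) (tnth xs j).

Definition Omega (m : nat) (e e' : m.-tuple P) (n : nat) (xs xs' : n.-tuple P)
    (k : nat) (Y : bidual k) : oper :=
  Rsigma e e' k (tautilde xs xs' Y).

Definition irreducible_L (M : vectType R[i]) (act : 'End(P) -> M -> M)
    (V : {vspace M}) : Prop :=
  let stable (W : {vspace M}) :=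
    forall a, AdL a -> forall v, v \in W -> act a v \in W in
  [/\ stable V, V != 0%VS
    & forall W : {vspace M}, stable W -> (W <= V)%VS -> W = 0%VS \/ W = V].

Definition weight_vector (M : vectType R[i]) (dact : P -> M -> M) (v : M) :=
  v != 0 /\ forall H, H \in pd_h P -> exists c : R[i], dact H v = c *: v.

Definition highest_weight_vector (M : vectType R[i]) (dact : P -> M -> M)
    (V : {vspace M}) (v : M) : Prop :=
  [/\ v \in V, weight_vector dact v
    & forall a x, positive_root (pd_Pi P) a -> in_rootspace a x -> x \in ll ->
        dact x v = 0].

Definition lowest_weight_vector (M : vectType R[i]) (dact : P -> M -> M)
    (V : {vspace M}) (v : M) : Prop :=
  [/\ v \in V, weight_vector dact v
    & forall a x, positive_root (pd_Pi P) a -> in_rootspace (- a) x ->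
        x \in ll -> dact x v = 0].

End Operators.

Arguments irreducible_L {R} P {M} act V.
Arguments weight_vector {R} P {M} dact v.
Arguments highest_weight_vector {R} P {M} dact V v.
Arguments lowest_weight_vector {R} P {M} dact V v.
Arguments pi_s {R} P s y f a.

(* Main.v *)
(* Write Phi(X, Y) for the functional [pi_s(X), Omega_k(Y)]_e. An element l of
   the real Levi subgroup acts on sections by f |-> f(l . l^-1), and this carries
   Phi(X, Y) to Phi(l X, l Y) and Omega_k(Y)_e to Omega_k(l Y)_e. Hence the
   tensors in g(1) (x) V^* which Phi sends into the span of the Omega_k(Y_i)_e
   form a subspace stable under the real Levi subgroup, so, differentiating and
   complexifying, under the Lie algebra l. It contains X_h (x) Y_l, which
   generates g(1) (x) V^* over l: the elements of the Borel subalgebra of l act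
   on X_h by scalars, so the y with X_h (x) y in the subspace form a subspace
   stable under it, and Y_l generates V^* under raising operators; thus
   X_h (x) V^* lies in the subspace, and irreducibility of g(1) gives the rest. *)
Require Import Defs.
From HB Require Import structures.
From mathcomp Require Import all_boot all_order all_algebra all_fingroup.
From mathcomp Require Import complex.
From mathcomp Require Import all_classical all_reals all_analysis.
From mathcomp Require Import ring.
Set Implicit Arguments.
Unset Strict Implicit.
Unset Printing Implicit Defensive.
Import Order.TTheory GRing.Theory Num.Theory.
Import numFieldNormedType.Exports.
Local Open Scope classical_set_scope.
Local Open Scope ring_scope.
Local Open Scope complex_scope.

(** The functionals live in an infinite-dimensional dual. The tensors sent into the span are
    therefore recorded by coefficient matrices in bases of [g(1)] and [V]: the subspace they form is
    finite-dimensional, hence closed, and a curve of group translates inside it can be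
    differentiated. For [X] in [g(1)] every [pi_s(X) h] vanishes at the identity, so the commutator
    there is minus [Omega_k(Y) pi_s(X)], and covariance of [Omega_k] is needed at the identity only.
    It rests on two facts about dual bases: [omega] is invariant, and the matrices of [Ad(l)] on
    [g(-1)] and of its inverse on [g(1)] are transposes. Real forms are assumed for [q] and [l]
    only, while [R] differentiates along real and imaginary parts of elements of [nbar]. That these
    stay in [nbar] comes from [H0] being real, since it spans the centre of [l]. The group theory is
    reduced to exponential series: automorphisms, inverses and dual actions all come from exp(C)
    beta(u, v) = beta(exp(A) u, exp(B) v), valid when [C] acts on a bilinear [beta] by the Leibniz
    rule with [A] and [B]. *)

(** Evaluates [linfun] from a bare proof of linearity, so that functions defined on the spot need no
    canonical linear structure. *)
Lemma linfun_lin (K : fieldType) (V W : vectType K) (f : V -> W) :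
  linear f -> forall x, linfun f x = f x.
Proof.
move=> lin x; pose isl := GRing.isLinear.Build _ _ _ _ _ lin.
pose L : {linear V -> W} := HB.pack f isl.
exact: (lfunE L).
Qed.

(** * Real-linear functionals and convergence *)

Section RealCoordinates.
Context {R : realType} (V : vectType R[i]).

(** Limits and derivatives in [V] are tested against these real-valued functionals, so that all
    analysis takes place in [R] and [V] carries no topology. *)
Definition rlinear (phi : V -> R) :=
  forall (a : R) x y, phi (a%:C *: x + y) = a * phi x + phi y.

Lemma rlin0 phi : rlinear phi -> phi 0 = 0.
Proof.
by move=> h; have := h 1 0 0; rewrite scaler0 addr0 mul1r => /eqP;
  rewrite -subr_eq subrr eq_sym => /eqP.
Qed.

Lemma rlinD phi : rlinear phi -> {morph phi : x y / x + y}.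
Proof. by move=> h x y; rewrite -[x]scale1r (h 1) mul1r scale1r. Qed.

Lemma rlinZ phi : rlinear phi -> forall (a : R) x, phi (a%:C *: x) = a * phi x.
Proof. by move=> h a x; rewrite -[_ *: _]addr0 h rlin0 // addr0. Qed.

Lemma rlin_sum phi : rlinear phi -> forall I (r : seq I) (P : pred I) F,
  phi (\sum_(i <- r | P i) F i) = \sum_(i <- r | P i) phi (F i).
Proof. by move=> h I r P F; apply: (big_morph phi (rlinD h) (rlin0 h)). Qed.

Notation rix := ('I_(\dim {:V}) * bool)%type.

Definition rc (p : rix) (x : V) : R :=
  let c := coord (vbasis {:V}) p.1 x in if p.2 then complex.Re c else complex.Im c.

Definition rb (p : rix) : V :=
  if p.2 then (vbasis {:V})`_(p.1) else 'i *: (vbasis {:V})`_(p.1).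

Lemma rc_rlin p : rlinear (rc p).
Proof.
move=> a x y; rewrite /rc linearP /=.
case: (coord _ _ x) => u v; case: (coord _ _ y) => u' v'.
by case: p.2; rewrite /= mul0r ?subr0 ?addr0.
Qed.

Lemma rc_expand x : x = \sum_p (rc p x)%:C *: rb p.
Proof.
rewrite [LHS](coord_vbasis (memvf x)).
rewrite -(pair_bigA _ (fun i b => (rc (i, b) x)%:C *: rb (i, b))) /=.
apply: eq_bigr => i _; rewrite big_bool /= /rc /rb /= scalerA -scalerDl.
by congr (_ *: _); rewrite {1}[coord _ _ _]complexE mulrC [_ * 'i]mulrC.
Qed.

Lemma rc_rb p q : rc p (rb q) = (p == q)%:R.
Proof.
have fb : free (vbasis {:V}) := basis_free (vbasisP _).
case: p q => i b [j c]; rewrite /rc /rb /= xpair_eqE.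
have e : coord (vbasis {:V}) i (if c then (vbasis {:V})`_j else 'i *: (vbasis {:V})`_j)
     = (i == j)%:R * (if c then 1 else 'i).
  case: c; rewrite ?linearZ /= coord_free // [j == i]eq_sym ?mulr1 //.
  exact: mulrC.
by rewrite {}e; case: (i == j); case: b; case: c; rewrite ?mul1r ?mul0r.
Qed.

Lemma rlin_expand phi : rlinear phi -> forall x,
  phi x = \sum_p rc p x * phi (rb p).
Proof.
move=> h x; rewrite {1}[x]rc_expand rlin_sum //; apply: eq_bigr => p _.
exact: rlinZ.
Qed.

Lemma rc_inj x y : (forall p, rc p x = rc p y) -> x = y.
Proof.
move=> h; rewrite [x]rc_expand [y]rc_expand.
by apply: eq_bigr => p _; rewrite h.
Qed.

Lemma rlin_sep x y : (forall phi, rlinear phi -> phi x = phi y) -> x = y.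
Proof. by move=> h; apply: rc_inj => p; apply/h/rc_rlin. Qed.

Definition rnorm x : R := \sum_p `|rc p x|.

Lemma rnorm_ge0 x : 0 <= rnorm x.
Proof. exact: sumr_ge0. Qed.

Lemma rlin_bound phi : rlinear phi -> forall x,
  `|phi x| <= (\sum_p `|phi (rb p)|) * rnorm x.
Proof.
move=> h x; rewrite (rlin_expand h) (le_trans (ler_norm_sum _ _ _)) //.
rewrite mulr_sumr; apply: ler_sum => p _; rewrite normrM mulrC.
by rewrite ler_wpM2r // (bigD1 p) //= lerDl sumr_ge0.
Qed.

Definition vcvg (u : nat -> V) (x : V) :=
  forall phi, rlinear phi -> (phi \o u) @ \oo --> phi x.

Lemma vcvg_coord u x : (forall p, (rc p \o u) @ \oo --> rc p x) -> vcvg u x.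
Proof.
move=> h phi hphi.
rewrite (rlin_expand hphi).
have -> : phi \o u = fun n => \sum_p rc p (u n) * phi (rb p).
  by apply/funext => n /=; rewrite (rlin_expand hphi).
apply: cvg_big => [|p _]; first exact: add_continuous.
by apply: cvgMl; exact: h.
Qed.

Lemma vcvg_unique u x y : vcvg u x -> vcvg u y -> x = y.
Proof. by move=> hx hy; apply: rlin_sep => phi h; apply: (cvg_unique _ (hx _ h) (hy _ h)). Qed.

Lemma vlim_eq u x : vcvg u x -> vlim u = x.
Proof.
move=> h; rewrite /vlim [RHS](coord_vbasis (memvf x)).
apply: eq_bigr => i _; congr (_ *: _).
have h1 := h _ (rc_rlin (i, true)); have h2 := h _ (rc_rlin (i, false)).
rewrite /limC (cvg_lim _ h1) // (cvg_lim _ h2) // /rc /=.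
by case: (coord _ _ _).
Qed.

Lemma vcvg_cst x : vcvg (fun=> x) x.
Proof. by move=> phi h; exact: cvg_cst. Qed.

End RealCoordinates.

Lemma rlin_comp (R : realType) (V W : vectType R[i]) (T : V -> W) phi :
  linear T -> rlinear phi -> rlinear (phi \o T).
Proof. by move=> hT h a x y /=; rewrite hT h. Qed.

Lemma vcvg_lin (R : realType) (V W : vectType R[i]) (T : V -> W) u x :
  linear T -> vcvg u x -> vcvg (T \o u) (T x).
Proof. by move=> hT h phi hphi; exact: (h _ (rlin_comp hT hphi)). Qed.

(** Subspaces are closed: [W] is the kernel of the linear map [\1 - projv W], and linear maps
    preserve convergence. *)
Lemma vcvg_mem (R : realType) (V : vectType R[i]) (W : {vspace V}) u x :
  vcvg u x -> (forall n, u n \in W) -> x \in W.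
Proof.
move=> h hu.
have hT : linear (\1%VF - projv W : 'End(V)) by apply: linearP.
have := vcvg_lin hT h.
have -> : (\1%VF - projv W : 'End(V)) \o u = fun=> 0.
  apply/funext => n /=.
  by rewrite add_lfunE opp_lfunE id_lfunE projv_id // subrr.
move=> /(vcvg_unique (@vcvg_cst _ _ 0)) /eqP.
by rewrite add_lfunE opp_lfunE id_lfunE eq_sym subr_eq0 => /eqP ->; apply: memv_proj.
Qed.

(** Spares differentiating power series term by term: the exponential only has to be compared with
    its first-order Taylor polynomial. *)
Lemma is_derive_quadratic (R : realType) (g : R -> R) (c K : R) :
  (forall t, `|t| <= 1 -> `|g t - g 0 - t * c| <= K * t ^+ 2) ->
  is_derive (0 : R) (1 : R) g c.
Proof.
move=> h.
have h1 : (fun t : R => t^-1 *: (g (t *: 1 + 0) - g 0)) @ 0^' --> c.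
  apply/cvgrPdist_le => eps e0.
  near=> t.
  have t0 : t != 0 by near: t; exact: nbhs_dnbhs_neq.
  have t1 : `|t| <= 1.
    by near: t; apply: dnbhs0_le.
  (* The sign of [K] is arbitrary, so the threshold uses the positive number [|K| + 1]. *)
  have t2 : `|t| <= eps / (`|K| + 1).
    near: t; apply: dnbhs0_le.
    by rewrite divr_gt0 // ltr_wpDl.
  rewrite addr0 [_%:A]mulr1.
  have -> : c - t^-1 *: (g t - g 0) = - (t^-1 * (g t - g 0 - t * c)).
    by rewrite /GRing.scale /=; field.
  rewrite normrN normrM normfV ler_pdivrMl ?normr_gt0 //.
  apply: (le_trans (h _ t1)).
  rewrite -normr_id -[X in _ * X]ger0_norm ?sqr_ge0 // normrX normr_id.
  apply: (@le_trans _ _ (`|t| * ((`|K| + 1) * `|t|))).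
    rewrite [leRHS](_ : _ = (`|K| + 1) * `|t| ^+ 2); last by ring.
    by rewrite ler_wpM2r ?sqr_ge0 // (le_trans (ler_norm K)) // lerDl.
  by rewrite ler_wpM2l // mulrC -ler_pdivlMr // ltr_wpDl.
split; first by apply/cvg_ex; exists c.
exact: cvg_lim h1.
Unshelve. all: by end_near.
Qed.

(** * The exponential of an endomorphism *)

Section Exponential.
Context {R : realType}.

Definition exp_sum (V : vectType R[i]) (A : 'End(V)) (x : V) (n : nat) : V :=
  \sum_(k < n) (k`!)%:R^-1 *: iter k A x.

Lemma invr_factC (k : nat) : (k`!%:R : R[i])^-1 = (k`!%:R^-1 : R)%:C.
Proof. by rewrite fmorphV rmorph_nat. Qed.

Lemma rlin_exp_sum (V : vectType R[i]) (A : 'End(V)) x phi n : rlinear phi ->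
  phi (exp_sum A x n) = \sum_(0 <= k < n) k`!%:R^-1 * phi (iter k A x).
Proof.
move=> h; rewrite rlin_sum // big_mkord; apply: eq_bigr => k _.
by rewrite invr_factC rlinZ.
Qed.

Definition opbound (V : vectType R[i]) (A : 'End(V)) : R := \sum_p rnorm (A (rb p)).

Lemma opbound_ge0 (V : vectType R[i]) (A : 'End(V)) : 0 <= opbound A.
Proof. by apply: sumr_ge0 => p _; apply: rnorm_ge0. Qed.

Lemma rnorm_op (V : vectType R[i]) (A : 'End(V)) x :
  rnorm (A x) <= opbound A * rnorm x.
Proof.
rewrite /rnorm /opbound /rnorm exchange_big mulr_suml; apply: ler_sum => q _.
by have h := rlin_comp (linearP A) (rc_rlin q); apply: (rlin_bound h).
Qed.

Lemma rnorm_iter (V : vectType R[i]) (A : 'End(V)) k x :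
  rnorm (iter k A x) <= opbound A ^+ k * rnorm x.
Proof.
elim: k => [|k IH]; first by rewrite mul1r.
rewrite iterS (le_trans (rnorm_op _ _)) // exprS -mulrA.
by rewrite ler_wpM2l ?opbound_ge0.
Qed.

(** The terms are dominated by [M] times those of the real exponential series at [opbound A]. *)
Lemma exp_sum_cvg (V : vectType R[i]) (A : 'End(V)) x phi : rlinear phi ->
  cvgn (phi \o exp_sum A x).
Proof.
move=> h; set M := (\sum_p `|phi (rb p)|) * rnorm x.
have M0 : 0 <= M by rewrite mulr_ge0 ?rnorm_ge0 ?sumr_ge0.
have -> : phi \o exp_sum A x = series (fun k => k`!%:R^-1 * phi (iter k A x)).
  by apply/funext => n /=; rewrite rlin_exp_sum.
apply: normed_cvg.
apply: (@series_le_cvg _ _ (M *: exp_coeff (opbound A))).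
- by move=> n /=.
- by move=> n /=; rewrite mulr_ge0 // exp_coeff_ge0 // opbound_ge0.
- move=> n /=; rewrite normrM ger0_norm ?invr_ge0 //.
  rewrite [leRHS](_ : _ = n`!%:R^-1 * (M * opbound A ^+ n)); last first.
    by rewrite /exp_coeff /GRing.scale /= /GRing.scale /=; ring.
  rewrite ler_wpM2l ?invr_ge0 // (le_trans (rlin_bound h _)) //.
  by rewrite /M -mulrA ler_wpM2l ?sumr_ge0 // mulrC; exact: rnorm_iter.
- by apply: is_cvg_seriesZ; exact: is_cvg_series_exp_coeff.
Qed.

Lemma exp_sum_vcvg (V : vectType R[i]) (A : 'End(V)) x :
  vcvg (exp_sum A x) (vlim (exp_sum A x)).
Proof.
(* The limit is assembled from its real coordinates; [vlim_eq] then identifies it with [vlim]. *)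
pose y := \sum_p (limn (rc p \o exp_sum A x))%:C *: rb p.
suff h : vcvg (exp_sum A x) y by rewrite (vlim_eq h).
apply: vcvg_coord => p.
suff -> : rc p y = limn (rc p \o exp_sum A x).
  exact/exp_sum_cvg/rc_rlin.
rewrite rlin_sum; last exact: rc_rlin.
rewrite (bigD1 p) //= rlinZ; last exact: rc_rlin.
rewrite rc_rb eqxx mulr1 big1 ?addr0 // => q /negPf qp.
rewrite rlinZ; last exact: rc_rlin.
by rewrite rc_rb eq_sym qp mulr0.
Qed.

Lemma iter_lin (V : vectType R[i]) (A : 'End(V)) k : linear (iter k A).
Proof. by elim: k => [//|k IH] a x y; rewrite !iterS IH linearP. Qed.

Lemma lexp_vcvg (V : vectType R[i]) (A : 'End(V)) x :
  vcvg (exp_sum A x) (lexp A x).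
Proof.
(* [lexp] is a [linfun], so its value at [x] is known only once the limit is shown to be linear in
   [x]. *)
have lin : linear (fun x => vlim (exp_sum A x)).
  move=> a u v; apply: vlim_eq => phi h.
  have hs : rlinear (phi \o [eta *:%R a]).
    by apply: rlin_comp => // c w w' /=; rewrite scalerDr !scalerA mulrC.
  have -> : phi \o exp_sum A (a *: u + v) =
    (phi \o [eta *:%R a] \o exp_sum A u) \+ (phi \o exp_sum A v).
    apply/funext => n /=; rewrite -rlinD //; congr phi.
    rewrite /exp_sum scaler_sumr -big_split /=; apply: eq_bigr => k _.
    by rewrite iter_lin scalerDr scalerA mulrC -scalerA.
  rewrite rlinD //; apply: cvgD; last exact: exp_sum_vcvg.
  exact: (exp_sum_vcvg (A := A) hs).
have -> : lexp A x = vlim (exp_sum A x) by apply: linfun_lin.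
exact: exp_sum_vcvg.
Qed.

Arguments lexp_vcvg {V} A x [phi] _.

Lemma lexp_mem (V : vectType R[i]) (A : 'End(V)) (W : {vspace V}) :
  (forall w, w \in W -> A w \in W) -> forall w, w \in W -> lexp A w \in W.
Proof.
move=> h w hw; apply: (vcvg_mem (lexp_vcvg A w)) => n.
apply: memv_suml => k _; apply: memvZ.
by elim: (nat_of_ord k) => //= j; apply: h.
Qed.

Lemma lexp_fix (V W : vectType R[i]) (A : 'End(V)) (T : V -> W) x :
  linear T -> (forall k, T (iter k.+1 A x) = 0) -> T (lexp A x) = T x.
Proof.
move=> hT h; apply: rlin_sep => phi hphi.
have hp := rlin_comp hT hphi.
have h1 := lexp_vcvg A x hp.
suff h2 : (phi \o T \o exp_sum A x) @ \oo --> phi (T x) by apply: (cvg_unique _ h1 h2).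
(* The partial sum of index 0 is empty, so the sequence is constant only after a shift by one. *)
rewrite -(cvg_shiftn 1).
have -> : [sequence (phi \o T \o exp_sum A x) (n + 1)%N]_n = fun=> phi (T x).
  apply/funext => n; rewrite /= -[phi (T _)]/((phi \o T) _) rlin_exp_sum //.
  rewrite addn1 big_nat_recl //= fact0 invr1 mul1r big1 ?addr0 // => i _.
  by rewrite h rlin0 // mulr0.
exact: cvg_cst.
Qed.

Lemma lexp0 (V : vectType R[i]) (x : V) : lexp 0 x = x.
Proof.
by apply: (@lexp_fix _ _ _ id) => // k; rewrite iterS zero_lfunE.
Qed.

Lemma lexp_intertwine (V W : vectType R[i]) (A : 'End(V)) (B : 'End(W))
    (T : V -> W) x :
  linear T -> (forall k, T (iter k A x) = iter k B (T x)) ->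
  T (lexp A x) = lexp B (T x).
Proof.
move=> hT h; have h1 := vcvg_lin hT (lexp_vcvg A x).
apply: (vcvg_unique h1); have -> : T \o exp_sum A x = exp_sum B (T x).
  apply/funext => n; rewrite /= /exp_sum -(linfun_lin hT) linear_sum.
  by apply: eq_bigr => k _; rewrite linearZ /= linfun_lin // h.
exact: lexp_vcvg.
Qed.

(** For [|t| <= 1] one has [|t|^k <= t^2] when [k >= 2], so the series from degree 2 on is at most
    [M * t^2] times the exponential of [opbound A]: a quadratic remainder. *)
Lemma lexp_derive (V : vectType R[i]) (A : 'End(V)) x phi : rlinear phi ->
  is_derive (0 : R) (1 : R) (fun t : R => phi (lexp (t%:C *: A) x)) (phi (A x)).
Proof.
move=> h; set M := (\sum_p `|phi (rb p)|) * rnorm x.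
have M0 : 0 <= M by rewrite mulr_ge0 ?rnorm_ge0 ?sumr_ge0.
have itZ (t : R) k : iter k (t%:C *: A) x = (t ^+ k)%:C *: iter k A x.
  elim: k => [|k IH]; first by rewrite expr0 scale1r.
  by rewrite !iterS IH scale_lfunE linearZ scalerA /= exprS rmorphM.
apply: (@is_derive_quadratic _ _ _ (M * expR (opbound A))) => t t1.
have -> : (0 : R)%:C *: A = 0 by rewrite scale0r.
rewrite lexp0.
have h1 := lexp_vcvg (t%:C *: A) x h.
have h2 : (fun n => phi (exp_sum (t%:C *: A) x n) - phi x - t * phi (A x)) @ \oo
   --> phi (lexp (t%:C *: A) x) - phi x - t * phi (A x).
  by apply: cvgB; [apply: cvgB => //; exact: cvg_cst | exact: cvg_cst].
have h3 := cvg_norm h2 _.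
apply: (ler_cvg_to (h3 _) (@cvg_cst R _ _ _ _)); near=> n.
have n2 : (2 <= n)%N by near: n; exists 2%N.
rewrite rlin_exp_sum //.
rewrite big_ltn ?(leq_trans _ n2) // big_ltn ?(leq_trans _ n2) //.
have -> : 0`!%:R^-1 * phi (iter 0 (t%:C *: A) x) = phi x.
  by rewrite fact0 invr1 mul1r.
have -> : 1`!%:R^-1 * phi (iter 1 (t%:C *: A) x) = t * phi (A x).
  by rewrite invr1 mul1r itZ expr1 rlinZ.
set sm := \sum_(2 <= i < n) _.
have -> : phi x + (t * phi (A x) + sm) - phi x - t * phi (A x) = sm by ring.
rewrite {}/sm.
apply: (le_trans (ler_norm_sum _ _ _)).
apply: (@le_trans _ _ (\sum_(2 <= k < n) M * t ^+ 2 * exp_coeff (opbound A) k)).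
  rewrite big_nat_cond [leRHS]big_nat_cond; apply: ler_sum => k.
  rewrite andbT => /andP[k2 _].
  rewrite itZ rlinZ // !normrM ger0_norm ?invr_ge0 // /exp_coeff /=.
  rewrite normrX.
  rewrite [leRHS](_ : _ = k`!%:R^-1 * (t ^+ 2 * (M * opbound A ^+ k))); last by ring.
  rewrite ler_wpM2l ?invr_ge0 //; apply: ler_pM => //.
  - by rewrite -[leRHS]ger0_norm ?sqr_ge0 // normrX ler_wiXn2l.
  - apply: (le_trans (rlin_bound h _)).
    rewrite /M -mulrA ler_wpM2l ?sumr_ge0 // mulrC; exact: rnorm_iter.
rewrite -mulr_sumr -mulrA [leRHS]mulrAC -[leRHS]mulrA.
rewrite ler_wpM2l // ler_wpM2l ?sqr_ge0 //.
apply: (@le_trans _ _ (series (exp_coeff (opbound A)) n)).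
  rewrite /series /= [leRHS](@big_cat_nat _ _ _ 2) //= lerDr.
  by apply: sumr_ge0 => i _; rewrite exp_coeff_ge0 ?opbound_ge0.
apply: nondecreasing_cvgn_le; last exact: is_cvg_series_exp_coeff.
apply: nondecreasing_series => i _ _.
by rewrite exp_coeff_ge0 ?opbound_ge0.
Unshelve. all: by end_near.
Qed.

(** Both sides run over the triangle [i + j < n], by antidiagonals on the left and by rows on the
    right. *)
Lemma triangle_sum (n : nat) (t : nat -> nat -> R) :
  \sum_(0 <= k < n) \sum_(0 <= i < k.+1) t i (k - i)%N =
  \sum_(0 <= i < n) \sum_(0 <= j < n - i) t i j.
Proof.
rewrite big_mkord.
transitivity (\sum_(k < n) \sum_(i < n | (i <= k)%N) t i (k - i)%N).
  apply: eq_bigr => k _; rewrite big_mkord.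
  by rewrite (big_ord_widen _ (fun i : nat => t i (k - i)%N) (ltn_ord k)).
rewrite (exchange_big_dep xpredT) //= big_mkord; apply: eq_bigr => i _.
rewrite -(big_mkord (fun k => (i <= k)%N) (fun k => t i (k - i)%N)).
rewrite (@big_cat_nat _ _ _ i) //=; last exact: ltnW.
rewrite big_nat_cond big1 ?add0r; last first.
  by move=> k /andP[/andP[_ ki] ik]; rewrite ltnNge ik in ki.
rewrite -{1}[val i]add0n big_addn big_nat_cond [RHS]big_nat_cond.
by apply: eq_big => [k|k _]; rewrite ?leq_addl ?addnK // andbT.
Qed.

(** Square minus triangle is the sum over the complementary corner [i + j >= n], and a termwise
    majorant passes to it. *)
Lemma cauchy_diff_le (n : nat) (t T : nat -> nat -> R) :
  (forall i j, `|t i j| <= T i j) ->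
  `|\sum_(0 <= i < n) \sum_(0 <= j < n) t i j
    - \sum_(0 <= k < n) \sum_(0 <= i < k.+1) t i (k - i)%N| <=
  \sum_(0 <= i < n) \sum_(0 <= j < n) T i j
    - \sum_(0 <= k < n) \sum_(0 <= i < k.+1) T i (k - i)%N.
Proof.
move=> h; rewrite !triangle_sum.
have e (s : nat -> nat -> R) : \sum_(0 <= i < n) \sum_(0 <= j < n) s i j
    - \sum_(0 <= i < n) \sum_(0 <= j < n - i) s i j =
   \sum_(0 <= i < n) \sum_(n - i <= j < n) s i j.
  rewrite -sumrB; apply: eq_bigr => i _.
  rewrite [X in X - _](@big_cat_nat _ _ _ (n - i)) //= ?leq_subr //.
  by rewrite addrAC subrr add0r.
rewrite !e; apply: (le_trans (ler_norm_sum _ _ _)); apply: ler_sum => i _.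
apply: (le_trans (ler_norm_sum _ _ _)); apply: ler_sum => j _; exact: h.
Qed.

(** The square is a product of partial sums for [a] and [b]; by the binomial theorem the triangle is
    the partial sum for [a + b]. The limit vanishes by the addition theorem for [expR]. *)
Lemma exp_coeff_cauchy_cvg0 (a b : R) :
  (fun n => \sum_(0 <= i < n) \sum_(0 <= j < n) exp_coeff a i * exp_coeff b j
    - \sum_(0 <= k < n) \sum_(0 <= i < k.+1)
        exp_coeff a i * exp_coeff b (k - i)%N) @ \oo --> (0 : R).
Proof.
have e n : \sum_(0 <= i < n) \sum_(0 <= j < n) exp_coeff a i * exp_coeff b j
    - \sum_(0 <= k < n) \sum_(0 <= i < k.+1) exp_coeff a i * exp_coeff b (k - i)%N
  = series (exp_coeff a) n * series (exp_coeff b) n - series (exp_coeff (a + b)) n.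
  congr (_ - _).
    rewrite /series /= mulr_suml; apply: eq_bigr => i _.
    by rewrite mulr_sumr.
  apply: eq_bigr => k _; rewrite /exp_coeff /= exprDn_comm; last exact: mulrC.
  rewrite big_mkord mulr_suml -(big_mkord xpredT (fun i => a ^+ i / i`!%:R * (b ^+ (k - i) / (k - i)`!%:R))).
  rewrite big_nat_rev /= big_mkord; apply: eq_bigr => i _.
  have ik : (i <= k)%N by rewrite -ltnS.
  rewrite add0n subSS subKn // -mulr_natr.
  rewrite -[k in X in _ = _ / X](subnK ik).
  have /(congr1 (fun m => m%:R : R)) := bin_fact ik; rewrite !natrM => hf.
  have f0 (m : nat) : (m`!%:R : R) != 0 by rewrite pnatr_eq0 -lt0n fact_gt0.
  rewrite (subnK ik) -hf -(mulrA (a ^+ _)) invfM invfM.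
  have b0 : ('C(k, i)%:R : R) != 0 by rewrite pnatr_eq0 -lt0n bin_gt0.
  by field; rewrite b0 !f0.
rewrite (_ : (fun n => _) = fun n => series (exp_coeff a) n * series (exp_coeff b) n
   - series (exp_coeff (a + b)) n); last by apply/funext => n; rewrite e.
rewrite -(subrr (expR (a + b))); apply: cvgB; last exact: is_cvg_series_exp_coeff.
rewrite expRD; apply: cvgM; exact: is_cvg_series_exp_coeff.
Qed.

(** * Exponentials of operators obeying a Leibniz rule *)

Section BilinearExp.
Context (V1 V2 V3 : vectType R[i]) (beta : V1 -> V2 -> V3).
Hypothesis linl : forall v, linear (beta^~ v).
Hypothesis linr : forall u, linear (beta u).

Lemma bil_expand phi : rlinear phi -> forall x y,
  phi (beta x y) = \sum_p \sum_q rc p x * (rc q y * phi (beta (rb p) (rb q))).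
Proof.
move=> h x y; rewrite [LHS](rlin_expand (rlin_comp (linl y) h) x).
apply: eq_bigr => p _; rewrite -mulr_sumr; congr (_ * _).
exact: (rlin_expand (rlin_comp (linr _) h) y).
Qed.

Lemma bil_bound phi : rlinear phi -> exists2 M : R, 0 <= M &
  forall x y, `|phi (beta x y)| <= M * (rnorm x * rnorm y).
Proof.
move=> h; exists (\sum_p \sum_q `|phi (beta (rb p) (rb q))|).
  by apply: sumr_ge0 => p _; apply: sumr_ge0.
move=> x y; apply: (le_trans (rlin_bound (rlin_comp (linl y) h) x)).
rewrite [leRHS]mulrA mulrAC ler_wpM2r ?rnorm_ge0 //.
rewrite mulr_suml; apply: ler_sum => p _.
exact: (rlin_bound (rlin_comp (linr _) h) y).
Qed.

Lemma bil_vcvg u v x y : vcvg u x -> vcvg v y ->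
  vcvg (fun n => beta (u n) (v n)) (beta x y).
Proof.
move=> hu hv phi h; rewrite (bil_expand h).
have -> : phi \o (fun n => beta (u n) (v n)) =
  fun n => \sum_p \sum_q rc p (u n) * (rc q (v n) * phi (beta (rb p) (rb q))).
  by apply/funext => n /=; rewrite (bil_expand h).
apply: cvg_big => [|p _]; first exact: add_continuous.
apply: cvg_big => [|q _]; first exact: add_continuous.
apply: cvgM; first exact: (hu _ (rc_rlin p)).
by apply: cvgMl; exact: (hv _ (rc_rlin q)).
Qed.

Context (A : 'End(V1)) (B : 'End(V2)) (C : 'End(V3)).
Hypothesis leib : forall u v, C (beta u v) = beta (A u) v + beta u (B v).

Lemma leibniz k u v : k`!%:R^-1 *: iter k C (beta u v) =
  \sum_(0 <= i < k.+1) (i`!%:R^-1 * (k - i)`!%:R^-1) *: beta (iter i A u) (iter (k - i) B v).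
Proof.
have f0 (m : nat) : (m`!%:R : R[i]) != 0 by rewrite pnatr_eq0 -lt0n fact_gt0.
have n0 (m : nat) : (m.+1%:R : R[i]) != 0 by rewrite pnatr_eq0.
have fS (m : nat) : (m`!%:R : R[i])^-1 = m.+1%:R * m.+1`!%:R^-1.
  by rewrite factS natrM invfM mulrA divff // mul1r.
elim: k => [|k IH].
  by rewrite big_nat1 fact0 invr1 mulr1.
have -> : k.+1`!%:R^-1 *: iter k.+1 C (beta u v) =
   k.+1%:R^-1 *: C (k`!%:R^-1 *: iter k C (beta u v)).
  by rewrite linearZ scalerA factS natrM invfM.
rewrite IH linear_sum /=.
pose t i : V3 := (i`!%:R^-1 * (k.+1 - i)`!%:R^-1) *: beta (iter i A u) (iter (k.+1 - i) B v).
apply: (scalerI (n0 k)); rewrite scalerA mulfV // scale1r.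
rewrite -[RHS]/(k.+1%:R *: \sum_(0 <= i < k.+2) t i).
transitivity (\sum_(0 <= i < k.+1) (i.+1%:R *: t i.+1 + (k.+1 - i)%:R *: t i)).
  rewrite big_nat_cond [RHS]big_nat_cond; apply: eq_bigr => i.
  rewrite andbT ltnS => /= ik.
  rewrite linearZ /= leib scalerDr /t subSS subSn //; congr (_ + _).
    by rewrite scalerA mulrA -fS.
  by rewrite scalerA mulrCA -fS.
rewrite big_split /= scaler_sumr.
(* Writing [k.+1] as [i + (k.+1 - i)] separates the terms where the last operator hits the first
   factor from those where it hits the second. *)
have -> : \sum_(0 <= i < k.+2) k.+1%:R *: t i =
   \sum_(0 <= i < k.+2) i%:R *: t i + \sum_(0 <= i < k.+2) (k.+1 - i)%:R *: t i.
  rewrite -big_split /= big_nat_cond [RHS]big_nat_cond; apply: eq_bigr => i.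
  by rewrite andbT ltnS => /= ik; rewrite -scalerDl -natrD subnKC.
congr (_ + _).
  by rewrite [RHS]big_nat_recl //= scale0r add0r.
by rewrite [RHS]big_nat_recr //= subnn scale0r addr0.
Qed.

(** Partial sums on the left are triangles, those on the right squares, of the same array [t]. Their
    difference is bounded by a constant times the same difference for two scalar exponential series,
    which tends to 0. *)
Lemma lexp_bil u v : lexp C (beta u v) = beta (lexp A u) (lexp B v).
Proof.
apply: rlin_sep => phi h.
pose t i j : R := i`!%:R^-1 * j`!%:R^-1 * phi (beta (iter i A u) (iter j B v)).
have hC n : phi (exp_sum C (beta u v) n) =
    \sum_(0 <= k < n) \sum_(0 <= i < k.+1) t i (k - i)%N.
  rewrite rlin_sum // -(big_mkord xpredT (fun k => phi (k`!%:R^-1 *: iter k C (beta u v)))).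
  apply: eq_bigr => k _; rewrite leibniz rlin_sum //; apply: eq_bigr => i _.
  by rewrite !invr_factC -rmorphM rlinZ.
have hAB n : phi (beta (exp_sum A u n) (exp_sum B v n)) =
    \sum_(0 <= i < n) \sum_(0 <= j < n) t i j.
  rewrite [LHS](rlin_exp_sum _ _ _ (rlin_comp (linl _) h)); apply: eq_bigr => i _.
  rewrite [X in _ * X](rlin_exp_sum _ _ _ (rlin_comp (linr _) h)) mulr_sumr.
  by apply: eq_bigr => j _; rewrite /t mulrA.
have [M M0 hM] := bil_bound h.
pose a := opbound A; pose b := opbound B; pose K := M * (rnorm u * rnorm v).
have ht i j : `|t i j| <= K * (exp_coeff a i * exp_coeff b j).
  rewrite /t normrM ger0_norm ?mulr_ge0 ?invr_ge0 //.
  have -> : K * (exp_coeff a i * exp_coeff b j) =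
    i`!%:R^-1 * j`!%:R^-1 * (M * ((a ^+ i * rnorm u) * (b ^+ j * rnorm v))).
    by rewrite /K /exp_coeff /=; ring.
  rewrite ler_wpM2l ?mulr_ge0 ?invr_ge0 // (le_trans (hM _ _)) // ler_wpM2l //.
  by apply: ler_pM; rewrite ?rnorm_ge0 ?rnorm_iter.
have cC := lexp_vcvg C (beta u v) h.
have cAB := bil_vcvg (lexp_vcvg A u) (lexp_vcvg B v) h.
suff cC' : (phi \o exp_sum C (beta u v)) @ \oo --> phi (beta (lexp A u) (lexp B v)).
  exact: (cvg_unique _ cC cC').
have cd : (fun n => phi (beta (exp_sum A u n) (exp_sum B v n)) -
     phi (exp_sum C (beta u v) n)) @ \oo --> (0 : R).
  have c0 : (fun n => K * (\sum_(0 <= i < n) \sum_(0 <= j < n) exp_coeff a i * exp_coeff b j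
    - \sum_(0 <= k < n) \sum_(0 <= i < k.+1)
        exp_coeff a i * exp_coeff b (k - i)%N)) @ \oo --> (0 : R).
    by rewrite -[X in _ --> X](mulr0 K); apply: cvgMr; exact: exp_coeff_cauchy_cvg0.
  apply: norm_cvg0.
  apply: (@squeeze_cvgr _ _ _ _ (fun=> 0) _ _ _ _ (@cvg_cst _ _ _ _ _) c0).
  near=> n; rewrite normr_ge0 /= hAB hC.
  apply: (le_trans (cauchy_diff_le _ ht)).
  rewrite mulrBr !mulr_sumr.
  by under [X in _ <= X - _]eq_bigr do rewrite mulr_sumr; under [X in _ <= _ - X]eq_bigr do rewrite mulr_sumr.
rewrite -[X in _ --> X]subr0.
rewrite (_ : phi \o _ = fun n => phi (beta (exp_sum A u n) (exp_sum B v n)) -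
  (phi (beta (exp_sum A u n) (exp_sum B v n)) - phi (exp_sum C (beta u v) n))); last first.
  by apply/funext => n /=; rewrite opprB addrC subrK.
exact: cvgB.
Unshelve. all: by end_near.
Qed.

End BilinearExp.

Section LexpInv.
Context (V : vectType R[i]) (A : 'End(V)).

Lemma comp_lfun_linl (U W X : vectType R[i]) (f : 'Hom(U, W)) :
  linear (fun g : 'Hom(W, X) => (g \o f)%VF).
Proof. by move=> a g g'; rewrite comp_lfunDl comp_lfunZl. Qed.

Lemma comp_lfun_linr (U W X : vectType R[i]) (f : 'Hom(W, X)) :
  linear (fun g : 'Hom(U, W) => (f \o g)%VF).
Proof. by move=> a g g'; rewrite comp_lfunDr comp_lfunZr. Qed.

(** Presents exp(B) as the orbit of the identity under one linear operator on endomorphisms, so that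
    results about [lexp A x] apply to exponentials as elements of ['End(V)]. *)
Lemma lexp_rmul (B : 'End(V)) :
  lexp (linfun (fun g : 'End(V) => (g \o B)%VF)) \1%VF = lexp B.
Proof.
apply/lfunP => x.
have ev : linear (fun g : 'End(V) => g x).
  by move=> a g g'; rewrite add_lfunE scale_lfunE.
rewrite -[in RHS](id_lfunE x).
apply: (@lexp_intertwine _ _ _ B _ _ ev) => k.
suff h g y : iter k (linfun (fun g : 'End(V) => (g \o B)%VF)) g y = g (iter k B y).
  by rewrite h !id_lfunE.
elim: k g y => //= k IH g y.
by rewrite linfun_lin; [rewrite comp_lfunE IH -iterSr | exact: comp_lfun_linl].
Qed.

(** An instance of [lexp_bil] for the evaluation pairing [g x]: right multiplication by [- A] on [g]
    and [A] on [x] add up to the zero operator on the value. *)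
Lemma lexpNK x : lexp (- A) (lexp A x) = x.
Proof.
pose ev (g : 'End(V)) (x : V) := g x.
have e : ev (lexp (linfun (fun g : 'End(V) => (g \o (- A))%VF)) \1%VF) (lexp A x)
   = lexp 0 (ev \1%VF x).
  symmetry; apply: lexp_bil => [v a g g'|g|g v].
  - by rewrite /ev add_lfunE scale_lfunE.
  - exact: linearP.
  - rewrite zero_lfunE linfun_lin; last exact: comp_lfun_linl.
    by rewrite /ev comp_lfunE opp_lfunE linearN addNr.
by rewrite lexp_rmul lexp0 /ev id_lfunE in e.
Qed.

End LexpInv.

Lemma lexp_ker0 (V : vectType R[i]) (A : 'End(V)) : lker (lexp A) == 0%VS.
Proof. by apply/lker0P; apply: (can_inj (lexpNK A)). Qed.

Lemma lexp_inv (V : vectType R[i]) (A : 'End(V)) : (lexp A)^-1%VF = lexp (- A).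
Proof.
apply/lfunP => x; have {1}-> : x = lexp A (lexp (- A) x).
  by have := lexpNK (- A) x; rewrite opprK.
by rewrite lker0_lfunK // lexp_ker0.
Qed.

End Exponential.
Arguments lexp_vcvg {R V} A x [phi] _.

(** * Lie algebras, roots and real forms *)

Section LieBasics.
Context {K : fieldType} {g : lieAlgebra K}.
Implicit Types x y z : g.

HB.instance Definition _ x :=
  GRing.isLinear.Build K g g *:%R (lie x) (lie_linr x).

Lemma lieDl x y z : lie (x + y) z = lie x z + lie y z.
Proof. by have := lie_linl z 1 x y; rewrite !scale1r. Qed.

Lemma lie0l z : lie 0 z = 0.
Proof. by apply: (addrI (lie 0 z)); rewrite -lieDl !addr0. Qed.

Lemma lieZl a x z : lie (a *: x) z = a *: lie x z.
Proof. by have := lie_linl z a x 0; rewrite lie0l !addr0. Qed.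

Lemma lieNl x z : lie (- x) z = - lie x z.
Proof. by rewrite -scaleN1r lieZl scaleN1r. Qed.

Lemma lie_suml I (r : seq I) (P : pred I) (F : I -> g) z :
  lie (\sum_(i <- r | P i) F i) z = \sum_(i <- r | P i) lie (F i) z.
Proof.
by apply: (big_morph (fun x => lie x z)) => [x y|]; rewrite ?lieDl ?lie0l.
Qed.

Lemma lieC x y : lie x y = - lie y x.
Proof.
apply/eqP; rewrite -addr_eq0; have := lie_alt (x + y).
by rewrite lieDl !linearD /= !lie_alt add0r addr0 => ->.
Qed.

Lemma lie_der x y z : lie x (lie y z) = lie (lie x y) z + lie y (lie x z).
Proof.
have := lie_jacobi x y z.
rewrite (lieC z x) linearN /= (lieC z) => /eqP.
by rewrite subr_eq0 => /eqP <-; rewrite addrNK.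
Qed.

Lemma adE x y : ad x y = lie x y.
Proof. by rewrite /ad linfun_lin //; apply: lie_linr. Qed.

Lemma ad_lin : linear (@ad K g).
Proof.
by move=> a x y; apply/lfunP => z; rewrite add_lfunE scale_lfunE !adE lieDl lieZl.
Qed.

Lemma ad_lie x y : ad (lie x y) = (ad x \o ad y)%VF - (ad y \o ad x)%VF.
Proof.
apply/lfunP => z; rewrite add_lfunE opp_lfunE !comp_lfunE !adE.
by rewrite (lie_der x y z) addrK.
Qed.

Lemma mem_gr x (j : int) y : (y \in gr x j) = (lie x y == j%:~R *: y).
Proof.
rewrite /gr /passmx.leigenspace memv_ker add_lfunE opp_lfunE scale_lfunE.
by rewrite id_lfunE subr_eq0 adE.
Qed.

Lemma lie_gr H x y (i j : int) : x \in gr H i -> y \in gr H j ->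
  lie x y \in gr H (i + j).
Proof.
rewrite !mem_gr => /eqP hx /eqP hy; apply/eqP.
by rewrite lie_der hx hy lieZl linearZ /= -scalerDl rmorphD.
Qed.

End LieBasics.

Section Trace.
Context {K : fieldType}.

Lemma ltrace_basis (V : vectType K) (f g : 'End(V)) :
  ltrace (f \o g)%VF = \sum_(i < \dim {:V}) \sum_(j < \dim {:V})
    coord (vbasis {:V}) j (g (vbasis {:V})`_i) * coord (vbasis {:V}) i (f (vbasis {:V})`_j).
Proof.
apply: eq_bigr => i _; rewrite comp_lfunE.
rewrite {1}(coord_vbasis (memvf (g (vbasis {:V})`_i))) linear_sum linear_sum /=.
by apply: eq_bigr => j _; rewrite linearZ linearZ.
Qed.

Lemma ltraceC (V : vectType K) (f g : 'End(V)) :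
  ltrace (f \o g)%VF = ltrace (g \o f)%VF.
Proof.
rewrite !ltrace_basis exchange_big; apply: eq_bigr => i _.
by apply: eq_bigr => j _; rewrite mulrC.
Qed.

Lemma ltrace_lin (V : vectType K) : linear (@ltrace K V : 'End(V) -> K^o).
Proof.
move=> a f g; rewrite /ltrace scaler_sumr -big_split; apply: eq_bigr => i _ /=.
by rewrite add_lfunE scale_lfunE linearP.
Qed.

Context {g : lieAlgebra K}.

Lemma ltraceB (V : vectType K) (f h : 'End(V)) : ltrace (f - h) = ltrace f - ltrace h.
Proof.
by rewrite [f - h]addrC -[- h]scaleN1r ltrace_lin scaleN1r addrC.
Qed.

Lemma killingC (x y : g) : killing x y = killing y x.
Proof. exact: ltraceC. Qed.

Lemma killing_inv (x y z : g) : killing (lie x y) z = killing x (lie y z).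
Proof.
rewrite /killing !ad_lie comp_lfunDl comp_lfunDr comp_lfunNl comp_lfunNr.
rewrite !ltraceB !comp_lfunA; congr (_ - _).
by rewrite -comp_lfunA ltraceC.
Qed.

Lemma killing_linl (y : g) : linear (fun x : g => killing x y : K^o).
Proof.
move=> a x x'; rewrite /killing ad_lin comp_lfunDl -comp_lfunZl; exact: ltrace_lin.
Qed.

Lemma killing_linr (x : g) : linear (fun y : g => killing x y : K^o).
Proof. by move=> a y y'; rewrite ![killing x _]killingC killing_linl. Qed.

Lemma killing0l (y : g) : killing 0 y = 0.
Proof. by have := killing_linl y (-1) 0 0; rewrite scaleN1r oppr0 addr0 => ->; rewrite scaleN1r addNr. Qed.

Lemma killing_suml I (r : seq I) (P : pred I) (F : I -> g) z :
  killing (\sum_(i <- r | P i) F i) z = \sum_(i <- r | P i) killing (F i) z.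
Proof.
apply: (big_morph (fun x => killing x z)) => [x y|]; last exact: killing0l.
by have := killing_linl z 1 x y; rewrite scale1r => ->; rewrite scale1r.
Qed.

(** For an automorphism, [ad (l z)] is the conjugate of [ad z] by [l], and the trace is invariant
    under conjugation. *)
Lemma killing_auto (l : 'End(g)) (x y : g) : lker l == 0%VS ->
  (forall u v, l (lie u v) = lie (l u) (l v)) -> killing (l x) (l y) = killing x y.
Proof.
move=> l0 hl.
have e z : ad (l z) = (l \o ad z \o l^-1)%VF.
  apply/lfunP => u; rewrite !comp_lfunE !adE hl lker0_lfunVK //.
rewrite /killing !e.
have -> : (l \o ad x \o l^-1 \o (l \o ad y \o l^-1) = l \o (ad x \o ad y \o l^-1))%VF.
  by rewrite -!comp_lfunA (lker0_compKf l0).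
by rewrite ltraceC -!comp_lfunA lker0_compVf // comp_lfun1r.
Qed.

(** The radical of the invariant form is an ideal, and one nonzero value keeps it from being
    everything. That value will come from the dual bases of [g(1)] and [g(-1)], in place of Cartan's
    criterion. *)
Lemma killing_nondeg : simple_lie g -> (exists x y : g, killing x y != 0) ->
  forall x : g, x != 0 -> exists y : g, killing x y != 0.
Proof.
move=> [_ simp] [x0 [y0 n0]] x xn0.
pose T (x : g) : 'Hom(g, K^o) := linfun (fun y => killing x y : K^o).
have TE u y : T u y = killing u y by rewrite /T linfun_lin //; exact: killing_linr.
have Tlin : linear T.
  by move=> a u v; apply/lfunP => y; rewrite add_lfunE scale_lfunE !TE killing_linl.
have := simp (lker (linfun T)).
have mem u : (u \in lker (linfun T)) = (T u == 0) by rewrite memv_ker linfun_lin.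
case=> [u y| h|h].
- rewrite !mem => /eqP hy; apply/eqP/lfunP => z.
  rewrite TE lieC (_ : killing _ _ = - killing (lie y u) z); last first.
    by have := killing_linl z (-1) (lie y u) 0; rewrite scaleN1r addr0 => ->; rewrite killing0l addr0 scaleN1r.
  by rewrite killing_inv -TE hy !zero_lfunE oppr0.
- have : x \notin lker (linfun T) by rewrite h memv0.
  rewrite mem => /lfunPn[y]; rewrite TE zero_lfunE => hy; by exists y.
- have : x0 \in lker (linfun T) by rewrite h memvf.
  rewrite mem => /eqP e; by rewrite -TE e zero_lfunE eqxx in n0.
Qed.

End Trace.

(** * Eigenvector decompositions inside invariant subspaces *)

Section Diagonalization.
Context {K : fieldType} {V : vectType K}.

Definition diagz (A : 'End(V)) := exists e : seq V, basis_of {:V} e /\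
  forall y, y \in e -> exists c : K, A y = c *: y.

(* [kp A s] is the operator [\prod_(c <- s) (A - c)]. *)
Definition kp (A : 'End(V)) (s : seq K) (v : V) :=
  foldr (fun c v => A v - c *: v) v s.

Lemma kp_cons A c s v : kp A (c :: s) v = A (kp A s v) - c *: kp A s v.
Proof. by []. Qed.

Lemma kp_lin A s : linear (kp A s).
Proof.
move=> a; elim: s => // c s IH u v; rewrite !kp_cons IH linearP scalerBr.
by rewrite scalerDr opprD addrACA !scalerA mulrC.
Qed.

Lemma kpA A s v : kp A s (A v) = A (kp A s v).
Proof.
by elim: s => // c s IH; rewrite !kp_cons IH linearB /= [A (c *: _)]linearZ.
Qed.

Lemma kp_eig (A : 'End(V)) s v c : A v = c *: v -> c \in s -> kp A s v = 0.
Proof.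
move=> e; elim: s => // d s IH; rewrite kp_cons inE => /orP[/eqP <-|/IH ->].
  rewrite -kpA e -(linfun_lin (kp_lin A s)) linearZ /= linfun_lin ?subrr //.
  exact: kp_lin.
by rewrite scaler0 linear0 subrr.
Qed.

(** Decompose [A w - c *: w] by induction; its pieces have eigenvalues different from [c] because
    [s] has no repetitions. Dividing each by its eigenvalue minus [c] gives [w1] with the same image
    under [A - c], so [w - w1] is the missing eigenvector for [c]. All pieces stay in [W]. *)
Lemma kp_split (A : 'End(V)) (W : {vspace V}) s : uniq s -> (forall w, w \in W -> A w \in W) ->
  forall w, w \in W -> kp A s w = 0 ->
  exists us : seq V, w = \sum_(u <- us) u /\
    forall u, u \in us -> u \in W /\ exists2 c, c \in s & A u = c *: u.
Proof.
elim: s => [|c s IH] us hW w hw.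
  by rewrite /kp /= => ->; exists [::]; split=> //; rewrite big_nil.
case/andP: us => cs us; rewrite kp_cons -kpA => h.
have h' : kp A s (A w - c *: w) = 0.
  rewrite addrC -scaleNr kp_lin scaleNr addrC; exact: h.
have hw' : A w - c *: w \in W by apply: memvB; [apply: hW | apply: memvZ].
have [vs [e hvs]] := IH us hW _ hw' h'.
have [ev hev] : exists ev : V -> K, forall u, u \in vs -> ev u \in s /\ A u = ev u *: u.
  pose ev u := if pselect (exists2 d, d \in s & A u = d *: u) is left h
               then sval (cid2 h) else 0.
  exists ev => u /hvs[_ hu]; rewrite /ev; case: pselect => // hh.
  by case: (cid2 hh).
pose w1 := \sum_(u <- vs) (ev u - c)^-1 *: u.
exists ((w - w1) :: [seq (ev u - c)^-1 *: u | u <- vs]); split.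
  by rewrite big_cons big_map subrK.
have hW1 : w1 \in W.
  by rewrite /w1 big_seq; apply: memv_suml => u /hvs[? _]; apply: memvZ.
have ec u : u \in vs -> ev u - c != 0.
  by move=> /hev[h1 _]; rewrite subr_eq0; apply: contraNneq cs => <-.
move=> u; rewrite inE => /orP[/eqP ->|/mapP[v hv ->]].
  split; first exact: memvB.
  exists c; first by rewrite inE eqxx.
  have e1 : A w1 - c *: w1 = A w - c *: w.
    rewrite e /w1 linear_sum scaler_sumr /= -sumrB big_seq [RHS]big_seq.
    apply: eq_bigr => u' hu'; rewrite linearZ /= (proj2 (hev _ hu')) !scalerA -scalerBl.
    by rewrite mulrC -mulrBl mulfV ?ec // scale1r.
  by rewrite linearB scalerBr /= -[A w](subrK (c *: w)) -e1 addrAC [_ - c *: w1]addrC addrK addrC.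
split; first by apply: memvZ; case: (hvs _ hv).
exists (ev v); first by rewrite inE; case: (hev _ hv) => ->; rewrite orbT.
by rewrite linearZ /= (proj2 (hev _ hv)) !scalerA mulrC.
Qed.

Lemma eig_decomp (A : 'End(V)) (W : {vspace V}) : diagz A -> (forall w, w \in W -> A w \in W) ->
  forall w, w \in W -> exists us : seq V, w = \sum_(u <- us) u /\
    forall u, u \in us -> u \in W /\ exists c, A u = c *: u.
Proof.
move=> [e [be he]] hW w hw.
have [ev hev] : exists ev : V -> K, forall u, u \in e -> A u = ev u *: u.
  pose ev u := if pselect (exists d, A u = d *: u) is left h then sval (cid h) else 0.
  exists ev => u /he hu; rewrite /ev; case: pselect => // hh.
  by case: (cid hh).
(* The product of [A - c] over the distinct eigenvalues kills the eigenbasis, hence every vector. *)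
have [] := @kp_split A W (undup [seq ev u | u <- e]) (undup_uniq _) hW w hw.
  have /coord_span -> : w \in <<in_tuple e>>%VS by rewrite (span_basis be) memvf.
  rewrite -(linfun_lin (kp_lin A _)) linear_sum big1 // => i _.
  rewrite linearZ /= (linfun_lin (kp_lin A _)).
  have hi : e`_i \in e by apply: mem_nth.
  by rewrite (kp_eig (hev _ hi)) ?scaler0 // mem_undup; apply/mapP; exists e`_i.
by move=> us [ew hus]; exists us; split=> // u /hus[? [c _ ?]]; split=> //; exists c.
Qed.

(** Recursion on the family: the part of [W] in an eigenspace of the first operator is stable under
    the others because they commute with it. *)
Lemma joint_eig_decomp (As : seq 'End(V)) :
  (forall A, A \in As -> diagz A) ->
  (forall A B, A \in As -> B \in As -> forall v, A (B v) = B (A v)) ->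
  forall W : {vspace V}, (forall A, A \in As -> forall w, w \in W -> A w \in W) ->
  forall w, w \in W -> exists us : seq V, w = \sum_(u <- us) u /\
    forall u, u \in us -> u \in W /\ forall A, A \in As -> exists c, A u = c *: u.
Proof.
elim: As => [|A As IH] hd hc W hW w hw.
  by exists [:: w]; rewrite big_seq1; split=> // u; rewrite inE => /eqP ->.
have hA : A \in A :: As by rewrite inE eqxx.
have hAs B : B \in As -> B \in A :: As by rewrite inE => ->; rewrite orbT.
have [us [-> hus]] := eig_decomp (hd A hA) (hW A hA) hw.
elim: us hus => [|u us IHu] hus.
  by exists [::]; split=> //; rewrite !big_nil.
have [v hv|vs [e hvs]] := IHu; first by apply: hus; rewrite inE hv orbT.
have [hu [c hcu]] := hus u (mem_head _ _).
have [] := IH _ _ (W :&: lker (A - c *: \1%VF))%VS _ u.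
- by move=> B /hAs; apply: hd.
- by move=> B B' /hAs hB /hAs hB'; apply: hc.
- move=> B /hAs hB v; rewrite !memv_cap !memv_ker !add_lfunE !opp_lfunE !scale_lfunE !id_lfunE.
  case/andP => hv; rewrite !subr_eq0 => /eqP h; rewrite hW //=.
  by rewrite hc // h linearZ.
- rewrite memv_cap hu memv_ker add_lfunE opp_lfunE scale_lfunE id_lfunE.
  by rewrite hcu subrr eqxx.
move=> ws [ew hws]; exists (ws ++ vs); split; first by rewrite big_cons big_cat -ew -e.
move=> v; rewrite mem_cat => /orP[/hws[]|/hvs//].
rewrite memv_cap memv_ker add_lfunE opp_lfunE scale_lfunE id_lfunE subr_eq0.
case/andP=> hv /eqP hAv hB; split=> // B; rewrite inE => /orP[/eqP ->|/hB//].
by exists c.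
Qed.

End Diagonalization.

Lemma kp_eigE (K : fieldType) (V : vectType K) (A : 'End(V)) s v c :
  A v = c *: v -> kp A s v = (\prod_(d <- s) (c - d)) *: v.
Proof.
move=> e; elim: s => [|d s IH]; first by rewrite big_nil scale1r.
by rewrite kp_cons IH linearZ /= e big_cons !scalerA -scalerBl mulrC -mulrBl.
Qed.

Section Roots.
Context {K : fieldType} {g : lieAlgebra K} (h : {vspace g}).
Hypothesis hc : cartan h.

Lemma cartan_abelian x y : x \in h -> y \in h -> lie x y = 0.
Proof. by case: hc => ha _ _; apply: ha. Qed.

(** [h + <[x]>] is again abelian, so maximality of [h] absorbs [x]. *)
Lemma cartan_centralizer x : (forall H, H \in h -> lie H x = 0) -> x \in h.
Proof.
move=> hx; case: (hc) => ha hmax _.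
rewrite -(hmax (h + <[x]>)%VS) ?addvSl //.
  by rewrite (subvP (addvSr _ _)) // memv_line.
move=> _ _ /memv_addP[u hu [v /vlineP[a ->] ->]] /memv_addP[u' hu' [v' /vlineP[b ->] ->]].
rewrite lieDl !linearD /= ha // lieZl !linearZ /= lieZl lie_alt hx //.
by rewrite (lieC x) hx // oppr0 !scaler0 !addr0.
Qed.

Lemma in_rootspace_ex (u : g) :
  (forall H, H \in h -> exists c, lie H u = c *: u) ->
  exists a : hdual h, in_rootspace a u.
Proof.
move=> hu; have [->|u0] := eqVneq u 0.
  by exists 0 => H; rewrite scaler0 linear0.
(* As [u] is nonzero, the one-element family is free and the coordinate of [lie H u] along [u] is
   the eigenvalue, now visibly linear in [H]. *)
pose f (H : subvs_of h) : K^o := coord [tuple u] 0 (lie (vsval H) u).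
have flin : linear f by move=> a x y; rewrite /f linearP lieDl lieZl linearP.
exists (linfun f) => H; rewrite linfun_lin // /f.
have [c ->] := hu _ (subvsP H); rewrite linearZ /=; congr (_ *: _).
have := @coord_free _ _ _ [tuple u] ord0 ord0; rewrite seq1_free => /(_ u0) /= ->.
by rewrite mulr1.
Qed.

Lemma weight_decomp (W : {vspace g}) :
  (forall H w, H \in h -> w \in W -> lie H w \in W) -> forall w, w \in W ->
  exists us : seq g, w = \sum_(u <- us) u /\
    forall u, u \in us -> u \in W /\ exists a : hdual h, in_rootspace a u.
Proof.
move=> hW w hw; have [_ _ hs] := hc.
have [A /mapP[H hH ->]|A B|A|us [ew hus]] :=
  @joint_eig_decomp _ _ [seq ad H | H <- vbasis h] _ _ W _ w hw.
- have [e [be he]] := hs _ (vbasis_mem hH); exists e; split=> // y /he[c hy].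
  by exists c; rewrite adE.
- move=> /mapP[H hH ->] /mapP[H' hH' ->] v; rewrite !adE lie_der.
  by rewrite (cartan_abelian (vbasis_mem hH) (vbasis_mem hH')) lie0l add0r.
- by move=> /mapP[H hH ->] v hv; rewrite adE; apply: hW => //; apply: vbasis_mem.
exists us; split=> // u /hus[huW hu]; split=> //; apply: in_rootspace_ex => H hH.
pose c (i : 'I_(\dim h)) : K := coord (vbasis h) i H.
have [ev hev] : exists ev : 'I_(\dim h) -> K, forall i : 'I_(\dim h), lie (vbasis h)`_i u = ev i *: u.
  have hh (i : 'I_(\dim h)) : exists c : K, lie (vbasis h)`_i u = c *: u.
    have [|d hd] := hu (ad (vbasis h)`_i).
      by apply/mapP; exists (vbasis h)`_i => //; apply: mem_nth; rewrite size_tuple.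
    by exists d; rewrite -adE.
  by exists (fun i => sval (cid (hh i))) => i; case: (cid (hh i)).
exists (\sum_i c i * ev i); rewrite [in LHS](coord_vbasis hH) lie_suml scaler_suml.
by apply: eq_bigr => i _; rewrite lieZl hev scalerA.
Qed.

Lemma rootspace0 (u : g) : in_rootspace (0 : hdual h) u -> u \in h.
Proof.
move=> hu; apply: cartan_centralizer => H hH.
by have := hu (vsproj h H); rewrite vsprojK // zero_lfunE scale0r.
Qed.

Hypothesis nondeg : forall x : g, x != 0 -> exists y, killing x y != 0.

(** Nondegeneracy and the weight decomposition give a vector [u] of some weight [b] that pairs
    nontrivially with a root vector for [a]. Invariance of the Killing form then forces
    [a + b = 0]. *)
Lemma rootN (a : hdual h) : is_root a -> is_root (- a).
Proof.
case=> a0 [x x0 hx]; split; first by rewrite oppr_eq0.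
have [y hy] := nondeg x0.
have [|us [e hus]] := @weight_decomp {:g}%VS _ y (memvf y); first by move=> *; apply: memvf.
have [u huus hu] : exists2 u, u \in us & killing u x != 0.
  apply: contrapT => hn; move: hy; rewrite killingC e killing_suml big_seq big1 ?eqxx //.
  move=> u hu; apply/eqP/negPn/negP => hk; apply: hn; by exists u.
have [_ [b hb]] := hus _ huus.
suff -> : - a = b.
  by exists u => //; apply: contraNneq hu => ->; rewrite killing0l.
apply/lfunP => H; apply/eqP; rewrite opp_lfunE eq_sym -addr_eq0.
have e1 : killing (lie (vsval H) u) x = (b H : K) * killing u x.
  by rewrite hb; have := killing_linl x (b H) u 0; rewrite addr0 killing0l addr0 => ->.
have e2 : killing (lie u (vsval H)) x = (a H : K) * killing u x.
  rewrite killing_inv hx.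
  by have := killing_linr u (a H) x 0; rewrite addr0 [killing u 0]killingC killing0l addr0 => ->.
have e3 : killing (lie u (vsval H)) x = - killing (lie (vsval H) u) x.
  rewrite lieC; have := killing_linl x (-1) (lie (vsval H) u) 0.
  by rewrite addr0 killing0l addr0 !scaleN1r => ->.
move: e3; rewrite e1 e2 => /eqP; rewrite -addr_eq0 -mulrDl mulf_eq0 (negPf hu) orbF.
by rewrite addrC.
Qed.

(** Stability of [W] under [h] suffices, so the principle applies to the Levi subalgebra. Negative
    roots are phrased through [- a] with [a] positive, as in the definition of lowest weight
    vectors. *)
Lemma root_ind (Pi : seq (hdual h)) (W : {vspace g}) (S : g -> Prop) :
  root_base Pi -> (forall H w, H \in h -> w \in W -> lie H w \in W) ->
  S 0 -> (forall x y, S x -> S y -> S (x + y)) -> (forall x, x \in h -> S x) ->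
  (forall a x, positive_root Pi a -> in_rootspace a x -> x \in W -> S x) ->
  (forall a x, positive_root Pi a -> in_rootspace (- a) x -> x \in W -> S x) ->
  forall w, w \in W -> S w.
Proof.
move=> [_ _ hb] hW S0 SD Sh Sp Sn w hw.
have [us [-> hus]] := weight_decomp hW hw.
rewrite big_seq; apply: (big_ind S) => // u /hus[huW [a ha]].
have [a0|a0] := eqVneq a 0; first by apply: Sh; apply: rootspace0; rewrite -a0.
have [->//|u0] := eqVneq u 0.
have ra : is_root a by split=> //; exists u.
have [p|n] := hb _ ra; first by apply: (Sp a).
by apply: (Sn (- a)); rewrite ?opprK //; split=> //; apply: rootN.
Qed.

(** The simple roots span the dual of [h], and linear functionals separate points. *)
Lemma cartan_eq0 (Pi : seq (hdual h)) (z : subvs_of h) : root_base Pi ->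
  (forall b, b \in Pi -> b z = 0) -> z = 0.
Proof.
move=> [bPi _ _] hz.
have all0 (a : hdual h) : a z = 0.
  have /coord_span -> : a \in <<in_tuple Pi>>%VS by rewrite (span_basis bPi) memvf.
  rewrite sum_lfunE big1 // => i _; rewrite scale_lfunE hz ?scaler0 //.
  exact: mem_nth.
rewrite (coord_vbasis (memvf z)) big1 // => i _.
pose f (z : subvs_of h) : K^o := coord (vbasis {:subvs_of h}) i z.
have flin : linear f by move=> a x y; rewrite /f linearP.
by have := all0 (linfun f); rewrite linfun_lin // /f => ->; rewrite scale0r.
Qed.

End Roots.

Section ExpAd.
Context {R : realType} {g : lieAlgebra R[i]}.

Lemma lexp_ad_auto (x u v : g) :
  lexp (ad x) (lie u v) = lie (lexp (ad x) u) (lexp (ad x) v).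
Proof.
apply: lexp_bil => [w|w|w w']; [exact: lie_linl|exact: lie_linr|].
by rewrite !adE lie_der.
Qed.

Lemma lexp_ad_conj (l : 'End(g)) (y : g) : lker l == 0%VS ->
  (forall u v, l (lie u v) = lie (l u) (l v)) ->
  (l \o lexp (ad y) = lexp (ad (l y)) \o l)%VF.
Proof.
move=> l0 hl; apply/lfunP => v; rewrite !comp_lfunE.
apply: lexp_intertwine => [|k]; first exact: linearP.
by elim: k => // k IH; rewrite !iterS !adE hl IH.
Qed.

Lemma ad0 : ad (0 : g) = 0.
Proof. by apply/lfunP => y; rewrite adE lie0l zero_lfunE. Qed.

Lemma adZ a (x : g) : ad (a *: x) = a *: ad x.
Proof. by rewrite -[a *: x]addr0 ad_lin ad0 addr0. Qed.

Lemma adN (x : g) : ad (- x) = - ad x.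
Proof. by rewrite -scaleN1r adZ scaleN1r. Qed.

Lemma lexp_adN (x : g) : (lexp (ad x))^-1%VF = lexp (ad (- x)).
Proof. by rewrite lexp_inv adN. Qed.

End ExpAd.

(** * Real forms and the associated conjugation *)

Section RealForm.
Context {R : realType} {g : lieAlgebra R[i]} (g0 : realForm g).

Lemma rf0 : g0 0.
Proof.
have := rf_lin (-1) (rf_reP g0 0) (rf_reP g0 0).
by rewrite rmorphN1 scaleN1r addNr.
Qed.

Lemma rfD x y : g0 x -> g0 y -> g0 (x + y).
Proof. by move=> hx hy; have := rf_lin 1 hx hy; rewrite scale1r. Qed.

Lemma rfZ (a : R) x : g0 x -> g0 (a%:C *: x).
Proof. by move=> hx; have := rf_lin a hx rf0; rewrite addr0. Qed.

Lemma rfN x : g0 x -> g0 (- x).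
Proof. by move=> /(rfZ (-1)); rewrite rmorphN1 scaleN1r. Qed.

Lemma rfB x y : g0 x -> g0 y -> g0 (x - y).
Proof. by move=> hx /rfN; apply: rfD. Qed.

Lemma rf_uniq y z y' z' : g0 y -> g0 z -> g0 y' -> g0 z' ->
  y + 'i *: z = y' + 'i *: z' -> y = y' /\ z = z'.
Proof.
move=> hy hz hy' hz' e.
have e1 : 'i *: (z' - z) = y - y'.
  by rewrite scalerBr -[y in RHS](addrK ('i *: z)) e addrAC [y' + _]addrC addrK.
have z0 : z' - z = 0 by apply: (rf_indep (r := g0)); rewrite ?e1; apply: rfB.
split; last by apply/eqP; rewrite eq_sym -subr_eq0 z0.
by apply/eqP; rewrite -subr_eq0 -e1 z0 scaler0.
Qed.

Lemma rf_proj x y z : g0 y -> g0 z -> x = y + 'i *: z ->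
  rf_re g0 x = y /\ rf_im g0 x = z.
Proof. by move=> hy hz e; apply: rf_uniq => //; rewrite -?rf_dec //; apply: rf_reP || apply: rf_imP. Qed.

Lemma rf_projL (a : R) x y :
  rf_re g0 (a%:C *: x + y) = a%:C *: rf_re g0 x + rf_re g0 y /\
  rf_im g0 (a%:C *: x + y) = a%:C *: rf_im g0 x + rf_im g0 y.
Proof.
apply: rf_proj; try by apply: rf_lin; (apply: rf_reP || apply: rf_imP).
rewrite {1}(rf_dec g0 x) {1}(rf_dec g0 y) !scalerDr !scalerA [a%:C * _]mulrC.
by rewrite addrACA.
Qed.

Lemma rf_in_id x : g0 x -> rf_re g0 x = x /\ rf_im g0 x = 0.
Proof. by move=> hx; apply: rf_proj => //; [exact: rf0 | rewrite scaler0 addr0]. Qed.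

Lemma rf_im_eq0 x : rf_im g0 x = 0 -> g0 x.
Proof. by move=> h; rewrite (rf_dec g0 x) h scaler0 addr0; apply: rf_reP. Qed.

(** [g0] is only a real subspace, so closedness is obtained by testing: composing [rf_im] with
    real-linear functionals gives functionals that vanish on every partial sum. *)
Lemma rf_lexp x y : g0 x -> g0 y -> g0 (lexp (ad x) y).
Proof.
move=> hx hy; apply: rf_im_eq0; apply: rlin_sep => phi h.
have hp : rlinear (phi \o rf_im g0).
  by move=> a u v /=; rewrite (proj2 (rf_projL _ _ _)) h.
have h1 := lexp_vcvg (ad x) y hp.
have h2 : (phi \o rf_im g0 \o exp_sum (ad x) y) @ \oo --> phi 0.
  rewrite (_ : _ \o _ = fun=> phi 0); first exact: cvg_cst.
  apply/funext => n /=; congr phi; apply: (proj2 (rf_in_id _)).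
  rewrite /exp_sum; apply: (big_ind g0) => [|u v|k _]; [exact: rf0|exact: rfD|].
  rewrite invr_factC; apply: rfZ; elim: (nat_of_ord k) => //= j IH.
  by rewrite adE; apply: rf_lie.
exact: (cvg_unique _ h1 h2).
Qed.

Lemma rf_re_auto (l : 'End(g)) x : (forall y, g0 y -> g0 (l y)) ->
  rf_re g0 (l x) = l (rf_re g0 x) /\ rf_im g0 (l x) = l (rf_im g0 x).
Proof.
move=> hl; apply: rf_proj; try by apply: hl; (apply: rf_reP || apply: rf_imP).
by rewrite {1}(rf_dec g0 x) linearD linearZ.
Qed.

(** The antilinear involution fixing [g0]. Complex subspaces stable under it are those containing
    the real and imaginary parts of their elements, so real forms can be handled as stability
    statements. *)
Definition rf_conj x := rf_re g0 x - 'i *: rf_im g0 x.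

Lemma rf_conjE x : rf_re g0 (rf_conj x) = rf_re g0 x /\ rf_im g0 (rf_conj x) = - rf_im g0 x.
Proof.
apply: rf_proj; [exact: rf_reP|exact/rfN/rf_imP|by rewrite scalerN].
Qed.

Lemma rf_conjK x : rf_conj (rf_conj x) = x.
Proof.
by rewrite {1}/rf_conj (proj1 (rf_conjE x)) (proj2 (rf_conjE x)) scalerN opprK -rf_dec.
Qed.

Lemma rf_conjD x y : rf_conj (x + y) = rf_conj x + rf_conj y.
Proof.
have := rf_projL 1 x y; rewrite !scale1r => -[h1 h2].
by rewrite /rf_conj h1 h2 scalerDr opprD addrACA.
Qed.

Lemma mulCii : 'i * 'i = -1 :> R[i].
Proof. by rewrite -expr2 sqr_i. Qed.

Lemma rf_conjZ c x : rf_conj (c *: x) = conjc c *: rf_conj x.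
Proof.
case: c => a b.
set u := rf_re g0 x; set v := rf_im g0 x.
have [h1 h2] : rf_re g0 ((a +i* b) *: x) = a%:C *: u - b%:C *: v /\
   rf_im g0 ((a +i* b) *: x) = b%:C *: u + a%:C *: v.
  apply: rf_proj.
  - by apply: rfB; apply: rfZ; (apply: rf_reP || apply: rf_imP).
  - by apply: rfD; apply: rfZ; (apply: rf_reP || apply: rf_imP).
  rewrite {1}(rf_dec g0 x) -/u -/v [a +i* b]complexE /= !scalerDr !scalerDl !scalerA.
  rewrite -mulrA ['i * (b%:C * 'i)]mulrCA mulCii mulrN1 scaleNr [a%:C * 'i]mulrC.
  by rewrite (AC (2*2) ((1*4)*(2*3)))%AC.
have e : a -i* b = a%:C - 'i * b%:C by apply/eqP; rewrite eq_complex /=; apply/andP; split; apply/eqP; ring.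
rewrite /rf_conj h1 h2 /= e -/u -/v scalerBl !scalerBr scalerDr !scalerA.
rewrite ['i * b%:C * 'i]mulrAC mulCii mulN1r scaleNr opprK [a%:C * 'i]mulrC !opprD.
by rewrite (AC (2*2) ((1*4)*(3*2)))%AC.
Qed.

Lemma rf_conj0 : rf_conj 0 = 0.
Proof. by rewrite -[X in rf_conj X](scale0r 0) rf_conjZ conjc0 scale0r. Qed.

Lemma rf_conj_lie x y : rf_conj (lie x y) = lie (rf_conj x) (rf_conj y).
Proof.
set u := rf_re g0 x; set v := rf_im g0 x; set u' := rf_re g0 y; set v' := rf_im g0 y.
have [gu gv gu' gv'] : [/\ g0 u, g0 v, g0 u' & g0 v'].
  by split; (apply: rf_reP || apply: rf_imP).
have [h1 h2] : rf_re g0 (lie x y) = lie u u' - lie v v' /\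
   rf_im g0 (lie x y) = lie v u' + lie u v'.
  apply: rf_proj; first by apply: rfB; apply: rf_lie.
    by apply: rfD; apply: rf_lie.
  rewrite {1}(rf_dec g0 x) {1}(rf_dec g0 y) -/u -/v -/u' -/v' !lieDl !linearD /=.
  rewrite !lieZl !linearZ /= scalerA mulCii scaleN1r.
  by rewrite (AC (2*2) ((1*4)*(3*2)))%AC.
rewrite /rf_conj h1 h2 -/u -/v -/u' -/v' !lieDl !linearD /= !lieNl !linearN /=.
rewrite !lieZl !linearZ /= scalerA mulCii scaleN1r !opprK.
by rewrite (AC (2*2) ((1*4)*(3*2)))%AC.
Qed.

Lemma conj_rf_mem (W : {vspace g}) : (forall x, x \in W -> rf_conj x \in W) ->
  forall x, x \in W -> rf_re g0 x \in W /\ rf_im g0 x \in W.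
Proof.
move=> hW x hx; have hs := hW x hx.
have n2 : (2%:R : R[i]) != 0 by rewrite pnatr_eq0.
have e1 : rf_re g0 x = 2%:R^-1 *: (x + rf_conj x).
  apply: (scalerI n2); rewrite scalerA divff // scale1r /rf_conj {2}(rf_dec g0 x).
  by rewrite addrACA subrr addr0 -[2%:R]/(1 + 1) scalerDl scale1r.
have e2 : rf_im g0 x = - 'i *: (x - rf_re g0 x).
  rewrite {2}(rf_dec g0 x) addrC addKr scalerA mulNr mulCii opprK scale1r //.
have r1 : rf_re g0 x \in W by rewrite e1; apply/memvZ/memvD.
by split=> //; rewrite e2; apply/memvZ/memvB.
Qed.

Lemma has_real_form_conj (W : {vspace g}) : has_real_form g0 W ->
  forall x, x \in W -> rf_conj x \in W.
Proof.
move=> hW x /hW[y [z [[gy hy] [gz hz] e]]].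
have [h1 h2] := rf_proj gy gz e.
by rewrite /rf_conj h1 h2; apply: memvB => //; apply: memvZ.
Qed.

End RealForm.

(** * The parabolic subalgebra and the Levi action *)

Section Parabolic.
Context {R : realType} (P : parabolicData R).
Hypothesis r_gt0 : (0 < pd_r P)%N.
Notation H0 := (vsval (pd_H0 P)).
Notation r := (pd_r P).

Lemma H0_cartan : H0 \in pd_h P.
Proof. exact: subvsP. Qed.

Lemma mem_grd (j : int) y : (y \in grd P j) = (lie H0 y == j%:~R *: y).
Proof. exact: mem_gr. Qed.

Lemma mem_ll y : (y \in ll P) = (lie H0 y == 0).
Proof. by rewrite /ll /par_l mem_gr mulr0z scale0r. Qed.

Lemma cartan_ll x : x \in pd_h P -> x \in ll P.
Proof. by move=> hx; rewrite mem_ll (cartan_abelian (pd_cartan P)) // H0_cartan. Qed.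

Lemma ll_stable_cartan H w : H \in pd_h P -> w \in ll P -> lie H w \in ll P.
Proof.
move=> hH; rewrite !mem_ll => /eqP hw; rewrite lie_der hw linear0 addr0.
by rewrite (cartan_abelian (pd_cartan P) H0_cartan hH) lie0l.
Qed.

Lemma ll_grd x y j : x \in ll P -> y \in grd P j -> lie x y \in grd P j.
Proof.
rewrite mem_ll !mem_grd => /eqP hx /eqP hy.
by rewrite lie_der hx lie0l add0r hy linearZ.
Qed.

Lemma ll_lie x y : x \in ll P -> y \in ll P -> lie x y \in ll P.
Proof. exact: ll_grd. Qed.

Lemma ll_qq x y : x \in ll P -> y \in qq P -> lie x y \in qq P.
Proof.
move=> hx /memv_sumP[vs hvs ->]; rewrite linear_sum /=; apply: memv_sumr => i _.
by apply: (ll_grd hx); apply: hvs.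
Qed.

Lemma ll_nbar x y : x \in ll P -> y \in nbar P -> lie x y \in nbar P.
Proof.
move=> hx /memv_sumP[vs hvs ->]; rewrite linear_sum /=; apply: memv_sumr => i _.
by apply: (ll_grd hx); apply: hvs.
Qed.

(** On the degree 0 part this is the character property on [l]; in positive degrees the bracket
    stays in [n], where the character vanishes. *)
Lemma lamq_ll_qq x y : x \in ll P -> y \in qq P -> pd_lamq P (lie x y) = 0.
Proof.
move=> hx /memv_sumP[vs hvs ->]; rewrite !linear_sum /= big1 // => i _.
have := hvs i isT; move: (vs i) => v.
case: i => [[|i] lti] /= hi; first by apply: pd_lamq_l.
have lti' : (i < r)%N by [].
apply: pd_lamq_n; apply: (subvP (sumv_sup (Ordinal lti') isT (subvv _))).
exact: (ll_grd hx hi).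
Qed.

(** The eigenvalues of [ad H0] on [qq] are 0, ..., r, and those on [nbar] are -1, ..., -r. These
    annihilating polynomials give directness of the decomposition, and later pin down the conjugate
    of [H0]. *)
Lemma qq_kp v : v \in qq P -> kp (ad H0) [seq i%:R | i <- iota 0 r.+1] v = 0.
Proof.
set sq := map _ _.
move=> /memv_sumP[vs hvs ->]; rewrite -(linfun_lin (kp_lin _ _)) linear_sum /= big1 // => i _.
rewrite linfun_lin; last exact: kp_lin.
have := hvs i isT; rewrite mem_gr => /eqP hi.
apply: (@kp_eig _ _ _ _ _ (i%:Z%:~R)); first by rewrite adE.
by rewrite /sq; apply/mapP; exists (nat_of_ord i); rewrite ?mem_iota ?ltn_ord.
Qed.

Lemma nbar_kp v : v \in nbar P -> kp (ad H0) [seq - i.+1%:R | i <- iota 0 r] v = 0.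
Proof.
set sq := map _ _.
move=> /memv_sumP[vs hvs ->]; rewrite -(linfun_lin (kp_lin _ _)) linear_sum /= big1 // => i _.
rewrite linfun_lin; last exact: kp_lin.
have := hvs i isT; rewrite mem_gr => /eqP hi.
apply: (@kp_eig _ _ _ _ _ ((- i.+1%:Z)%:~R)); first by rewrite adE.
by rewrite /sq; apply/mapP; exists (nat_of_ord i); rewrite ?mem_iota ?ltn_ord // rmorphN.
Qed.

Lemma H0_ll : H0 \in ll P.
Proof. exact/cartan_ll/H0_cartan. Qed.

(** The intersection splits into eigenvectors of [ad H0] with eigenvalues [i >= 0]; on a nonzero
    one, the polynomial annihilating [nbar] would force some [i + j + 1] to vanish. *)
Lemma nbar_qq_cap : (nbar P :&: qq P = 0)%VS.
Proof.
apply/eqP; rewrite -subv0; apply/subvP => v hv; rewrite memv0.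
have st w : w \in (nbar P :&: qq P)%VS -> ad H0 w \in (nbar P :&: qq P)%VS.
  rewrite !memv_cap adE => /andP[h1 h2].
  by rewrite ll_nbar ?ll_qq ?H0_ll.
have hk : kp (ad H0) [seq i%:R | i <- iota 0 r.+1] v = 0.
  by apply: qq_kp; move: hv; rewrite memv_cap => /andP[].
have un : uniq [seq i%:R : R[i] | i <- iota 0 r.+1].
  rewrite map_inj_uniq ?iota_uniq // => i j /eqP; rewrite eqr_nat => /eqP //.
have [us [-> hus]] := kp_split un st hv hk.
rewrite big_seq big1 // => u /hus[huW [c /mapP[i _ ->] hu]].
move: huW; rewrite memv_cap => /andP[/nbar_kp + _].
rewrite (kp_eigE _ hu) => /eqP; rewrite scaler_eq0 => /orP[|/eqP //].
rewrite prodf_seq_eq0 => /hasP[d /mapP[j _ ->]] /=.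
by rewrite opprK -natrD pnatr_eq0 addnS.
Qed.

Lemma qq_nbar_cap : (qq P :&: nbar P = 0)%VS.
Proof. by rewrite capvC nbar_qq_cap. Qed.

Lemma proj_sum z : daddv_pi (qq P) (nbar P) z + daddv_pi (nbar P) (qq P) z = z.
Proof.
by apply: daddv_pi_add; rewrite ?qq_nbar_cap // addvC (pd_gr_full P) memvf.
Qed.

Lemma proj_q u v : u \in qq P -> v \in nbar P ->
  daddv_pi (qq P) (nbar P) (u + v) = u /\ daddv_pi (nbar P) (qq P) (u + v) = v.
Proof.
move=> hu hv.
have eu := daddv_pi_id qq_nbar_cap hu; have ev := daddv_pi_id nbar_qq_cap hv.
have eu' : daddv_pi (nbar P) (qq P) u = 0.
  by apply: (addrI u); rewrite addr0 -{1}eu proj_sum.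
have ev' : daddv_pi (qq P) (nbar P) v = 0.
  by apply: (addIr v); rewrite add0r -{2}ev proj_sum.
split.
  transitivity (daddv_pi (qq P) (nbar P) u + daddv_pi (qq P) (nbar P) v).
    exact: linearD.
  by rewrite eu ev' addr0.
transitivity (daddv_pi (nbar P) (qq P) u + daddv_pi (nbar P) (qq P) v).
  exact: linearD.
by rewrite eu' ev add0r.
Qed.

Section LeviExp.
Context (x : P) (hx : x \in ll P).
Notation l := (lexp (ad x)).

Lemma levi_grd j y : y \in grd P j -> l y \in grd P j.
Proof. by apply: lexp_mem => w hw; rewrite adE; apply: ll_grd. Qed.

Lemma levi_qq y : y \in qq P -> l y \in qq P.
Proof. by apply: lexp_mem => w hw; rewrite adE; apply: ll_qq. Qed.

Lemma levi_nbar y : y \in nbar P -> l y \in nbar P.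
Proof. by apply: lexp_mem => w hw; rewrite adE; apply: ll_nbar. Qed.

Lemma levi_proj z : daddv_pi (qq P) (nbar P) (l z) = l (daddv_pi (qq P) (nbar P) z) /\
  daddv_pi (nbar P) (qq P) (l z) = l (daddv_pi (nbar P) (qq P) z).
Proof.
rewrite -{1 3}(proj_sum z) linearD.
by apply: proj_q; [apply: levi_qq | apply: levi_nbar]; apply: memv_pi.
Qed.

Lemma levi_lamq z : z \in qq P -> pd_lamq P (l z) = pd_lamq P z.
Proof.
move=> hz; apply: (@lexp_fix _ _ _ _ (pd_lamq P)) => [|k]; first exact: linearP.
rewrite iterS adE lamq_ll_qq //.
by elim: k => //= k IH; rewrite adE ll_qq.
Qed.

End LeviExp.

Lemma H0_neq0 : H0 != 0.
Proof.
apply/eqP => h0; have := pd_H0P (pd_alqP P); rewrite eqxx.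
have -> : pd_H0 P = 0 by apply: subvs_inj; rewrite h0.
by rewrite linear0 => /eqP; rewrite eq_sym oner_eq0.
Qed.

Lemma grd_root (b : hdual (pd_h P)) (x : P) (j : int) :
  b (pd_H0 P) = j%:~R -> in_rootspace b x -> x \in grd P j.
Proof. by move=> hb hx; rewrite mem_grd hx hb. Qed.

(** Maximality of the parabolic enters here: every simple root other than [alq] has its root vectors
    in [l], hence vanishes on a central [z], so [z] agrees with [alq(z) H0] on all simple roots. *)
Lemma ll_center z : z \in ll P -> (forall y, y \in ll P -> lie z y = 0) ->
  exists c, z = c *: H0.
Proof.
move=> hz hc.
have zh : z \in pd_h P.
  apply: (cartan_centralizer (pd_cartan P)) => H hH.
  by rewrite lieC hc ?oppr0 // cartan_ll.
pose z' := vsproj (pd_h P) z; pose c : R[i] := pd_alq P z'.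
suff e : z' = c *: pd_H0 P by exists c; rewrite -(vsprojK zh) -/z' e.
apply/eqP; rewrite -subr_eq0; apply/eqP.
apply: (cartan_eq0 (pd_base P)) => b hb.
rewrite linearB linearZ /= pd_H0P //.
have [->|nb] := eqVneq b (pd_alq P); first by rewrite /GRing.scale /= mulr1 subrr.
rewrite scaler0 subr0.
have [_ hr _] := pd_base P; have [_ [y y0 hy]] := hr _ hb.
have yl : y \in ll P.
  by apply: (grd_root (j := 0) _ hy); rewrite pd_H0P // (negPf nb).
have := hy z'; rewrite vsprojK // hc // => /esym/eqP.
by rewrite scaler_eq0 (negPf y0) orbF => /eqP.
Qed.

Notation sg := (rf_conj (pd_g0 P)).

(* Conjugation preserves [ll P], hence the line of its centre, so it maps
   [H0] to [c *: H0] with [|c| = 1]; as it preserves [qq P] too, [c] is a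
   natural number. *)
Lemma conj_H0 : sg H0 = H0.
Proof.
have ls := has_real_form_conj (@pd_l_real _ P).
have qs := has_real_form_conj (@pd_q_real _ P).
have [y hy|c hc] := @ll_center (sg H0) (ls _ H0_ll).
  have /eqP := mem_ll (sg y); rewrite ls // eq_sym eqb_id => /eqP h.
  by rewrite -[y](rf_conjK (pd_g0 P)) -rf_conj_lie h rf_conj0.
have [_ hr _] := pd_base P; have [_ [x x0 hx]] := hr _ (pd_alqP P).
have x1 : x \in grd P 1 by apply: (grd_root (j := 1) _ hx); rewrite pd_H0P ?pd_alqP // eqxx.
have xq : x \in qq P.
  have l1 : (1 < r.+1)%N by [].
  exact: (subvP (sumv_sup (Ordinal l1) isT (subvv _))).
have cc : conjc c * c = 1.
  have := rf_conjK (pd_g0 P) H0; rewrite hc rf_conjZ hc scalerA => /eqP.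
  by rewrite -subr_eq0 -{2}[H0]scale1r -scalerBl scaler_eq0 (negPf H0_neq0) orbF subr_eq0 => /eqP.
have sx0 : sg x != 0.
  apply: contraNneq x0 => h; by rewrite -[x](rf_conjK (pd_g0 P)) h rf_conj0.
have hH : ad H0 (sg x) = conjc c *: sg x.
  rewrite adE -{1}(rf_conjK (pd_g0 P) H0) -rf_conj_lie hc lieZl.
  by move: x1; rewrite mem_grd => /eqP ->; rewrite scale1r rf_conjZ.
have := qq_kp (qs _ xq); rewrite (kp_eigE _ hH) => /eqP.
rewrite scaler_eq0 (negPf sx0) orbF prodf_seq_eq0 => /hasP[d /mapP[i _ ->]] /=.
rewrite subr_eq0 => /eqP ci.
have ci' : c = i%:R by rewrite -[c]conjcK ci conjc_nat.
move: cc; rewrite ci ci' -natrM => /eqP; rewrite -[1]/(1%:R) eqr_nat muln_eq1 => /andP[/eqP i1 _].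
by rewrite hc ci' i1 scale1r.
Qed.

Lemma conj_grd j y : y \in grd P j -> sg y \in grd P j.
Proof.
rewrite !mem_grd => /eqP h; rewrite -{1}conj_H0 -rf_conj_lie h rf_conjZ.
have -> : conjc (j%:~R : R[i]) = j%:~R by rewrite rmorph_int.
by [].
Qed.

Lemma conj_nbar y : y \in nbar P -> sg y \in nbar P.
Proof.
move=> /memv_sumP[vs hvs ->].
rewrite (big_morph sg (rf_conjD _) (_ : sg 0 = 0)); last first.
  exact: rf_conj0.
by apply: memv_sumr => i _; apply: conj_grd; apply: hvs.
Qed.

(** [Rop x] differentiates along the real and imaginary parts of [x]; these must lie in [nbar] for
    the curves to remain in [Nbar0]. *)
Lemma nbar_re y : y \in nbar P ->
  rf_re (pd_g0 P) y \in nbar P /\ rf_im (pd_g0 P) y \in nbar P.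
Proof. by move=> hy; apply: conj_rf_mem hy => x; apply: conj_nbar. Qed.

End Parabolic.

(** * Bilinear forms as a module over the Levi subalgebra *)

(** Projecting the curve to a complement of [W] gives a constant function, whose derivative at 0 is
    the projection of [D y]. *)
Lemma lexp_deriv_mem (R : realType) (V : vectType R[i]) (D : 'End(V)) (W : {vspace V}) y :
  (forall t : R, lexp (t%:C *: D) y \in W) -> D y \in W.
Proof.
move=> h; pose Q : 'End(V) := \1%VF - projv W.
have QE v : Q v = v - projv W v by rewrite add_lfunE opp_lfunE id_lfunE.
suff : Q (D y) = 0.
  by rewrite QE => /eqP; rewrite subr_eq0 => /eqP ->; apply: memv_proj.
apply: rlin_sep => phi hphi.
have hp := rlin_comp (linearP Q) hphi.
have := @lexp_derive _ _ D y _ hp; rewrite (_ : (fun t => _) = cst (phi 0)); last first.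
  by apply/funext => t /=; rewrite QE projv_id ?subrr.
by move=> h1; rewrite -[LHS](derive_val (is_derive := h1)) derive_cst rlin0.
Qed.

Section Bilinear.
Context {K : fieldType} {V : vectType K} (U W : {vspace V}).

(** The forms of [bidual], with arbitrary subspaces in place of the two graded pieces. *)
Definition gbd := 'Hom(subvs_of U, 'Hom(subvs_of W, K^o)).
Implicit Type Y : gbd.

Definition gbival Y (x z : V) : K := Y (vsproj U x) (vsproj W z).

Definition gmk (B : V -> V -> K) : gbd :=
  linfun (fun x => linfun (fun z => B (vsval x) (vsval z) : K^o)).

Definition bilform (B : V -> V -> K) :=
  (forall z, linear (fun x => B x z : K^o)) /\ (forall x, linear (B x : V -> K^o)).

Lemma gbival_bil Y : bilform (gbival Y).
Proof.
split=> [z|x] a u v; rewrite /gbival linearP; last by rewrite linearP.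
by rewrite linearP /= add_lfunE scale_lfunE.
Qed.

Lemma gbival_linY x z : linear (fun Y => gbival Y x z : K^o).
Proof. by move=> a Y Y'; rewrite /gbival !add_lfunE !scale_lfunE. Qed.

Lemma gbival_mk B x z : bilform B -> x \in U -> z \in W ->
  gbival (gmk B) x z = B x z.
Proof.
move=> [hl hr] hx hz; rewrite /gbival /gmk.
have inner (u : V) : linear (fun z : subvs_of W => B u (vsval z) : K^o).
  by move=> a v w; rewrite linearP hr.
rewrite linfun_lin.
  by rewrite linfun_lin ?vsprojK //; exact: inner.
move=> a u v; apply/lfunP => w; rewrite add_lfunE scale_lfunE !linfun_lin //.
by rewrite linearP hl.
Qed.

Lemma gbd_eq Y Y' : (forall x z, x \in U -> z \in W -> gbival Y x z = gbival Y' x z) ->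
  Y = Y'.
Proof.
move=> h; apply/lfunP => x; apply/lfunP => z.
by have := h _ _ (subvsP x) (subvsP z); rewrite /gbival !vsvalK.
Qed.

End Bilinear.

(** * Levi actions on an abstract space of bilinear forms *)

Section BilinearLie.
Context {R : realType} {g : lieAlgebra R[i]} (U W L : {vspace g}).
Context (M : vectType R[i]) (val : M -> g -> g -> R[i]) (mk : (g -> g -> R[i]) -> M).
Implicit Type Y : M.
Hypothesis val_bil : forall Y, bilform (val Y).
Hypothesis val_linY : forall x z, linear (fun Y => val Y x z : R[i]^o).
Hypothesis val_mk : forall B x z, bilform B -> x \in U -> z \in W -> val (mk B) x z = B x z.
Hypothesis val_eq : forall Y Y',
  (forall x z, x \in U -> z \in W -> val Y x z = val Y' x z) -> Y = Y'.
Hypothesis LU : forall x y, x \in L -> y \in U -> lie x y \in U.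
Hypothesis LW : forall x y, x \in L -> y \in W -> lie x y \in W.
Hypothesis LL : forall x y, x \in L -> y \in L -> lie x y \in L.

(** [bact] and [glie] repeat the bodies of [bidual_act] and [bidual_lie] for abstract [val] and
    [mk], so that the specialization at the end is by conversion. *)
Definition bact (a : 'End(g)) Y : M :=
  mk (fun x z => val Y ((a^-1)%VF x) ((a^-1)%VF z)).

Definition glie (u : g) Y : M :=
  mk (fun x z => - val Y (lie u x) z - val Y x (lie u z)).

Lemma bilform_comp B (a b : 'End(g)) : bilform B -> bilform (fun x z => B (a x) (b z)).
Proof. by move=> [hl hr]; split=> [z|x] c u v; rewrite linearP ?hl ?hr. Qed.

Lemma bilform_lie Y u : bilform (fun x z => - val Y (lie u x) z - val Y x (lie u z)).
Proof.
have [hl hr] := val_bil Y.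
split=> [z|x] c v w; rewrite linearP.
  by rewrite !hl /GRing.scale /=; ring.
by rewrite !hr /GRing.scale /=; ring.
Qed.

Lemma glieE Y u x z : x \in U -> z \in W ->
  val (glie u Y) x z = - val Y (lie u x) z - val Y x (lie u z).
Proof. by move=> hx hz; apply: val_mk => //; apply: bilform_lie. Qed.

Lemma bactE Y (a : 'End(g)) x z : x \in U -> z \in W ->
  val (bact a Y) x z = val Y ((a^-1)%VF x) ((a^-1)%VF z).
Proof.
move=> hx hz; apply: (val_mk (B := fun x z => val Y ((a^-1)%VF x) ((a^-1)%VF z))) => //.
by apply: bilform_comp; apply: val_bil.
Qed.

Lemma glie_lin u : linear (glie u).
Proof.
move=> a Y Y'; apply: val_eq => x z hx hz.
rewrite glieE // !val_linY !glieE // /GRing.scale /=; ring.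
Qed.

Lemma glie_linl Y : linear (fun u => glie u Y).
Proof.
move=> a u v; apply: val_eq => x z hx hz.
have [hl hr] := val_bil Y.
rewrite glieE // !val_linY !glieE // !lieDl !lieZl hl hr /GRing.scale /=; ring.
Qed.

Lemma glie_rep u v Y : u \in L -> v \in L ->
  glie (lie u v) Y = glie u (glie v Y) - glie v (glie u Y).
Proof.
move=> hu hv; apply: val_eq => x z hx hz.
have [hl hr] := val_bil Y.
rewrite -scaleN1r addrC val_linY !glieE //; try by (apply: LU || apply: LW).
have e w : lie (lie u v) w = (-1) *: lie v (lie u w) + lie u (lie v w).
  by rewrite scaleN1r (lie_der u v) addrCA addrA addrNK.
rewrite !e hl hr /GRing.scale /=; ring.
Qed.

Definition glie_op u : 'End(M) := linfun (glie u).

Lemma glie_opE u Y : glie_op u Y = glie u Y.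
Proof. by rewrite linfun_lin //; apply: glie_lin. Qed.

Lemma glie_opZ a u : glie_op (a *: u) = a *: glie_op u.
Proof.
apply/lfunP => Y; rewrite scale_lfunE !glie_opE.
have := glie_linl Y a u 0; rewrite addr0 => ->.
suff -> : glie 0 Y = 0 by rewrite addr0.
by have := glie_linl Y (-1) 0 0; rewrite scaler0 addr0 scaleN1r addNr.
Qed.

(** Composing the two arguments of [Y] with endomorphisms [a] and [b] is bilinear in [(a, b)], and
    [glie u] obeys the Leibniz rule there with right multiplication by [- ad u] in each slot.
    [lexp_bil] at the pair of identities gives the claim. *)
Lemma bact_lexp u Y : u \in L -> bact (lexp (ad u)) Y = lexp (glie_op u) Y.
Proof.
move=> hu.
pose beta (a b : 'End(g)) : M := mk (fun x z => val Y (a x) (b z)).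
have betaE a b x z : x \in U -> z \in W -> val (beta a b) x z = val Y (a x) (b z).
  by move=> hx hz; apply: (val_mk (bilform_comp a b (val_bil Y))).
have [hl hr] := val_bil Y.
have bl b : linear (beta^~ b).
  move=> c a a'; apply: val_eq => x z hx hz.
  by rewrite val_linY !betaE // add_lfunE scale_lfunE hl.
have br a : linear (beta a).
  move=> c b b'; apply: val_eq => x z hx hz.
  by rewrite val_linY !betaE // add_lfunE scale_lfunE hr.
pose Rm : 'End('End(g)) := linfun (fun a : 'End(g) => (a \o (- ad u))%VF).
have RmE a x : Rm a x = - a (lie u x).
  rewrite linfun_lin; last exact: comp_lfun_linl.
  by rewrite comp_lfunE opp_lfunE linearN adE.
have leib a b : glie_op u (beta a b) = beta (Rm a) b + beta a (Rm b).
  apply: val_eq => x z hx hz; rewrite glie_opE.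
  have -> : beta (Rm a) b + beta a (Rm b) = 1 *: beta (Rm a) b + beta a (Rm b).
    by rewrite scale1r.
  rewrite val_linY glieE // !betaE //; try by (apply: LU || apply: LW).
  rewrite !RmE scale1r; congr (_ + _).
    by rewrite -[RHS](linfun_lin (hl (b z))) linearN /= linfun_lin.
  by rewrite -[RHS](linfun_lin (hr (a x))) linearN /= linfun_lin.
have h := lexp_bil bl br leib \1%VF \1%VF.
have e1 : beta \1%VF \1%VF = Y.
  by apply: val_eq => x z hx hz; rewrite betaE // !id_lfunE.
by rewrite e1 lexp_rmul in h; rewrite h /bact lexp_inv.
Qed.

Lemma bact1 Y : bact \1%VF Y = Y.
Proof.
have i1 : (\1%VF : 'End(g))^-1%VF = \1%VF.
  rewrite -[LHS]comp_lfun1r lker0_compVf //.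
  by apply/lker0P => x y; rewrite !id_lfunE.
apply: val_eq => x z hx hz; rewrite [LHS](@bactE Y _ x z hx hz) i1.
by rewrite !id_lfunE.
Qed.

Lemma inv_lfun_comp (V : vectType R[i]) (a b : 'End(V)) : lker a == 0%VS -> lker b == 0%VS ->
  lker (a \o b)%VF == 0%VS /\ ((a \o b)^-1 = b^-1 \o a^-1)%VF.
Proof.
move=> a0 b0.
have c0 : lker (a \o b)%VF == 0%VS.
  by apply/lker0P => x y; rewrite !comp_lfunE => /(lker0P a0)/(lker0P b0).
split=> //; apply/lfunP => x; apply: (lker0P c0).
by rewrite lker0_lfunVK // !comp_lfunE !lker0_lfunVK.
Qed.

Notation AL := (analytic_subgroup (fun x : g => x \in L)).

(** Forms in [M] are determined on [U] and [W] only, so composing actions requires the inverse of a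
    group element to preserve these subspaces. Injectivity is carried along to invert
    compositions. *)
Lemma analytic_inv (a : 'End(g)) : AL a -> lker a == 0%VS /\
  forall Z : {vspace g}, (forall x y, x \in L -> y \in Z -> lie x y \in Z) ->
  forall y, y \in Z -> (a^-1)%VF y \in Z.
Proof.
elim=> [|u x _ [u0 hu] hx].
  have k0 : lker (\1%VF : 'End(g)) == 0%VS by apply/lker0P => x y; rewrite !id_lfunE.
  split=> // Z hZ y hy.
  by have := lker0_lfunK k0 y; rewrite id_lfunE => ->.
have [k0 ->] := inv_lfun_comp u0 (lexp_ker0 (ad x)).
split=> // Z hZ y hy; rewrite comp_lfunE lexp_adN.
apply: lexp_mem (hu _ hZ _ hy) => w hw; rewrite adE; apply: hZ => //.
by rewrite memvN.
Qed.

Lemma bact_comp (a b : 'End(g)) Y : AL a -> lker b == 0%VS ->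
  bact (a \o b)%VF Y = bact a (bact b Y).
Proof.
move=> ha b0; have [a0 hai] := analytic_inv ha.
have [_ e] := inv_lfun_comp a0 b0.
apply: val_eq => x z hx hz.
rewrite [LHS](@bactE Y _ x z hx hz) [RHS](@bactE (bact b Y) _ x z hx hz) e.
rewrite [RHS](@bactE Y b); first by rewrite !comp_lfunE.
  exact: hai.
exact: hai.
Qed.

Lemma analytic_lexp (u : g) : u \in L -> AL (lexp (ad u)).
Proof. by move=> hu; rewrite -[lexp _]comp_lfun1l; apply: analytic_mul => //; apply: analytic_id. Qed.

(** Passes from the group to the Lie algebra: differentiating one-parameter subgroups makes [V]
    stable under [glie], and exponentiating makes a [glie]-stable subspace stable under all products
    of exponentials, so irreducibility applies to it. *)
Lemma irreducible_L_lie (V : {vspace M}) :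
  let stable (Z : {vspace M}) :=
    forall a, AL a -> forall v, v \in Z -> bact a v \in Z in
  [/\ stable V, V != 0%VS
    & forall Z : {vspace M}, stable Z -> (Z <= V)%VS -> Z = 0%VS \/ Z = V] ->
  [/\ forall u Y, u \in L -> Y \in V -> glie u Y \in V,
      forall u Y, u \in L -> Y \in V -> bact (lexp (ad u)) Y \in V
    & forall Z : {vspace M}, (Z <= V)%VS ->
       (forall u Y, u \in L -> Y \in Z -> glie u Y \in Z) -> Z = 0%VS \/ Z = V].
Proof.
move=> /= [hst _ hirr]; split=> [u Y hu hY|u Y hu hY|Z hZV hZ].
- rewrite -glie_opE; apply: lexp_deriv_mem => t.
  have htu : t%:C *: u \in L by apply: memvZ.
  rewrite -glie_opZ -bact_lexp //; apply: hst => //; exact: analytic_lexp.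
- by apply: hst => //; exact: analytic_lexp.
apply: hirr => // a ha; elim: ha => [|b u hb IH hu] Y hY; first by rewrite bact1.
rewrite bact_comp ?lexp_ker0 //; apply: IH; rewrite bact_lexp //.
by apply: lexp_mem hY => w hw; rewrite glie_opE; apply: hZ.
Qed.

End BilinearLie.

Lemma irr_grd (R : realType) (P : parabolicData R) (V : {vspace P}) :
  irreducible_L P (fun (a : 'End(P)) (x : P) => a x) V ->
  forall W : {vspace P}, (W <= V)%VS ->
   (forall u y, u \in ll P -> y \in W -> lie u y \in W) -> W = 0%VS \/ W = V.
Proof.
move=> [_ _ hirr] W hWV hW; apply: hirr => // a ha.
elim: ha => [|b u hb IH hu] y hy; first by rewrite id_lfunE.
rewrite comp_lfunE; apply: IH; apply: lexp_mem hy => w hw.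
by rewrite adE; apply: hW.
Qed.

(** * Cyclicity of highest tensor lowest weight vectors *)

Section Cyclic.
Context {R : realType} (P : parabolicData R) (M : vectType R[i]).
Context (rho : P -> 'End(M)).
Hypothesis rho_lin : forall v, linear (fun x => rho x v).
Hypothesis rho_rep : forall x y v, x \in ll P -> y \in ll P ->
  rho (lie x y) v = rho x (rho y v) - rho y (rho x v).
Hypothesis nondeg : forall x : P, x != 0 -> exists y, killing x y != 0.

(** Only the homogeneous elements of the Borel subalgebra of [l]; induction on roots needs no
    others. *)
Definition bplus (x : P) := x \in ll P /\
  (x \in pd_h P \/ exists2 a, positive_root (pd_Pi P) a & in_rootspace a x).

(* Shrinking [A] repeatedly to the [v] with [rho x v \in A] for all [x] in
   [ll P] replaces a PBW argument: [v0] survives every step. *)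
Lemma lie_hull (v0 : M) (A : {vspace M}) :
  (forall H, H \in pd_h P -> exists c : R[i], rho H v0 = c *: v0) ->
  (forall a x, positive_root (pd_Pi P) a -> in_rootspace (- a) x -> x \in ll P ->
     rho x v0 = 0) ->
  (forall x v, bplus x -> v \in A -> rho x v \in A) -> v0 \in A ->
  exists2 B : {vspace M}, (B <= A)%VS & v0 \in B /\
    forall x v, x \in ll P -> v \in B -> rho x v \in B.
Proof.
move=> hw hneg; have [n] := ubnP (\dim A); elim: n A => // n IH A dA hA v0A.
pose b := vbasis (ll P).
pose A' := (A :&: \bigcap_(i < \dim (ll P)) (rho b`_i @^-1: A))%VS.
have mA' v : v \in A' <-> v \in A /\ forall z, z \in ll P -> rho z v \in A.
  split.
    rewrite memv_cap => /andP[hv /subv_bigcapP h]; split=> // z hz.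
    rewrite (coord_vbasis hz) -(linfun_lin (rho_lin v)) linear_sum /=.
    apply: memv_suml => i _; rewrite linearZ /=; apply: memvZ.
    by rewrite linfun_lin // memv_preim; apply: (h i isT).
  case=> hv h; rewrite memv_cap hv; apply/subv_bigcapP => i _.
  rewrite -memvE -memv_preim; apply: h.
  by apply: vbasis_mem; apply: mem_nth; rewrite size_tuple.
have v0A' : v0 \in A'.
  apply/mA'; split=> // z hz.
  apply: (root_ind (pd_cartan P) nondeg (S := fun z => rho z v0 \in A) (pd_base P)
     (@ll_stable_cartan _ P) _ _ _ _ _ hz).
  - by have := rho_lin v0 (-1) 0 0; rewrite scaler0 addr0 scaleN1r addNr => ->; apply: mem0v.
  - by move=> x y hx hy; have := rho_lin v0 1 x y; rewrite !scale1r => ->; apply: memvD.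
  - by move=> x /hw[c ->]; apply: memvZ.
  - by move=> a x pa ha hx; apply: hA => //; split=> //; right; exists a.
  - by move=> a x pa ha hx; rewrite (hneg a) //; apply: mem0v.
have hA' x v : bplus x -> v \in A' -> rho x v \in A'.
  move=> hx /mA'[hv hz]; apply/mA'; split; first exact: hA.
  move=> z zl; have xl := hx.1.
  have -> : rho z (rho x v) = rho (lie z x) v + rho x (rho z v).
    by rewrite rho_rep // subrK.
  by apply: memvD; [apply/hz/ll_lie | apply: hA => //; apply: hz].
have [eA|nA] := eqVneq A' A.
  exists A; first exact: subvv.
  by split=> // x v hx; rewrite -{1}eA => /mA'[_]; apply.
have sA : (A' <= A)%VS by apply: capvSl.
have [|||B hB hB'] := IH A' => //.
  have := dimv_leqif_eq sA; rewrite (negPf nA) => h.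
  by rewrite -ltnS; apply: leq_trans dA; rewrite ltnS (ltn_leqif h).
by exists B => //; apply: subv_trans hB sA.
Qed.

(* Elements of the Borel subalgebra act on [Xh] by scalars, so the set of [v]
   with [T Xh v \in W] is stable under it and [lie_hull] applies at [Yl]. *)
Lemma tensor_cyclic (M' : vectType R[i]) (T : P -> M -> M') (W : {vspace M'})
    (G : {vspace P}) (V : {vspace M}) (Xh : P) (Yl : M) :
  (forall v, linear (T^~ v)) -> (forall x, linear (T x)) ->
  (forall x X, x \in ll P -> X \in G -> lie x X \in G) ->
  (forall x v, x \in ll P -> v \in V -> rho x v \in V) ->
  (forall U : {vspace P}, (U <= G)%VS ->
     (forall u y, u \in ll P -> y \in U -> lie u y \in U) -> U = 0%VS \/ U = G) ->
  (forall U : {vspace M}, (U <= V)%VS ->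
     (forall u y, u \in ll P -> y \in U -> rho u y \in U) -> U = 0%VS \/ U = V) ->
  highest_weight_vector P (@lie _ P) G Xh ->
  lowest_weight_vector P (fun x => rho x) V Yl ->
  (forall x X v, x \in ll P -> X \in G -> v \in V -> T X v \in W ->
     T (lie x X) v + T X (rho x v) \in W) ->
  T Xh Yl \in W -> forall X v, X \in G -> v \in V -> T X v \in W.
Proof.
move=> linl linr hG hV irrG irrV [XG [X0 Xw] Xp] [YV [Y0 Yw] Yn] hW hT.
have TZl X c v : T X v \in W -> T (c *: X) v \in W.
  by move=> h; rewrite -(linfun_lin (linl v)) linearZ /= linfun_lin //; apply: memvZ.
pose A := (V :&: (linfun (T Xh) @^-1: W))%VS.
have mA v : (v \in A) = (v \in V) && (T Xh v \in W).
  by rewrite memv_cap -memv_preim linfun_lin.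
have key x X v c : x \in ll P -> X \in G -> v \in V -> lie x X = c *: X ->
    T X v \in W -> T X (rho x v) \in W.
  move=> hx hX hv e h; have := hW x X v hx hX hv h; rewrite e => h2.
  by rewrite -(addKr (T (c *: X) v) (T X _)); apply: memvD => //; rewrite memvN; apply: TZl.
have [x v [hx hxb]||B hBA [YB hB]] := @lie_hull Yl A Yw Yn.
- rewrite !mA => /andP[hv hTv]; rewrite hV //=.
  case: hxb => [/Xw[c hc]|[a pa ha]]; first exact: (key x Xh v c).
  by apply: (key x Xh v 0) => //; rewrite scale0r; apply: (Xp a).
- by rewrite mA YV.
have eB : B = V.
  have [|//|e0|//] := irrV B; first by apply: (subv_trans hBA); apply: capvSl.
  by move: YB; rewrite e0 memv0 (negPf Y0).
have XhV v : v \in V -> T Xh v \in W.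
  by rewrite -eB => /(subvP hBA); rewrite mA => /andP[].
pose bV := vbasis V.
pose U := (G :&: \bigcap_(i < \dim V) (linfun (T^~ bV`_i) @^-1: W))%VS.
have mU X : X \in U <-> X \in G /\ forall v, v \in V -> T X v \in W.
  split.
    rewrite memv_cap => /andP[hX /subv_bigcapP h]; split=> // v hv.
    rewrite (coord_vbasis hv) -(linfun_lin (linr X)) linear_sum /=.
    apply: memv_suml => i _; rewrite linearZ /=; apply: memvZ.
    have := h i isT; rewrite -memvE -memv_preim.
    by rewrite !linfun_lin.
  case=> hX h; rewrite memv_cap hX; apply/subv_bigcapP => i _.
  rewrite -memvE -memv_preim linfun_lin //; apply: h.
  by apply: vbasis_mem; apply: mem_nth; rewrite size_tuple.
have [||e0|e] := irrG U; first exact: capvSl.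
- move=> x X hx /mU[hX h]; apply/mU; split; first exact: hG.
  move=> v hv; have := hW x X v hx hX hv (h v hv) => h2.
  rewrite -(addrK (T X (rho x v)) (T (lie x X) v)); apply: memvB => //.
  by apply/h/hV.
- have : Xh \in U by apply/mU.
  by rewrite e0 memv0 (negPf X0).
by move=> X v; rewrite -{1}e => /mU[_]; apply.
Qed.

End Cyclic.

Lemma lfunL (K : fieldType) (V W : vectType K) (T : 'Hom(V, W)) c u v :
  T (c *: u + v) = c *: T u + T v.
Proof. exact: linearP. Qed.

(** * Differentiation along one-parameter subgroups *)

Section DerivC.
Context {R : realType}.
Implicit Types (u v : R -> R[i]) (d e : R[i]).

Definition is_derivC u d :=
  is_derive (0 : R) (1 : R) (fun t => complex.Re (u t)) (complex.Re d) /\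
  is_derive (0 : R) (1 : R) (fun t => complex.Im (u t)) (complex.Im d).

Lemma derivC_val u d : is_derivC u d -> Defs.derivC u 0 = d.
Proof.
move=> [h1 h2]; rewrite /Defs.derivC !derive1E.
rewrite (derive_val (is_derive := h1)) (derive_val (is_derive := h2)).
by case: d {h1 h2}.
Qed.

Lemma is_derivC_cst c : is_derivC (fun=> c) 0.
Proof. by split; exact: is_derive_cst. Qed.

Lemma ReD (z w : R[i]) : complex.Re (z + w) = complex.Re z + complex.Re w.
Proof. by case: z; case: w. Qed.

Lemma ImD (z w : R[i]) : complex.Im (z + w) = complex.Im z + complex.Im w.
Proof. by case: z; case: w. Qed.

Lemma ReM (z w : R[i]) :
  complex.Re (z * w) = complex.Re z * complex.Re w - complex.Im z * complex.Im w.
Proof. by case: z; case: w. Qed.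

Lemma ImM (z w : R[i]) :
  complex.Im (z * w) = complex.Re z * complex.Im w + complex.Im z * complex.Re w.
Proof. by case: z; case: w. Qed.

Lemma is_derivCD u v d e : is_derivC u d -> is_derivC v e ->
  is_derivC (fun t => u t + v t) (d + e).
Proof.
move=> [h1 h2] [h3 h4]; rewrite /is_derivC ReD ImD.
have -> : (fun t : R => complex.Re (u t + v t)) =
  (fun t => complex.Re (u t)) + (fun t => complex.Re (v t)).
  by apply/funext => t; rewrite ReD.
have -> : (fun t : R => complex.Im (u t + v t)) =
  (fun t => complex.Im (u t)) + (fun t => complex.Im (v t)).
  by apply/funext => t; rewrite ImD.
by split; apply: is_deriveD.
Qed.

Lemma is_derivCM u v d e : is_derivC u d -> is_derivC v e ->
  is_derivC (fun t => u t * v t) (d * v 0 + u 0 * e).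
Proof.
move=> [h1 h2] [h3 h4].
have i1 := is_deriveB (is_deriveM h1 h3) (is_deriveM h2 h4).
have mulCii := is_deriveD (is_deriveM h1 h4) (is_deriveM h2 h3).
rewrite /is_derivC.
have -> : (fun t : R => complex.Re (u t * v t)) =
  (fun t => complex.Re (u t)) * (fun t => complex.Re (v t)) -
  (fun t => complex.Im (u t)) * (fun t => complex.Im (v t)).
  by apply/funext => t; rewrite ReM.
have -> : (fun t : R => complex.Im (u t * v t)) =
  (fun t => complex.Re (u t)) * (fun t => complex.Im (v t)) +
  (fun t => complex.Im (u t)) * (fun t => complex.Re (v t)).
  by apply/funext => t; rewrite ImM.
split; [apply: is_derive_eq i1 _ | apply: is_derive_eq mulCii _];
  rewrite /GRing.scale /= ?ReD ?ImD ?ReM ?ImM; ring.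
Qed.

Lemma is_derivCr (u : R -> R) (d : R) : is_derive (0 : R) (1 : R) u d ->
  is_derivC (fun t => (u t)%:C) d%:C.
Proof. by move=> h; split=> //=; exact: is_derive_cst. Qed.

Lemma is_derivC_near u v d : (\forall t \near (0 : R), u t = v t) ->
  is_derivC u d -> is_derivC v d.
Proof.
move=> h [h1 h2]; split.
- by apply: (near_eq_is_derive _ h1); apply: filterS h => t ->.
- by apply: (near_eq_is_derive _ h2); apply: filterS h => t ->.
Qed.

End DerivC.

(** * Smooth sections and the operators [Rop] and [pi_s] *)

Section Nice.
Context {R : realType} (P : parabolicData R).
Hypothesis r_gt0 : (0 < pd_r P)%N.
Notation EndP := 'End(P).
Implicit Types (f h : fsec P) (a : EndP) (x y : P) (U : EndP -> Prop).

Definition nbar0 x := x \in nbar P /\ pd_g0 P x.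

Lemma nbar0L (c : R) x y : nbar0 x -> nbar0 y -> nbar0 (c%:C *: x + y).
Proof. by move=> [h1 h2] [h3 h4]; split; [apply: memvD => //; apply: memvZ | apply: rf_lin]. Qed.

Lemma nbar0Z (c : R) x : nbar0 x -> nbar0 (c%:C *: x).
Proof. by move=> [h1 h2]; split; [apply: memvZ | apply: rfZ]. Qed.

Definition curve a x (t : R) : EndP := (a \o lexp (ad (t%:C *: x)))%VF.

Lemma lexp_ad0 : lexp (ad (0 : P)) = \1%VF.
Proof. by apply/lfunP => y; rewrite ad0 lexp0 id_lfunE. Qed.

Lemma curve0 a x : curve a x 0 = a.
Proof. by rewrite /curve scale0r lexp_ad0 comp_lfun1r. Qed.

Lemma curve_Nbar0 a x t : Nbar0 a -> nbar0 x -> Nbar0 (curve a x t).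
Proof. by move=> ha hx; apply: analytic_mul => //; apply: nbar0Z. Qed.

Lemma Nbar0_ker0 a : Nbar0 a -> lker a == 0%VS.
Proof.
elim=> [|u x _ u0 _]; first by apply/lker0P => x y; rewrite !id_lfunE.
exact: (inv_lfun_comp u0 (lexp_ker0 _)).1.
Qed.

(** By [lexp_rmul] the curve is [a] composed with the exponential of a right multiplication operator
    applied to the identity, so [lexp_derive] applies on ['End(P)]. *)
Lemma curve_derive a x psi : rlinear psi ->
  is_derive (0 : R) (1 : R) (fun t => psi (curve a x t)) (psi (a \o ad x)%VF).
Proof.
move=> hpsi.
pose Rm (B : EndP) : 'End(EndP) := linfun (fun b : EndP => (b \o B)%VF).
have RmE B b : Rm B b = (b \o B)%VF by rewrite linfun_lin //; exact: comp_lfun_linl.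
have hp := rlin_comp (comp_lfun_linr (U := P) a) hpsi.
have := @lexp_derive _ _ (Rm (ad x)) \1%VF _ hp.
rewrite /= RmE comp_lfun1l => h.
have e (t : R) : lexp (t%:C *: Rm (ad x)) \1%VF = lexp (ad (t%:C *: x)).
  have -> : t%:C *: Rm (ad x) = Rm (ad (t%:C *: x)).
    by apply/lfunP => b; rewrite scale_lfunE !RmE adZ comp_lfunZr.
  exact: lexp_rmul.
rewrite (_ : (fun t => psi (curve a x t)) =
  fun t : R => psi (a \o lexp (t%:C *: Rm (ad x)) \1)%VF) //.
by apply/funext => t; rewrite e.
Qed.

(** Openness only along the curves that [Rreal] differentiates, which is the locality needed to
    replace a function by another one agreeing with it on [U]. *)
Definition curve_open U := forall a x, Nbar0 a -> nbar0 x -> U a ->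
  \forall t \near (0 : R), U (curve a x t).

(* [f] has [n] successive derivatives along the curves [a exp(tx)] in [Nbar0],
   within [U], and each derivative is real-linear in the direction [x]. *)
Fixpoint nice U (n : nat) f : Prop :=
  if n is m.+1 then
    (forall a, Nbar0 a -> U a ->
      (forall x, nbar0 x -> is_derivC (fun t => f (curve a x t)) (Rreal x f a)) /\
      (forall (c : R) x y, nbar0 x -> nbar0 y ->
         Rreal (c%:C *: x + y) f a = c%:C * Rreal x f a + Rreal y f a)) /\
    (forall x, nbar0 x -> nice U m (Rreal x f))
  else True.

Lemma nice_pred U n f : nice U n.+1 f -> nice U n f.
Proof.
elim: n f => [//|n IH] f [h1 h2]; split=> // x hx; apply: IH; exact: h2.
Qed.

Lemma nice_intro U n f (D : P -> fsec P) : curve_open U ->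
  (forall a x, Nbar0 a -> U a -> nbar0 x -> is_derivC (fun t => f (curve a x t)) (D x a)) ->
  (forall a (c : R) x y, Nbar0 a -> U a -> nbar0 x -> nbar0 y ->
     D (c%:C *: x + y) a = c%:C * D x a + D y a) ->
  (forall x, nbar0 x -> exists2 h, nice U n h & forall a, Nbar0 a -> U a -> Rreal x f a = h a) ->
  (forall f h, (forall a, Nbar0 a -> U a -> f a = h a) -> nice U n h -> nice U n f) ->
  nice U n.+1 f.
Proof.
move=> hU hd hl hn ext.
have RE a x : Nbar0 a -> U a -> nbar0 x -> Rreal x f a = D x a.
  by move=> ha hu hx; apply: derivC_val; apply: hd.
split=> [a ha hu|x hx].
  split=> [x hx|c x y hx hy]; first by rewrite RE //; apply: hd.
  by rewrite !RE // ?hl //; apply: nbar0L.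
by have [h hh e] := hn x hx; apply: ext hh.
Qed.

Lemma Rreal_ext U x f h : curve_open U -> nbar0 x ->
  (forall a, Nbar0 a -> U a -> f a = h a) ->
  forall a, Nbar0 a -> U a -> Rreal x f a = Rreal x h a.
Proof.
move=> hU hx e a ha hu; rewrite /Rreal /Defs.derivC !derive1E.
have hn := hU a x ha hx hu.
congr (_ +i* _); apply: near_eq_derive; rewrite ?oner_eq0 //;
  apply: filterS hn => t ht; rewrite -/(curve a x t) e //; exact: curve_Nbar0.
Qed.

Lemma nice_ext U n f h : curve_open U -> (forall a, Nbar0 a -> U a -> f a = h a) ->
  nice U n h -> nice U n f.
Proof.
move=> hU; elim: n f h => [//|n IH] f h e [h1 h2].
have RE x a : nbar0 x -> Nbar0 a -> U a -> Rreal x f a = Rreal x h a.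
  by move=> hx ha hu; apply: (Rreal_ext hU hx e).
split=> [a ha hu|x hx].
  have [h3 h4] := h1 a ha hu; split=> [x hx|c x y hx hy].
    rewrite RE //; apply: (is_derivC_near _ (h3 x hx)).
    apply: filterS (hU a x ha hx hu) => t ht; rewrite e //; exact: curve_Nbar0.
  by rewrite !RE // ?h4 //; apply: nbar0L.
apply: IH (h2 x hx) => a ha hu; exact: RE.
Qed.

(** Reduces niceness to an explicit formula [D] for the first derivatives. [Rreal x f] agrees with
    [D x] only on [Nbar0] within [U], hence the transfer through [nice_ext]. *)
Lemma niceP U n f (D : P -> fsec P) : curve_open U ->
  (forall a x, Nbar0 a -> U a -> nbar0 x -> is_derivC (fun t => f (curve a x t)) (D x a)) ->
  (forall a (c : R) x y, Nbar0 a -> U a -> nbar0 x -> nbar0 y ->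
     D (c%:C *: x + y) a = c%:C * D x a + D y a) ->
  (forall x, nbar0 x -> nice U n (D x)) -> nice U n.+1 f.
Proof.
move=> hU hd hl hn; apply: (nice_intro hU hd hl) => [x hx|f' h' e].
  by exists (D x); [exact: hn | move=> a ha hu; apply: derivC_val; apply: hd].
exact: nice_ext.
Qed.

Lemma nice_der U n f a x : nice U n.+1 f -> Nbar0 a -> U a -> nbar0 x ->
  is_derivC (fun t => f (curve a x t)) (Rreal x f a).
Proof. by move=> [h _] ha hu hx; apply: (h a ha hu).1. Qed.

Lemma nice_derL U n f a (c : R) x y : nice U n.+1 f -> Nbar0 a -> U a -> nbar0 x -> nbar0 y ->
  Rreal (c%:C *: x + y) f a = c%:C * Rreal x f a + Rreal y f a.
Proof. by move=> [h _] ha hu hx hy; apply: (h a ha hu).2. Qed.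

Lemma nice_cst U n c : curve_open U -> nice U n (fun=> c).
Proof.
move=> hU; elim: n c => [//|n IH] c.
apply: (niceP (D := fun _ _ => 0) hU) => [a x _ _ _|a d x y _ _ _ _|x hx].
- exact: is_derivC_cst.
- by rewrite mulr0 addr0.
- exact: IH.
Qed.

Lemma niceD U n f h : curve_open U -> nice U n f -> nice U n h ->
  nice U n (fun a => f a + h a).
Proof.
move=> hU; elim: n f h => [//|n IH] f h hf hh.
apply: (niceP (D := fun x a => Rreal x f a + Rreal x h a) hU) => [a x ha hu hx|a c x y ha hu hx hy|x hx].
- by apply: is_derivCD; [apply: nice_der hf _ _ _ | apply: nice_der hh _ _ _].
- rewrite (nice_derL c hf ha hu hx hy) (nice_derL c hh ha hu hx hy).
  by rewrite mulrDr addrACA.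
- by apply: IH; [case: hf => _; apply | case: hh => _; apply].
Qed.

Lemma niceM U n f h : curve_open U -> nice U n f -> nice U n h ->
  nice U n (fun a => f a * h a).
Proof.
move=> hU; elim: n f h => [//|n IH] f h hf hh.
apply: (niceP (D := fun x a => Rreal x f a * h a + f a * Rreal x h a) hU) => [a x ha hu hx|a c x y ha hu hx hy|x hx].
- have := is_derivCM (nice_der hf ha hu hx) (nice_der hh ha hu hx).
  by rewrite curve0.
- rewrite (nice_derL c hf ha hu hx hy) (nice_derL c hh ha hu hx hy).
  move: (Rreal x f a) (Rreal y f a) (Rreal x h a) (Rreal y h a) (f a) (h a) c%:C.
  by move=> *; ring.
- apply: niceD => //; apply: IH.
  + by case: hf => _; apply.
  + exact: nice_pred.
  + exact: nice_pred.
  + by case: hh => _; apply.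
Qed.

Lemma nice_sum U n I (s : seq I) (F : I -> fsec P) : curve_open U ->
  (forall i, nice U n (F i)) -> nice U n (fun a => \sum_(i <- s) F i a).
Proof.
move=> hU hF; elim: s => [|i s IH].
  by apply: (nice_ext hU _ (nice_cst n 0 hU)) => a _ _; rewrite big_nil.
apply: (nice_ext hU _ (niceD hU (hF i) IH)) => a _ _; by rewrite big_cons.
Qed.

(** The derivative along [x] sends [psi] to [psi] precomposed with right multiplication by [ad x],
    again a real-linear functional, so the induction closes. *)
Lemma nice_rlin U n psi : curve_open U -> rlinear psi ->
  nice U n (fun a => (psi a)%:C).
Proof.
move=> hU; elim: n psi => [//|n IH] psi hpsi.
apply: (niceP (D := fun x a => (psi (a \o ad x)%VF)%:C) hU) => [a x ha hu hx|a c x y ha hu hx hy|x hx].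
- by apply: is_derivCr; apply: curve_derive.
- by rewrite ad_lin comp_lfunDr -comp_lfunZr hpsi rmorphD rmorphM.
- by apply: IH; apply: (rlin_comp (comp_lfun_linl (X := P) (ad x)) hpsi).
Qed.

Lemma curve_inv a x t X : Nbar0 a ->
  ((curve a x t)^-1)%VF X = lexp (t%:C *: - ad x) ((a^-1)%VF X).
Proof.
move=> ha; rewrite /curve (inv_lfun_comp (Nbar0_ker0 ha) (lexp_ker0 _)).2 comp_lfunE.
by rewrite lexp_adN adN adZ scalerN.
Qed.

(** Differentiating the inverse of [a] applied to [X] along [x] brackets that vector with [- x];
    this is absorbed into [psi]. *)
Lemma nice_inv U n psi X : curve_open U -> rlinear psi ->
  nice U n (fun a => (psi ((a^-1)%VF X))%:C).
Proof.
move=> hU; elim: n psi => [//|n IH] psi hpsi.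
apply: (niceP (D := fun x a => (psi (- lie x ((a^-1)%VF X)))%:C) hU) => [a x ha hu hx|a c x y ha hu hx hy|x hx].
- apply: is_derivCr.
  have := @lexp_derive _ _ (- ad x) ((a^-1)%VF X) _ hpsi.
  rewrite opp_lfunE adE (_ : (fun t : R => psi (lexp _ _)) =
    fun t => psi (((curve a x t)^-1)%VF X)) //.
  by apply/funext => t; rewrite (curve_inv x t X ha).
- by rewrite lieDl lieZl opprD -scalerN hpsi rmorphD rmorphM.
- apply: (IH (psi \o (fun z => - lie x z))); apply: (rlin_comp _ hpsi) => c z z'.
  by rewrite linearP opprD scalerN.
Qed.

Notation rixE := ('I_(\dim {:EndP}) * bool)%type.
Notation VV := ('rV[R]_(\dim {:EndP}) * 'rV[R]_(\dim {:EndP}))%type.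

Definition vcoords a : VV :=
  (\row_i rc (i, true) a, \row_i rc (i, false) a).

Definition vdir (p : rixE) : VV :=
  if p.2 then (delta_mx 0 p.1, 0) else (0, delta_mx 0 p.1).

Lemma vcoordsK a : rcoord_point (vcoords a) = a.
Proof.
rewrite /rcoord_point [RHS](coord_vbasis (memvf a)); apply: eq_bigr => i _.
by congr (_ *: _); rewrite /= !mxE /rc /=; case: (coord _ _ _).
Qed.

Lemma vcoordsE a : vcoords a = \sum_p rc p a *: vdir p.
Proof.
rewrite -(pair_bigA _ (fun i b => rc (i, b) a *: vdir (i, b))) /=.
have e i : \sum_b rc (i, b) a *: vdir (i, b) =
  (rc (i, true) a *: delta_mx 0 i, rc (i, false) a *: delta_mx 0 i) :> VV.
  rewrite big_bool /= /vdir /=.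
  by congr pair; rewrite /= scaler0 ?addr0 ?add0r.
under eq_bigr do rewrite e.
rewrite [RHS]surjective_pairing /vcoords; congr (_, _).
  rewrite (big_morph fst (fun x y : VV => erefl (x + y).1) (erefl _)) /=.
  rewrite [LHS]row_sum_delta; apply: eq_bigr => i _; by rewrite mxE.
rewrite (big_morph snd (fun x y : VV => erefl (x + y).2) (erefl _)) /=.
rewrite [LHS]row_sum_delta; apply: eq_bigr => i _; by rewrite mxE.
Qed.

Lemma diff_comb (I : Type) (s : seq I) (u : I -> R -> R) (u' : I -> R) (w : I -> VV) :
  (forall p, is_derive (0 : R) (1 : R) (u p) (u' p)) ->
  differentiable (fun t : R => \sum_(p <- s) u p t *: w p) (0 : R) /\
  'd (fun t : R => \sum_(p <- s) u p t *: w p) (0 : R) 1 = \sum_(p <- s) u' p *: w p.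
Proof.
move=> hu; elim: s => [|p s [h1 h2]].
  rewrite (_ : (fun t : R => _) = cst 0); last by apply/funext => t; rewrite big_nil.
  by split; [exact: differentiable_cst | rewrite diff_cst big_nil].
have e : (fun t : R => \sum_(p0 <- p :: s) u p0 t *: w p0) =
   (fun t => u p t *: w p) + (fun t : R => \sum_(p <- s) u p t *: w p).
  by apply/funext => t; rewrite big_cons.
have d1 : differentiable (u p) 0 by apply/derivable1_diffP; case: (hu p).
have d2 : differentiable (fun t => u p t *: w p) 0 by apply: differentiableZl.
rewrite e; split; first exact: differentiableD.
rewrite diffD // big_cons; congr (_ + _) => //.
rewrite diffZl //; congr (_ *: _).
by rewrite -deriveE //; apply: derive_val.
Qed.

Lemma curve_chain (G : VV -> R) a x : differentiable G (vcoords a) ->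
  is_derive (0 : R) (1 : R) (fun t => G (vcoords (curve a x t)))
    (\sum_p rc p (a \o ad x)%VF * 'D_(vdir p) G (vcoords a)).
Proof.
move=> hG.
pose u (p : rixE) t := rc p (curve a x t).
have hu p : is_derive (0 : R) (1 : R) (u p) (rc p (a \o ad x)%VF).
  exact: curve_derive (rc_rlin p).
have [d1 d2] := diff_comb (index_enum _) vdir hu.
have e : (fun t => vcoords (curve a x t)) = fun t => \sum_p u p t *: vdir p.
  by apply/funext => t; rewrite vcoordsE.
have e0 : vcoords a = \sum_p u p 0 *: vdir p by rewrite vcoordsE /u curve0.
rewrite (_ : (fun t => G _) = G \o (fun t => \sum_p u p t *: vdir p)); last first.
  by rewrite -e.
have hG' : differentiable G ((fun t => \sum_p u p t *: vdir p) 0) by rewrite -e0.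
have dc : differentiable (G \o (fun t => \sum_p u p t *: vdir p)) (0 : R).
  exact: differentiable_comp.
apply: DeriveDef; first exact: diff_derivable.
rewrite deriveE // diff_comp //= d2 -e0 linear_sum; apply: eq_bigr => p _.
by rewrite linearZ /= deriveE.
Qed.

Lemma vcoords_curve_open (O : set VV) : open O -> curve_open (fun a => O (vcoords a)).
Proof.
move=> oO a x ha hx hu.
have hu' p : is_derive (0 : R) (1 : R) (fun t => rc p (curve a x t)) (rc p (a \o ad x)%VF).
  exact: curve_derive (rc_rlin p).
have [d1 _] := diff_comb (index_enum _) vdir hu'.
have c := differentiable_continuous d1.
have /c h : nbhs (\sum_p rc p (curve a x 0) *: vdir p) O.
  by rewrite -vcoordsE curve0; apply: open_nbhs_nbhs.
have h' : \forall t \near (0 : R), O (\sum_p rc p (curve a x t) *: vdir p) := h.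
by apply: filterS h' => t; rewrite -vcoordsE.
Qed.

(** By the chain rule, the derivative is a sum of real-linear functions of [a] times partial
    derivatives of [G], which have one order of smoothness less. *)
Lemma nice_smooth_real (O : set VV) n (G : VV -> R) : open O -> times_diff O n G ->
  nice (fun a => O (vcoords a)) n (fun a => (G (vcoords a))%:C).
Proof.
move=> oO; have hU := vcoords_curve_open oO.
elim: n G => [//|n IH] G [hd hn].
apply: (niceP (D := fun x a => \sum_p (rc p (a \o ad x)%VF)%:C * ('D_(vdir p) G (vcoords a))%:C) hU)
  => [a x ha hu hx|a c x y ha hu hx hy|x hx].
- under eq_bigr do rewrite -rmorphM; rewrite -rmorph_sum.
  by apply: is_derivCr; apply: curve_chain; apply: hd.
- rewrite mulr_sumr -big_split /=; apply: eq_bigr => p _.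
  rewrite ad_lin comp_lfunDr -comp_lfunZr.
  by rewrite (rc_rlin p) rmorphD rmorphM mulrDl mulrA.
- apply: nice_sum => // p; apply: niceM => //.
    exact: (nice_rlin n hU (rlin_comp (comp_lfun_linl (X := P) (ad x)) (rc_rlin p))).
  exact: (IH ('D_(vdir p) G) (hn (vdir p))).
Qed.

Definition everywhere : EndP -> Prop := fun=> True.

Lemma curve_openT : curve_open everywhere.
Proof.
move=> a x _ _ _; near=> t; exact: Logic.I.
Unshelve. all: by end_near.
Qed.

(** [U] only restricts the points where conditions are imposed, while the functions [Rreal x f] are
    the same for all [U]; so the neighbourhood may vary with the point. *)
Lemma nice_local n f : (forall a, Nbar0 a -> exists2 U, U a & nice U n f) ->
  nice everywhere n f.
Proof.
elim: n f => [//|n IH] f h; split=> [a ha _|x hx].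
  by have [U hU [h1 _]] := h a ha; apply: h1.
by apply: IH => a /h[U hU [_ h2]]; exists U => //; apply: h2.
Qed.

Lemma smooth_nice n f : smooth_section f -> nice everywhere n f.
Proof.
move=> hf; apply: nice_local => a ha.
have [|O [F [oO hO hF e]]] := hf (vcoords a); first by rewrite vcoordsK.
exists (fun a => O (vcoords a)) => //.
have hU := vcoords_curve_open oO; have [h1 h2] := hF n.
have n1 := nice_smooth_real oO h1; have n2 := nice_smooth_real oO h2.
apply: (nice_ext hU _ (niceD hU n1 (niceM hU (nice_cst n 'i hU) n2))) => b hb hu.
by rewrite -complexE -[in LHS](vcoordsK b) e // vcoordsK.
Qed.

Notation smoothN := (nice everywhere).

(** The identity behind complex linearity of [Rop], with a generic [I] so that [ring] sees only
    [I * I = -1]. *)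
Lemma complex_scale_id (I A B C D s t : R[i]) : I * I = -1 ->
  s * A + (- t * B + C) + I * (t * A + (s * B + D)) =
  (s + I * t) * (A + I * B) + (C + I * D).
Proof.
move=> mulCii; apply/eqP; rewrite -subr_eq0.
rewrite (_ : _ - _ = - (I * I + 1) * (t * B)); last by ring.
by rewrite mulCii addNr oppr0 mul0r.
Qed.

Lemma Rop_lin n f a (c : R[i]) x y : smoothN n.+1 f -> Nbar0 a ->
  x \in nbar P -> y \in nbar P ->
  Rop (c *: x + y) f a = c * Rop x f a + Rop y f a.
Proof.
move=> hf ha hx hy.
case: c => al be; set c := al +i* be.
have [xr xi] := nbar_re r_gt0 hx; have [yr yi] := nbar_re r_gt0 hy.
set u := rf_re (pd_g0 P) x; set v := rf_im (pd_g0 P) x.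
set u' := rf_re (pd_g0 P) y; set v' := rf_im (pd_g0 P) y.
have [nu nv nu' nv'] : [/\ nbar0 u, nbar0 v, nbar0 u' & nbar0 v'].
  by split; split=> //; (apply: rf_reP || apply: rf_imP).
have [e1 e2] : rf_re (pd_g0 P) (c *: x + y) = al%:C *: u + ((- be)%:C *: v + u') /\
   rf_im (pd_g0 P) (c *: x + y) = be%:C *: u + (al%:C *: v + v').
  apply: rf_proj.
  - by apply: rf_lin; [case: nu | apply: rf_lin; [case: nv | case: nu']].
  - by apply: rf_lin; [case: nu | apply: rf_lin; [case: nv | case: nv']].
  rewrite {1}(rf_dec (pd_g0 P) x) {1}(rf_dec (pd_g0 P) y) -/u -/v -/u' -/v'.
  rewrite /c [al +i* be]complexE /= !scalerDr !scalerDl !scalerA.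
  rewrite -mulrA ['i * (be%:C * 'i)]mulrCA mulCii mulrN1 rmorphN [al%:C * 'i]mulrC.
  by rewrite (AC (2*2*2) ((1*(4*5))*(2*(3*6))))%AC.
rewrite /Rop e1 e2 -/u -/v -/u' -/v'.
have L := nice_derL _ hf ha I.
rewrite !L //; try exact: nbar0L.
have -> : c = al%:C + 'i * be%:C by exact: complexE.
rewrite rmorphN /=.
exact: complex_scale_id mulCii.
Qed.

Lemma nice_Rop n f x : smoothN n.+1 f -> x \in nbar P -> smoothN n (Rop x f).
Proof.
move=> [_ h] hx; have [xr xi] := nbar_re r_gt0 hx.
apply: niceD; [exact: curve_openT| |].
  by apply: h; split=> //; apply: rf_reP.
apply: niceM; [exact: curve_openT|apply: nice_cst; exact: curve_openT|].
by apply: h; split=> //; apply: rf_imP.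
Qed.

Lemma Rop_ext x f h : x \in nbar P -> (forall a, Nbar0 a -> f a = h a) ->
  forall a, Nbar0 a -> Rop x f a = Rop x h a.
Proof.
move=> hx e a ha; have [xr xi] := nbar_re r_gt0 hx; rewrite /Rop.
by congr (_ + _ * _); apply: (Rreal_ext curve_openT _ _ ha I);
  first [by split=> //; apply: rf_reP | by split=> //; apply: rf_imP | by move=> b hb _; apply: e].
Qed.

Lemma Rop_flin n x f h (c : R[i]) : x \in nbar P -> smoothN n.+1 f -> smoothN n.+1 h ->
  forall a, Nbar0 a -> Rop x (fun b => c * f b + h b) a = c * Rop x f a + Rop x h a.
Proof.
move=> hx hf hh a ha; have [xr xi] := nbar_re r_gt0 hx.
have e y : nbar0 y -> Rreal y (fun b => c * f b + h b) a = c * Rreal y f a + Rreal y h a.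
  move=> hy; apply: derivC_val; apply: is_derivCD; last exact: (nice_der hh ha I hy).
  have := is_derivCM (is_derivC_cst c) (nice_der hf ha I hy).
  by rewrite mul0r add0r.
rewrite /Rop !e; try by split=> //; (apply: rf_reP || apply: rf_imP).
by rewrite !mulrDr [_ * (c * _)]mulrCA addrACA.
Qed.

Lemma nice_coef n (T : P -> R[i]^o) X : linear T -> smoothN n (fun a => T ((a^-1)%VF X)).
Proof.
move=> hT.
have h1 : rlinear (fun z => complex.Re (T z)).
  by move=> c u v; rewrite hT /GRing.scale /= ReD ReM /= mul0r subr0.
have h2 : rlinear (fun z => complex.Im (T z)).
  by move=> c u v; rewrite hT /GRing.scale /= ImD ImM /= mul0r addr0.
have oT := curve_openT.
apply: (nice_ext oT _ (niceD oT (nice_inv n X oT h1)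
   (niceM oT (nice_cst n 'i oT) (nice_inv n X oT h2)))) => a _ _.
exact: complexE.
Qed.

Lemma Rop_sum n f a I (s : seq I) (c : I -> R[i]) (y : I -> P) :
  smoothN n.+1 f -> Nbar0 a -> (forall i, y i \in nbar P) ->
  Rop (\sum_(i <- s) c i *: y i) f a = \sum_(i <- s) c i * Rop (y i) f a.
Proof.
move=> hf ha hy; elim: s => [|i s IH].
  rewrite !big_nil; have := Rop_lin (-1) hf ha (mem0v _) (mem0v _).
  by rewrite scaler0 addr0 mulN1r addNr.
rewrite !big_cons (Rop_lin _ hf ha) ?IH //.
by apply: memv_suml => j _; apply: memvZ.
Qed.

(** The direction of differentiation in [pi_s] varies with [a]. Expanding it in a basis of [nbar]
    leaves fixed operators [Rop], with coefficients that are nice functions of [a]. *)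
Lemma pi_s_expand n s X f a : smoothN n.+1 f -> Nbar0 a ->
  pi_s P s X f a = s * (pd_lamq P (daddv_pi (qq P) (nbar P) ((a^-1)%VF X)) : R[i]) * f a
   - \sum_(i < \dim (nbar P)) (coord (vbasis (nbar P)) i
        (daddv_pi (nbar P) (qq P) ((a^-1)%VF X))) * Rop (vbasis (nbar P))`_i f a.
Proof.
move=> hf ha; rewrite /pi_s; congr (_ - _).
rewrite {1}(coord_vbasis (memv_pi (nbar P) (qq P) ((a^-1)%VF X))).
apply: (Rop_sum _ _ hf ha) => i.
by apply: vbasis_mem; apply: mem_nth; rewrite size_tuple.
Qed.

Lemma nice_pi_s n s X f : smoothN n.+1 f -> smoothN n (pi_s P s X f).
Proof.
move=> hf; have oT := curve_openT.
pose T1 (z : P) : R[i]^o := s * (pd_lamq P (daddv_pi (qq P) (nbar P) z) : R[i]).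
pose T2 i (z : P) : R[i]^o := coord (vbasis (nbar P)) i (daddv_pi (nbar P) (qq P) z).
have l1 : linear T1.
  by move=> c u v; rewrite /T1 !linearP mulrDr /GRing.scale /= mulrCA.
have l2 i : linear (T2 i) by move=> c u v; rewrite /T2 !linearP.
have n1 := niceM oT (nice_coef n X l1) (nice_pred hf).
have n2 i := niceM oT (nice_coef n X (l2 i)) (nice_Rop hf
   (vbasis_mem (mem_nth 0 (_ : (i < size (vbasis (nbar P)))%N)))).
have n3 : smoothN n (fun a => \sum_(i < \dim (nbar P)) T2 i ((a^-1)%VF X) * Rop (vbasis (nbar P))`_i f a).
  by apply: nice_sum => // i; apply: n2; rewrite size_tuple.
apply: (nice_ext oT _ (niceD oT n1 (niceM oT (nice_cst n (-1) oT) n3))) => a ha _.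
by rewrite (pi_s_expand s X hf ha) mulN1r.
Qed.

Lemma pi_s_lin n s f a (c : R[i]) X X' : smoothN n.+1 f -> Nbar0 a ->
  pi_s P s (c *: X + X') f a = c * pi_s P s X f a + pi_s P s X' f a.
Proof.
move=> hf ha; rewrite /pi_s.
rewrite (lfunL (a^-1)%VF); move: ((a^-1)%VF X) ((a^-1)%VF X') => u v.
have hn w : daddv_pi (nbar P) (qq P) w \in nbar P by exact: memv_pi.
move: (daddv_pi (nbar P) (qq P)) (daddv_pi (qq P) (nbar P)) hn => Tn Tq hn.
rewrite (lfunL Tn) (lfunL Tq).
rewrite (Rop_lin c hf ha (hn u) (hn v)).
rewrite (lfunL (pd_lamq P)) -[_ *: _ + _]/(c * _ + _).
move: (Rop _ f a) (Rop _ f a) (pd_lamq P _ : R[i]) (pd_lamq P _ : R[i]) (f a) => *.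
ring.
Qed.

End Nice.

(** * Multilinear forms, polarization and dual bases *)

Section Multilinear.
Context {K : fieldType} {V : vectType K} (W : {vspace V}).
Implicit Type F : seq V -> K.

(** Formulated on words, because iterated derivatives and iterated brackets are both folds over
    words; entries are confined to [W] since [Rop] is linear only on [nbar]. *)
Definition mlin F := forall s1 s2 (c : K) u v,
  {subset s1 <= W} -> {subset s2 <= W} -> u \in W -> v \in W ->
  F (s1 ++ (c *: u + v) :: s2) = c * F (s1 ++ u :: s2) + F (s1 ++ v :: s2).

Lemma mlin_sum F s1 s2 I (r : seq I) (c : I -> K) (v : I -> V) : mlin F ->
  {subset s1 <= W} -> {subset s2 <= W} -> (forall i, v i \in W) ->
  F (s1 ++ (\sum_(i <- r) c i *: v i) :: s2) =
  \sum_(i <- r) c i * F (s1 ++ v i :: s2).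
Proof.
move=> hF h1 h2 hv; elim: r => [|i r IH].
  rewrite !big_nil; have := hF s1 s2 (-1) 0 0 h1 h2 (mem0v _) (mem0v _).
  by rewrite scaler0 addr0 mulN1r addNr.
rewrite !big_cons hF ?IH //; apply: memv_suml => j _; exact: memvZ.
Qed.

Definition ffcons k m (p : 'I_m * {ffun 'I_k -> 'I_m}) : {ffun 'I_k.+1 -> 'I_m} :=
  [ffun t => oapp p.2 p.1 (unlift ord0 t)].

Lemma ffcons0 k m (p : 'I_m * {ffun 'I_k -> 'I_m}) : ffcons p ord0 = p.1.
Proof. by rewrite ffunE unlift_none. Qed.

Lemma ffconsS k m (p : 'I_m * {ffun 'I_k -> 'I_m}) t : ffcons p (lift ord0 t) = p.2 t.
Proof. by rewrite ffunE liftK. Qed.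

Lemma sum_ffcons k m (G : {ffun 'I_k.+1 -> 'I_m} -> K) :
  \sum_J G J = \sum_(j < m) \sum_(J : {ffun 'I_k -> 'I_m}) G (ffcons (j, J)).
Proof.
rewrite pair_bigA /= (reindex (@ffcons k m)) /=.
  by apply: eq_bigr => -[].
exists (fun f => (f ord0, [ffun t => f (lift ord0 t)])) => [[j J] _|f _] /=.
  rewrite ffcons0; congr (_, _); apply/ffunP => t; by rewrite ffunE ffconsS.
apply/ffunP => t; case: (unliftP ord0 t) => [t' ->|->].
  by rewrite ffconsS ffunE.
by rewrite ffcons0.
Qed.

(** The prefix [s0] holds the slots already expanded, which lets the induction treat the first
    remaining slot. *)
Lemma mlin_expand F k m (s0 : seq V) (c : 'I_k -> 'I_m -> K) (v : 'I_m -> V) :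
  mlin F -> {subset s0 <= W} -> (forall j, v j \in W) ->
  F (s0 ++ [seq \sum_j c t j *: v j | t <- enum 'I_k]) =
  \sum_(J : {ffun 'I_k -> 'I_m}) (\prod_t c t (J t)) *
     F (s0 ++ [seq v (J t) | t <- enum 'I_k]).
Proof.
move=> hF + hv; elim: k s0 c => [|k IH] s0 c hs0.
  rewrite (bigD1 [ffun t : 'I_0 => match notF (ltn_ord t) with end]) //= big_ord0 mul1r.
  rewrite big1 ?addr0; last by move=> J /negP[]; apply/eqP/ffunP => -[].
  by congr F; congr cat; rewrite (size0nil (_ : size (enum 'I_0) = 0)%N) ?size_enum_ord.
have hsum t : \sum_j c t j *: v j \in W.
  by apply: memv_suml => j _; apply: memvZ.
rewrite enum_ordSl /= -map_comp mlin_sum //; last first.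
  by move=> x /mapP[t _ ->] /=; apply: hsum.
rewrite sum_ffcons; apply: eq_bigr => j _.
have hs : {subset rcons s0 (v j) <= W}.
  by move=> x; rewrite mem_rcons inE => /orP[/eqP ->|/hs0].
have := IH (rcons s0 (v j)) (fun t => c (lift ord0 t)) hs.
rewrite cat_rcons (_ : map _ _ = [seq ((fun t => \sum_j0 c t j0 *: v j0) \o lift ord0) i
   | i <- enum 'I_k]) // => ->.
rewrite mulr_sumr; apply: eq_bigr => J _.
rewrite big_ord_recl ffcons0 /= mulrA; congr (_ * _ * F _).
  by apply: eq_bigr => t _; rewrite ffconsS.
rewrite cat_rcons; congr (_ ++ _ :: _); rewrite -map_comp.
by apply: eq_map => t /=; rewrite ffconsS.
Qed.

(** Replacing [J] by [J] composed with [w] frees the coefficient product from [w], so that it can be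
    pulled out of the symmetrization. *)
Lemma mlin_perm_expand F k m (w : 'S_k) (c : 'I_k -> 'I_m -> K) (v : 'I_m -> V) :
  mlin F -> (forall j, v j \in W) ->
  F [seq \sum_j c (w t) j *: v j | t <- enum 'I_k] =
  \sum_(J : {ffun 'I_k -> 'I_m}) (\prod_t c t (J t)) *
     F [seq v (J (w t)) | t <- enum 'I_k].
Proof.
move=> hF hv.
have := @mlin_expand F k m [::] (fun t => c (w t)) v hF _ hv.
rewrite !cat0s => ->; last by [].
rewrite (reindex (fun J : {ffun 'I_k -> 'I_m} => [ffun t => J (w t)])) /=; last first.
  exists (fun J : {ffun 'I_k -> 'I_m} => [ffun t => J ((w^-1)%g t)]) => J _;
    by apply/ffunP => t; rewrite !ffunE ?permK ?permKV.
apply: eq_bigr => J _; congr (_ * _).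
  rewrite [RHS](reindex_inj (@perm_inj _ w)); apply: eq_bigr => t _; by rewrite ffunE.
by congr F; apply: eq_map => t; rewrite ffunE.
Qed.

Definition mlsym F k (y : 'I_k -> V) : K :=
  k`!%:R^-1 * \sum_(w : 'S_k) F [seq y (w t) | t <- enum 'I_k].

Lemma mlsym_lin F F1 F2 (c : K) k (y : 'I_k -> V) :
  (forall w : 'S_k, F [seq y (w t) | t <- enum 'I_k] =
    c * F1 [seq y (w t) | t <- enum 'I_k] + F2 [seq y (w t) | t <- enum 'I_k]) ->
  mlsym F y = c * mlsym F1 y + mlsym F2 y.
Proof.
move=> h; rewrite /mlsym (eq_bigr _ (fun w _ => h w)) big_split /= mulrDr.
by rewrite -mulr_sumr mulrCA.
Qed.

Lemma mlsym_expand F k m (c : 'I_k -> 'I_m -> K) (v : 'I_m -> V) (y : 'I_k -> V) :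
  mlin F -> (forall j, v j \in W) -> (forall t, y t = \sum_j c t j *: v j) ->
  mlsym F y = \sum_(J : {ffun 'I_k -> 'I_m}) (\prod_t c t (J t)) * mlsym F (v \o J).
Proof.
move=> hF hv hy; rewrite /mlsym.
under eq_bigr => w _.
  rewrite (eq_map (g := fun t => \sum_j c (w t) j *: v j)); last by move=> t; exact: hy.
  rewrite (mlin_perm_expand w c hF hv); over.
rewrite exchange_big /= mulr_sumr; apply: eq_bigr => J _.
by rewrite mulrCA -mulr_sumr.
Qed.

End Multilinear.

Section Polarization.
Context {K : fieldType} {V : vectType K} (W : {vspace V}).

(** Each summand is a product over [i], and the sum over [S] factors into the product of 1 minus the
    indicator that [i] is outside the image of [J]. This is 1 if [J] is onto, equivalently
    injective, and 0 otherwise. *)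
Lemma alternating_cover k (J : {ffun 'I_k -> 'I_k}) :
  \sum_(S : {set 'I_k}) (-1) ^+ (k - #|S|) * \prod_t (J t \in S)%:R =
  (injectiveb J)%:R :> K.
Proof.
have e (S : {set 'I_k}) : (-1) ^+ (k - #|S|) * \prod_t (J t \in S)%:R =
   \prod_i (if i \in S then 1 else - (i \notin codom J)%:R) :> K.
  have -> : (-1) ^+ (k - #|S|) = \prod_i (if i \in S then 1 else -1) :> K.
    transitivity (\prod_(i in ~: S) (-1) : K).
      by rewrite prodr_const [#|~: S|]cardsCs finset.setCK card_ord.
    by rewrite big_mkcond; apply: eq_bigr => i _; rewrite inE; case: (i \in S).
  have -> : \prod_t (J t \in S)%:R = \prod_i (if i \in S then 1 else (i \notin codom J)%:R) :> K.
    have [/existsP[t ht]|/existsPn h] := boolP [exists t, J t \notin S].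
      rewrite (bigD1 t) //= (negPf ht) mul0r (bigD1 (J t)) //= (negPf ht).
      by rewrite codom_f mul0r.
    rewrite big1 => [|t _]; last by have := h t; rewrite negbK => ->.
    rewrite big1 // => i _; case: ifP => // iS.
    suff -> : i \notin codom J by [].
    by apply/codomP => -[t et]; have := h t; rewrite -et iS.
  rewrite -big_split; apply: eq_bigr => i _ /=.
  by case: ifP => _; rewrite ?mul1r // mulN1r.
under eq_bigr do rewrite e.
transitivity (\prod_(i < k) (1 + - (i \notin codom J)%:R) : K).
  by rewrite bigA_distr; apply: eq_bigl => S; rewrite inE.
have [inj|ninj] := boolP (injectiveb J).
  rewrite big1 // => i _.
  have /codomP[t ->] : i \in codom J.
    by have [g _ gK] := injF_bij (injectiveP _ inj); rewrite -(gK i) codom_f.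
  by rewrite codom_f subr0.
have [/forallP h|/forallPn[i hi]] := boolP [forall i, i \in codom J].
  case/negP: ninj; rewrite /injectiveb /dinjectiveb.
  apply: (leq_size_uniq (enum_uniq 'I_k)); first by move=> i _; apply: h.
  by rewrite size_image size_enum_ord card_ord.
by rewrite (bigD1 i) //= hi subrr mul0r.
Qed.

(* The alternating sum in [polar] is inclusion-exclusion: it keeps exactly the
   bijective index maps, i.e. it symmetrizes [B]. *)
Lemma polarization k (p : V -> K) (B : seq V -> K) (y : 'I_k -> V) :
  mlin W B -> (forall t, y t \in W) ->
  (forall x, x \in W -> p x = B [seq x | t <- enum 'I_k]) ->
  k`!%:R^-1 * \sum_(S : {set 'I_k}) (-1) ^+ (k - #|S|) * p (\sum_(i in S) y i) =
  mlsym B y.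
Proof.
move=> hB hy hp; rewrite /mlsym; congr (_ * _).
transitivity (\sum_(S : {set 'I_k}) \sum_(J : {ffun 'I_k -> 'I_k})
   (-1) ^+ (k - #|S|) * \prod_t (J t \in S)%:R * B [seq y (J t) | t <- enum 'I_k]).
  apply: eq_bigr => S _.
  have -> : \sum_(i in S) y i = \sum_i (i \in S)%:R *: y i.
    by rewrite big_mkcond; apply: eq_bigr => i _; case: (i \in S); rewrite ?scale1r ?scale0r.
  rewrite hp; last by apply: memv_suml => i _; apply: memvZ.
  have := @mlin_expand _ _ _ B k k [::] (fun _ i => (i \in S)%:R) y hB _ hy.
  rewrite cat0s => ->; last by [].
  by rewrite mulr_sumr; apply: eq_bigr => J _; rewrite mulrA.
rewrite exchange_big /=.
under eq_bigr do rewrite -mulr_suml alternating_cover.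
rewrite (bigID (fun J : {ffun 'I_k -> 'I_k} => injectiveb J)) /= addrC big1 ?add0r; last first.
  by move=> J /negPf ->; rewrite mul0r.
rewrite (reindex (@pval _)) /=; last first.
  pose in_Sn := insubd (1%g : 'S_k).
  by exists in_Sn => /= f Uf; first apply: val_inj; apply: insubdK.
apply: eq_big => [w|w _]; first by rewrite (valP w).
rewrite (valP w) mul1r; congr B; apply: eq_map => t; by rewrite pvalE.
Qed.

End Polarization.

(** * Dual bases and invariance of their contraction *)

Section DualBases.
Context {K : fieldType} {g : lieAlgebra K}.
Context (U U' : {vspace g}) (n : nat) (e e' : n.-tuple g).
Hypothesis be : basis_of U e.
Hypothesis be' : basis_of U' e'.
Hypothesis dual : forall i j : 'I_n, killing (tnth e i) (tnth e' j) = (i == j)%:R.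

Lemma dual_coord u : u \in U -> u = \sum_j killing u (tnth e' j) *: tnth e j.
Proof.
move=> hu; rewrite {1}(coord_basis be hu); apply: eq_bigr => j _.
rewrite -tnth_nth; congr (_ *: _).
rewrite {2}(coord_basis be hu) killing_suml (bigD1 j) //= big1 ?addr0.
  have := killing_linl (tnth e' j) (coord e j u) (e`_j) 0; rewrite addr0 => ->.
  by rewrite killing0l addr0 -tnth_nth dual eqxx /GRing.scale /= mulr1.
move=> i ij; have := killing_linl (tnth e' j) (coord e i u) (e`_i) 0; rewrite addr0 => ->.
by rewrite killing0l addr0 -tnth_nth dual (negPf ij) scaler0.
Qed.

End DualBases.

Section DualChange.
Context {K : fieldType} {g : lieAlgebra K}.
Context (U U' : {vspace g}) (n : nat) (e e' : n.-tuple g).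
Hypothesis be : basis_of U e.
Hypothesis be' : basis_of U' e'.
Hypothesis dual : forall i j : 'I_n, killing (tnth e i) (tnth e' j) = (i == j)%:R.
Context (l l' : 'End(g)).
Hypothesis l'K : forall x, l (l' x) = x.
Hypothesis lk : forall x y, killing (l x) (l y) = killing x y.
Hypothesis lU : forall x, x \in U -> l' x \in U.
Hypothesis lU' : forall x, x \in U' -> l x \in U'.

Lemma l'_coord i : l' (tnth e i) = \sum_j killing (l' (tnth e i)) (tnth e' j) *: tnth e j.
Proof. by apply: (dual_coord be dual); apply/lU/(basis_mem be)/mem_tnth. Qed.

(** Invariance of the Killing form makes this the transpose of the matrix in [l'_coord]. *)
Lemma l_coord j : l (tnth e' j) = \sum_i killing (l' (tnth e i)) (tnth e' j) *: tnth e' i.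
Proof.
have dual' (i i' : 'I_n) : killing (tnth e' i) (tnth e i') = (i == i')%:R.
  by rewrite killingC dual eq_sym.
rewrite {1}(dual_coord be' dual' (lU' (basis_mem be' (mem_tnth j e')))).
by apply: eq_bigr => i _; rewrite killingC -{1}(l'K (tnth e i)) lk.
Qed.

(** Invariance of the canonical tensor of a pair of dual bases: the matrix of [l] moves from the
    first slot to the second, where it rebuilds [l (l' e_i) = e_i]. Applied to [xs], [xs'] it is the
    invariance of [omega]. *)
Lemma dual_bil_inv (b : g -> g -> K) :
  (forall z, linear (fun x => b x z : K^o)) -> (forall x, linear (b x : g -> K^o)) ->
  \sum_j b (l (tnth e' j)) (l (tnth e j)) = \sum_j b (tnth e' j) (tnth e j).
Proof.
move=> hl hr.
have step j : b (l (tnth e' j)) (l (tnth e j)) =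
    \sum_i killing (l' (tnth e i)) (tnth e' j) * b (tnth e' i) (l (tnth e j)).
  rewrite {1}l_coord -(linfun_lin (hl (l (tnth e j)))) linear_sum.
  by apply: eq_bigr => i _; rewrite linearZ /= linfun_lin.
under eq_bigr do rewrite step.
rewrite exchange_big; apply: eq_bigr => i _ /=.
rewrite -{2}(l'K (tnth e i)) {2}l'_coord linear_sum.
rewrite -(linfun_lin (hr (tnth e' i))) linear_sum.
by apply: eq_bigr => j _; rewrite !linearZ /= linfun_lin.
Qed.

End DualChange.

(** * Conjugation by the Levi subgroup *)

Section SmoothTransport.
Context {R : realType} (E : vectType R[i]).
Notation VV := ('rV[R]_(\dim {:E}) * 'rV[R]_(\dim {:E}))%type.

(** For linear [L] the derivative of [G \o L] along [v] is that of [G] along [L v], composed with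
    [L], so the iteration never leaves this form. *)
Lemma times_diff_comp (L : {linear VV -> VV}) (O : set VV) n (G : VV -> R) :
  (forall p, differentiable L p) -> times_diff O n G ->
  times_diff (L @^-1` O) n (G \o L).
Proof.
move=> hL; elim: n G => [|n IH] G [h1 h2].
  by split=> // p hp; apply: differentiable_comp => //; apply: h1.
split=> [p hp|v]; first by apply: differentiable_comp => //; apply: h1.
have -> : 'D_v (G \o L) = 'D_(L v) G \o L.
  by apply/funext => p; rewrite /derive /=; do 2 f_equal; apply/funext => t /=; rewrite linearP.
exact: (IH ('D_(L v) G) (h2 (L v))).
Qed.

Lemma smooth_on_comp (L : {linear VV -> VV}) (O : set VV) (F : VV -> R[i]) :
  (forall p, differentiable L p) -> smooth_on O F ->
  smooth_on (L @^-1` O) (F \o L).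
Proof.
move=> hL hF n; have [h1 h2] := hF n.
by split; [exact: (times_diff_comp hL h1) | exact: (times_diff_comp hL h2)].
Qed.

End SmoothTransport.

Lemma comp_conj (K : fieldType) (V : vectType K) (l a b c : 'End(V)) :
  lker l == 0%VS -> (l \o b = c \o l)%VF ->
  (l \o (a \o b) \o l^-1 = (l \o a \o l^-1) \o c)%VF.
Proof.
move=> l0 e.
have -> : c = (l \o b \o l^-1)%VF by rewrite e -comp_lfunA lker0_compfV // comp_lfun1r.
by rewrite -!comp_lfunA (lker0_compKf l0).
Qed.

Section Conjugation.
Context {R : realType} (P : parabolicData R).
Hypothesis r_gt0 : (0 < pd_r P)%N.
Context (x : P) (hx : x \in ll P) (gx : pd_g0 P x).
Notation EndP := 'End(P).
Notation l := (lexp (ad x)).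
Implicit Types (f : fsec P) (a : EndP).

Definition cl a : EndP := (l \o a \o l^-1)%VF.
Definition cf f : fsec P := fun a => f (cl a).

Lemma cl1 : cl \1%VF = \1%VF.
Proof. by rewrite /cl comp_lfun1r lker0_compfV ?lexp_ker0. Qed.

Lemma cl_lexp a y : cl (a \o lexp (ad y))%VF = (cl a \o lexp (ad (l y)))%VF.
Proof.
have e := lexp_ad_conj y (lexp_ker0 (ad x)) (lexp_ad_auto x).
exact: (comp_conj a (lexp_ker0 (ad x)) e).
Qed.

Lemma levi_nbar0 y : nbar0 y -> nbar0 (l y).
Proof. by move=> [h1 h2]; split; [apply: levi_nbar | apply: rf_lexp]. Qed.

Lemma cl_Nbar0 a : Nbar0 a -> Nbar0 (cl a).
Proof.
elim=> [|u y _ IH hy]; first by rewrite cl1; apply: analytic_id.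
by rewrite cl_lexp; apply: analytic_mul => //; apply: levi_nbar0.
Qed.

Lemma Rreal_cf y f : Rreal y (cf f) = cf (Rreal (l y) f).
Proof.
apply/funext => a.
have e : (fun t : R => f (cl (a \o lexp (ad (t%:C *: y)))%VF)) =
   (fun t : R => f (cl a \o lexp (ad (t%:C *: l y)))%VF).
  by apply/funext => t; rewrite cl_lexp linearZ.
exact: (congr1 (fun u => Defs.derivC u 0) e).
Qed.

Lemma Rop_cf y f : Rop y (cf f) = cf (Rop (l y) f).
Proof.
have [e1 e2] := rf_re_auto y (fun z => rf_lexp gx (y := z)).
by apply/funext => a; rewrite /Rop e1 e2 !Rreal_cf.
Qed.

Lemma Rprod_cf s f : Rprod s (cf f) = cf (Rprod (map l s) f).
Proof. by elim: s => //= y s IH; rewrite IH Rop_cf. Qed.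

Lemma cl_inv a X : Nbar0 a -> ((cl a)^-1)%VF (l X) = l ((a^-1)%VF X).
Proof.
move=> ha; have a0 := Nbar0_ker0 ha; have l0 := lexp_ker0 (ad x).
have c0 : lker (cl a) == 0%VS by apply: Nbar0_ker0; apply: cl_Nbar0.
apply: (lker0P c0); rewrite (lker0_lfunVK c0) /cl !comp_lfunE.
by rewrite (lker0_lfunK l0) (lker0_lfunVK a0).
Qed.

Lemma pi_sE s X f a z : (a^-1)%VF X = z -> pi_s P s X f a =
  s * (pd_lamq P (daddv_pi (qq P) (nbar P) z) : R[i]) * f a
  - Rop (daddv_pi (nbar P) (qq P) z) f a.
Proof. by move=> <-. Qed.

(** [Ad(l)] commutes with the projections to [q] and [nbar] and preserves the character on [q],
    while conjugation carries [Rop y] to [Rop (l y)]. *)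
Lemma pi_s_cf s X f a : Nbar0 a -> pi_s P s X (cf f) a = pi_s P s (l X) f (cl a).
Proof.
move=> ha; rewrite (pi_sE s (cf f) (erefl ((a^-1)%VF X))) (pi_sE s f (cl_inv X ha)).
move: ((a^-1)%VF X) => z.
have hq : daddv_pi (qq P) (nbar P) z \in qq P by exact: memv_pi.
have := levi_lamq hx hq; have := levi_proj hx z.
move: (daddv_pi (nbar P) (qq P)) (daddv_pi (qq P) (nbar P)) => Tn Tq [-> ->] ->.
by rewrite Rop_cf.
Qed.

Notation VV := ('rV[R]_(\dim {:EndP}) * 'rV[R]_(\dim {:EndP}))%type.

Definition clV (p : VV) : VV := vcoords (cl (rcoord_point p)).

Lemma rcoord_lin (t : R) (p q : VV) :
  rcoord_point (t *: p + q) = t%:C *: rcoord_point p + rcoord_point q :> EndP.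
Proof.
rewrite /rcoord_point scaler_sumr -big_split; apply: eq_bigr => i _ /=.
rewrite scalerA -scalerDl; congr (_ *: _); rewrite !mxE.
by apply/eqP; rewrite eq_complex /= !mul0r subr0 addr0 !eqxx.
Qed.

Lemma cl_lin : linear cl.
Proof. by move=> c a b; rewrite /cl comp_lfunDr -comp_lfunZr comp_lfunDl -comp_lfunZl. Qed.

Lemma vcoords_lin (t : R) (a b : EndP) : vcoords (t%:C *: a + b) = t *: vcoords a + vcoords b.
Proof. by congr (_, _); apply/rowP => i; rewrite !mxE rc_rlin. Qed.

Lemma clV_lin : linear clV.
Proof. by move=> t p q; rewrite /clV rcoord_lin cl_lin vcoords_lin. Qed.

HB.instance Definition _ := GRing.isLinear.Build R VV VV *:%R clV clV_lin.

(** Written as a finite sum of coordinate functions times fixed vectors, whose differentiability is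
    available factor by factor. *)
Lemma clV_diff (p : VV) : differentiable clV p.
Proof.
pose c (q : 'I_(\dim {:EndP}) * bool) (p : VV) : R :=
  if q.2 then p.1 0 q.1 else p.2 0 q.1.
have cd q (p' : VV) : differentiable (c q) p'.
  rewrite /c; case: q.2.
    rewrite (_ : (fun p : VV => p.1 0 q.1) = (fun M : 'rV[R]_(\dim {:EndP}) => M 0 q.1) \o fst) //.
    apply: differentiable_comp; last exact: differentiable_coord.
    by apply: linear_differentiable => z; apply: cvg_fst.
  rewrite (_ : (fun p : VV => p.2 0 q.1) = (fun M : 'rV[R]_(\dim {:EndP}) => M 0 q.1) \o snd) //.
  apply: differentiable_comp; last exact: differentiable_coord.
  by apply: linear_differentiable => z; apply: cvg_snd.
have e : clV = fun p : VV => \sum_q c q p *: vcoords (cl (rb q)).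
  apply/funext => p'; rewrite /clV.
  have -> : rcoord_point p' = \sum_q (c q p')%:C *: rb q :> EndP.
    rewrite /rcoord_point -(pair_bigA _ (fun i b => (c (i, b) p')%:C *: rb (i, b))) /=.
    apply: eq_bigr => i _; rewrite big_bool /= /rb /= scalerA -scalerDl; congr (_ *: _).
    by rewrite [LHS]complexE mulrC.
  elim: (index_enum _) => [|q s IH].
    rewrite !big_nil.
    have -> : cl 0 = 0 by rewrite /cl comp_lfun0r comp_lfun0l.
    by congr (_, _); apply/rowP => i; rewrite !mxE rlin0 //; exact: rc_rlin.
  by rewrite !big_cons cl_lin vcoords_lin IH.
rewrite e; elim: (index_enum _) => [|q s IH].
  rewrite (_ : (fun p : VV => _) = cst 0); last by apply/funext => p'; rewrite big_nil.
  exact: differentiable_cst.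
rewrite (_ : (fun p : VV => _) = (fun p => c q p *: vcoords (cl (rb q))) +
   (fun p : VV => \sum_(q <- s) c q p *: vcoords (cl (rb q)))).
  by apply: differentiableD => //; apply: differentiableZl.
by apply/funext => p'; rewrite big_cons.
Qed.

Lemma smooth_cf f : smooth_section f -> smooth_section (cf f).
Proof.
move=> hf p hp.
have [|O [F [oO hO hF e]]] := hf (clV p); first by rewrite vcoordsK; apply: cl_Nbar0.
exists (clV @^-1` O), (F \o clV); split.
- apply: open_comp oO => q _; apply: differentiable_continuous; exact: clV_diff.
- exact: hO.
- exact: (smooth_on_comp clV_diff hF).
- move=> q hq hn; rewrite /cf -(vcoordsK (cl (rcoord_point q))) e //.
  by rewrite vcoordsK; apply: cl_Nbar0.
Qed.

End Conjugation.

(** * Products of [Rop] on sections smooth to all orders *)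

Section Words.
Context {R : realType} (P : parabolicData R).
Hypothesis r_gt0 : (0 < pd_r P)%N.
Implicit Types (f h : fsec P) (a : 'End(P)) (s : seq P).

Definition sm f := forall n, nice (@everywhere _ P) n f.

Lemma Rprod_sm s f : sm f -> {subset s <= nbar P} -> sm (Rprod s f).
Proof.
move=> hf; elim: s => [//|y s IH] hs n /=.
apply: (nice_Rop r_gt0); last by apply: hs; rewrite inE eqxx.
by apply: IH => z hz; apply: hs; rewrite inE hz orbT.
Qed.

Lemma Rprod_ext s f h : {subset s <= nbar P} -> (forall a, Nbar0 a -> f a = h a) ->
  forall a, Nbar0 a -> Rprod s f a = Rprod s h a.
Proof.
move=> + e; elim: s => [|y s IH] hs a ha /=; first exact: e.
apply: (Rop_ext r_gt0) => //; first by apply: hs; rewrite inE eqxx.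
by apply: IH => z hz; apply: hs; rewrite inE hz orbT.
Qed.

Lemma Rprod_flin s f h (c : R[i]) : {subset s <= nbar P} -> sm f -> sm h ->
  forall a, Nbar0 a ->
  Rprod s (fun b => c * f b + h b) a = c * Rprod s f a + Rprod s h a.
Proof.
move=> + hf hh; elim: s => [//|y s IH] hs a ha /=.
have hs' : {subset s <= nbar P} by move=> z hz; apply: hs; rewrite inE hz orbT.
have hy : y \in nbar P by apply: hs; rewrite inE eqxx.
have f1 := Rprod_sm hf hs' 1%N; have h1 := Rprod_sm hh hs' 1%N.
rewrite -(Rop_flin r_gt0 c hy f1 h1 ha).
by apply: (Rop_ext r_gt0) => // b hb; apply: IH.
Qed.

Lemma Rprod_cat s1 s2 f : Rprod (s1 ++ s2) f = Rprod s1 (Rprod s2 f).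
Proof. by elim: s1 => //= y s1 ->. Qed.

Lemma Rprod_mlin f a : sm f -> Nbar0 a -> mlin (nbar P) (fun s => Rprod s f a).
Proof.
move=> hf ha s1 s2 c u v h1 h2 hu hv; rewrite !Rprod_cat.
have hg := Rprod_sm hf h2.
have su : sm (Rop u (Rprod s2 f)) by move=> n; apply: (nice_Rop r_gt0 (hg n.+1) hu).
have sv : sm (Rop v (Rprod s2 f)) by move=> n; apply: (nice_Rop r_gt0 (hg n.+1) hv).
rewrite -[RHS](Rprod_flin c h1 su sv ha).
apply: Rprod_ext => // b hb /=; exact: (Rop_lin r_gt0 c (hg 1%N) hb hu hv).
Qed.

Lemma sm_pi_s (s : R[i]) X f : sm f -> sm (pi_s P s X f).
Proof. by move=> hf n; apply: nice_pi_s. Qed.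

Lemma smooth_sm f : smooth_section f -> sm f.
Proof. by move=> hf n; apply: smooth_nice. Qed.

End Words.

(** * Propagation of the span condition *)

(** Among the subspaces contained in [S] take one of maximal dimension: adjoining any [v] satisfying
    [S] cannot enlarge it. This turns the undecidable span condition into a [vspace]. *)
Lemma pred_vspace (K : fieldType) (V : vectType K) (S : V -> Prop) :
  S 0 -> (forall c u v, S u -> S v -> S (c *: u + v)) ->
  exists W : {vspace V}, forall v, v \in W <-> S v.
Proof.
move=> S0 SL.
pose Q d := `[< exists W : {vspace V}, \dim W = d /\ forall v, v \in W -> S v >].
have Q0 : exists d, Q d.
  by exists 0%N; apply/asboolP; exists 0%VS; rewrite dimv0; split=> // v; rewrite memv0 => /eqP ->.
have Qb d : Q d -> (d <= \dim {:V})%N.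
  by move=> /asboolP[W [<- _]]; apply: dimvS; apply: subvf.
case: (ex_maxnP Q0 Qb) => d /asboolP[W [dW hW]] dmax.
exists W => v; split=> [|hv]; first exact: hW.
have hWv : forall w, w \in (W + <[v]>)%VS -> S w.
  move=> w /memv_addP[u hu [u' /vlineP[c ->] ->]]; rewrite addrC; apply: SL => //.
  exact: hW.
have /dmax dle : Q (\dim (W + <[v]>)%VS) by apply/asboolP; exists (W + <[v]>)%VS.
have /eqP -> : W == (W + <[v]>)%VS by rewrite eqEdim addvSl dW.
by rewrite (subvP (addvSr _ _)) // memv_line.
Qed.

Lemma is_derive_sumseq (R : realType) I (s : seq I) (u : I -> R -> R) (u' : I -> R) :
  (forall i, is_derive (0 : R) (1 : R) (u i) (u' i)) ->
  is_derive (0 : R) (1 : R) (fun t => \sum_(i <- s) u i t) (\sum_(i <- s) u' i).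
Proof.
move=> hu; elim: s => [|i s IH].
  rewrite big_nil (_ : (fun t => _) = cst 0); first exact: is_derive_cst.
  by apply/funext => t; rewrite big_nil.
rewrite big_cons (_ : (fun t => _) = u i + (fun t => \sum_(i <- s) u i t)).
  exact: is_deriveD.
by apply/funext => t; rewrite big_cons.
Qed.

Lemma bil_derive (R : realType) (V1 V2 V3 : vectType R[i]) (beta : V1 -> V2 -> V3)
    (A : 'End(V1)) (B : 'End(V2)) x y (phi : V3 -> R) :
  (forall v, linear (beta^~ v)) -> (forall u, linear (beta u)) -> rlinear phi ->
  is_derive (0 : R) (1 : R)
    (fun t : R => phi (beta (lexp (t%:C *: A) x) (lexp (t%:C *: B) y)))
    (phi (beta (A x) y + beta x (B y))).
Proof.
move=> hl hr hphi.
rewrite (_ : (fun t : R => _) = (fun t : R => \sum_p \sum_q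
   rc p (lexp (t%:C *: A) x) * (rc q (lexp (t%:C *: B) y) * phi (beta (rb p) (rb q))))); last first.
  by apply/funext => t; rewrite (bil_expand hl hr hphi).
rewrite (rlinD hphi) !(bil_expand hl hr hphi) -big_split /=.
apply: is_derive_sumseq => p; rewrite -big_split /=; apply: is_derive_sumseq => q.
have h1 := lexp_derive A x (rc_rlin p); have h2 := lexp_derive B y (rc_rlin q).
have h3 := is_deriveM h2 (is_derive_cst (phi (beta (rb p) (rb q))) (0 : R) (1 : R)).
apply: is_derive_eq (is_deriveM h1 h3) _.
have -> : (0 : R)%:C *: A = 0 by rewrite scale0r.
have -> : (0 : R)%:C *: B = 0 by rewrite scale0r.
rewrite mulrfctE.
have -> : (0 : R)%:C *: B = 0 by rewrite scale0r.
rewrite !lexp0 /GRing.scale /= /cst; ring.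
Qed.

(** The infinitesimal form of stability under a one-parameter group acting on both factors: the
    product rule for a curve inside the closed subspace [W]. *)
Lemma bil_deriv_mem (R : realType) (V1 V2 V3 : vectType R[i]) (beta : V1 -> V2 -> V3)
    (A : 'End(V1)) (B : 'End(V2)) x y (W : {vspace V3}) :
  (forall v, linear (beta^~ v)) -> (forall u, linear (beta u)) ->
  (forall t : R, beta (lexp (t%:C *: A) x) (lexp (t%:C *: B) y) \in W) ->
  beta (A x) y + beta x (B y) \in W.
Proof.
move=> hl hr h; pose Q : 'End(V3) := \1%VF - projv W.
have QE v : Q v = v - projv W v by rewrite add_lfunE opp_lfunE id_lfunE.
set w := _ + _.
suff : Q w = 0.
  by rewrite QE => /eqP; rewrite subr_eq0 => /eqP ->; apply: memv_proj.
apply: rlin_sep => phi hphi.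
have hp := rlin_comp (linearP Q) hphi.
have := bil_derive A B x y hl hr hp; rewrite (_ : (fun t : R => _) = cst (phi 0)); last first.
  by apply/funext => t /=; rewrite QE projv_id ?subrr.
by move=> h1; rewrite -[LHS](derive_val (is_derive := h1)) derive_cst rlin0.
Qed.

(** * Covariance of [Omega] and the stable subspace of tensors *)

Section Main.
Context {R : realType} (P : parabolicData R).
Hypothesis r_gt0 : (0 < pd_r P)%N.
Context (m : nat) (e e' : m.-tuple P) (d : nat) (xs xs' : d.-tuple P).
Hypothesis he : dual_bases (grd P 1) (grd P (-1)) e e'.
Hypothesis hxs : dual_bases (grd P (pd_r P)%:Z) (grd P (- (pd_r P)%:Z)) xs xs'.
Context (k : nat).
Notation gk := (grd P (k%:Z - (pd_r P)%:Z)).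
Notation gt := (grd P (pd_r P)%:Z).
(* [M], [val] and [mk] stand for [bidual P k], [bival] and [mkbidual]. *)
Context (M : vectType R[i]) (val : M -> P -> P -> R[i]) (mk : (P -> P -> R[i]) -> M).
Implicit Types (Y : M) (f g : fsec P).
Hypothesis val_bil : forall Y, bilform (val Y).
Hypothesis val_linY : forall x z, linear (fun Y => val Y x z : R[i]^o).
Hypothesis val_mk : forall B x z, bilform B -> x \in gk -> z \in gt -> val (mk B) x z = B x z.
Hypothesis val_eq : forall Y Y',
  (forall x z, x \in gk -> z \in gt -> val Y x z = val Y' x z) -> Y = Y'.

Definition tautM Y (x : P) : R[i] :=
  (k`!)%:R^-1 * \sum_(j < d) val Y (iter k (ad x) (tnth xs' j)) (tnth xs j).

Definition OmegaM Y : oper P := Rsigma e e' k (tautM Y).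

(** A multilinear form in the word [s], through nested brackets, whose diagonal is [tautM Y]. It
    need not be symmetric; [mlsym] symmetrizes it. *)
Definition Bform Y (s : seq P) : R[i] :=
  (k`!)%:R^-1 * \sum_(j < d) val Y (foldr (@lie _ P) (tnth xs' j) s) (tnth xs j).

Lemma foldr_lie_const (I : Type) (s : seq I) (x z : P) :
  foldr (@lie _ P) z [seq x | _ <- s] = iter (size s) (ad x) z.
Proof. by elim: s => //= i s ->; rewrite adE. Qed.

Lemma tautM_Bform Y x : tautM Y x = Bform Y [seq x | t <- enum 'I_k].
Proof.
congr (_ * _); apply: eq_bigr => j _; congr (val Y _ _).
by rewrite foldr_lie_const size_enum_ord.
Qed.

Lemma foldr_lie_lin (s : seq P) : linear (fun z => foldr (@lie _ P) z s).
Proof. by move=> c u v; elim: s => //= y s ->; rewrite linearP. Qed.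

Lemma val_linl Y z : linear (fun x => val Y x z : R[i]^o).
Proof. by case: (val_bil Y). Qed.

Lemma Bform_mlin Y (W : {vspace P}) : mlin W (Bform Y).
Proof.
move=> s1 s2 c u v _ _ _ _; rewrite /Bform mulrCA -mulrDr; congr (_ * _).
rewrite mulr_sumr -big_split; apply: eq_bigr => j _ /=.
rewrite !foldr_cat /= lieDl lieZl foldr_lie_lin; exact: val_linl.
Qed.

Lemma Bform_linY (c : R[i]) Y Y' s : Bform (c *: Y + Y') s = c * Bform Y s + Bform Y' s.
Proof.
rewrite /Bform mulrCA -mulrDr; congr (_ * _).
rewrite mulr_sumr -big_split; apply: eq_bigr => j _ /=; exact: val_linY.
Qed.

Lemma e_mem i : tnth e i \in grd P 1.
Proof. by case: he => be _ _; apply: (basis_mem be); apply: mem_tnth. Qed.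

Lemma e'_mem i : tnth e' i \in grd P (-1).
Proof. by case: he => _ be _; apply: (basis_mem be); apply: mem_tnth. Qed.

Lemma e'_nbar i : tnth e' i \in nbar P.
Proof. exact: (subvP (sumv_sup (Ordinal r_gt0) isT (subvv _)) _ (e'_mem i)). Qed.

Notation ee I := (fun t => tnth e (I t)).
Notation ee' I := (fun t => tnth e' (I t)).
Notation RF g a := (fun s => Rprod s g a).

(** Polarization turns the coefficients into symmetrized multilinear forms, so that both factors can
    be expanded under a change of basis. *)
Lemma OmegaE Y g a : OmegaM Y g a =
  \sum_(I : {ffun 'I_k -> 'I_m}) mlsym (Bform Y) (ee I) * mlsym (RF g a) (ee' I).
Proof.
apply: eq_bigr => I _; congr (_ * _).
exact: (@polarization _ _ (grd P 1) k (tautM Y) (Bform Y) (ee I) (@Bform_mlin Y _)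
  (fun t => e_mem _) (fun x _ => tautM_Bform Y x)).
Qed.

Lemma OmegaM_linY (c : R[i]) Y Y' g a :
  OmegaM (c *: Y + Y') g a = c * OmegaM Y g a + OmegaM Y' g a.
Proof.
rewrite !OmegaE mulr_sumr -big_split; apply: eq_bigr => I _ /=.
rewrite (mlsym_lin (fun w => Bform_linY c Y Y' _)).
by move: (mlsym _ _) (mlsym _ _) (mlsym _ _) => *; ring.
Qed.

Lemma one_Nbar0 : Nbar0 (\1%VF : 'End(P)).
Proof. exact: analytic_id. Qed.

Lemma e'_sub (I : {ffun 'I_k -> 'I_m}) (w : 'S_k) :
  {subset [seq tnth e' (I (w t)) | t <- enum 'I_k] <= nbar P}.
Proof. by move=> x /mapP[t _ ->]; apply: e'_nbar. Qed.

Lemma OmegaM_flin (c : R[i]) Y f g : sm f -> sm g ->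
  OmegaM Y (fun b => c * f b + g b) \1%VF = c * OmegaM Y f \1%VF + OmegaM Y g \1%VF.
Proof.
move=> hf hg; rewrite !OmegaE mulr_sumr -big_split; apply: eq_bigr => I _ /=.
have -> : mlsym (RF (fun b => c * f b + g b) \1%VF) (ee' I) =
    c * mlsym (RF f \1%VF) (ee' I) + mlsym (RF g \1%VF) (ee' I).
  by apply: mlsym_lin => w; exact: (Rprod_flin r_gt0 c (e'_sub (I := I) (w := w)) hf hg one_Nbar0).
by move: (mlsym _ _) (mlsym _ _) (mlsym _ _) => *; ring.
Qed.

Lemma OmegaM_ext Y f g : (forall a, Nbar0 a -> f a = g a) ->
  OmegaM Y f \1%VF = OmegaM Y g \1%VF.
Proof.
move=> h; rewrite !OmegaE; apply: eq_bigr => I _; congr (_ * _).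
rewrite /mlsym; congr (_ * _); apply: eq_bigr => w _.
exact: (Rprod_ext r_gt0 (e'_sub (I := I) (w := w)) h one_Nbar0).
Qed.

Section Levi.
Context (x : P) (hx : x \in ll P).
Notation l := (lexp (ad x)).
Notation l' := (lexp (ad (- x))).

Lemma l'_ll : - x \in ll P. Proof. by rewrite memvN. Qed.

Lemma lK z : l' (l z) = z.
Proof. by rewrite adN lexpNK. Qed.

Lemma l'K z : l (l' z) = z.
Proof. by have := lexpNK (- ad x) z; rewrite opprK adN. Qed.

Lemma l_killing (u : P) y z : killing (lexp (ad u) y) (lexp (ad u) z) = killing y z.
Proof. by apply: killing_auto; [exact: lexp_ker0 | exact: lexp_ad_auto]. Qed.

Lemma foldr_lie_auto (u : P) z s :
  lexp (ad u) (foldr (@lie _ P) z s) = foldr (@lie _ P) (lexp (ad u) z) (map (lexp (ad u)) s).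
Proof. by elim: s => //= y s IH; rewrite lexp_ad_auto IH. Qed.

Lemma foldr_lie_grd (s : seq P) z (j : int) : {subset s <= grd P 1} -> z \in grd P j ->
  foldr (@lie _ P) z s \in grd P ((size s)%:Z + j).
Proof.
move=> + hz; elim: s => [|y s IH] hs; first by rewrite add0r.
rewrite /= -[(size s).+1]add1n PoszD -addrA; apply: lie_gr.
  by apply: hs; rewrite inE eqxx.
by apply: IH => u hu; apply: hs; rewrite inE hu orbT.
Qed.

(** Invariance of [omega] lets [l] pass from the form [Y] to the entries of the word. The length
    condition places the iterated bracket in [gk], where forms in [M] are determined. *)
Lemma Bform_act Y s : {subset s <= grd P 1} -> size s = k ->
  Bform (bact val mk l Y) s = Bform Y (map l' s).
Proof.
move=> hs hk; have [bx bx' dx] := hxs.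
congr (_ * _).
transitivity (\sum_(j < d) val Y (foldr (@lie _ P) (l' (tnth xs' j)) (map l' s)) (l' (tnth xs j))).
  apply: eq_bigr => j _.
  have h1 : foldr (@lie _ P) (tnth xs' j) s \in gk.
    have := foldr_lie_grd hs (basis_mem bx' (mem_tnth j xs')); by rewrite hk.
  have h2 : tnth xs j \in gt by apply: (basis_mem bx); apply: mem_tnth.
  rewrite (bactE val_bil val_mk Y l h1 h2) lexp_adN; congr (val Y _ _).
  exact: foldr_lie_auto.
have h1 z : z \in gt -> l z \in gt by exact: (levi_grd hx).
have h2 z : z \in grd P (- (pd_r P)%:Z) -> l' z \in grd P (- (pd_r P)%:Z).
  exact: (levi_grd l'_ll).
pose b u z := val Y (foldr (@lie _ P) u (map l' s)) z.
have b1 z : linear (fun u => b u z : R[i]^o).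
  by move=> c u v; rewrite /b foldr_lie_lin; apply: val_linl.
have b2 u : linear (b u : P -> R[i]^o) by case: (val_bil Y) => _; apply.
exact: (dual_bil_inv bx bx' dx lK (l_killing (- x)) h1 h2 b1 b2).
Qed.

Hypothesis gx : pd_g0 P x.

(** The same matrix [A] expresses [l'] on [e] and, transposed, [l] on [e']. Expanding one factor on
    each side gives the same double sum over [I] and [J]. *)
Lemma OmegaM_act Y g : sm g ->
  OmegaM (bact val mk l Y) g \1%VF = OmegaM Y (cf x g) \1%VF.
Proof.
move=> hg; rewrite !OmegaE; have [be be' de] := he.
pose A i j : R[i] := killing (l' (tnth e i)) (tnth e' j).
have l1U z : z \in grd P 1 -> l' z \in grd P 1 by exact: (levi_grd l'_ll).
have l2U z : z \in grd P (-1) -> l z \in grd P (-1) by exact: (levi_grd hx).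
have c1 i : l' (tnth e i) = \sum_j A i j *: tnth e j.
  exact: (l'_coord be de l1U).
have c2 j : l (tnth e' j) = \sum_i A i j *: tnth e' i.
  exact: (l_coord be' de l'K (l_killing x) l2U).
have E1 (I : {ffun 'I_k -> 'I_m}) : mlsym (Bform (bact val mk l Y)) (ee I) =
   \sum_(J : {ffun 'I_k -> 'I_m}) (\prod_t A (I t) (J t)) * mlsym (Bform Y) (ee J).
  rewrite -(mlsym_expand (c := fun t j => A (I t) j) (@Bform_mlin Y (grd P 1)) e_mem
    (fun t => c1 (I t))).
  rewrite /mlsym; congr (_ * _); apply: eq_bigr => w _.
  have hs : {subset [seq tnth e (I (w t)) | t <- enum 'I_k] <= grd P 1}.
    by move=> u /mapP[t _ ->]; apply: e_mem.
  have hk : size [seq tnth e (I (w t)) | t <- enum 'I_k] = k.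
    by rewrite size_map size_enum_ord.
  by rewrite (Bform_act Y hs hk) -map_comp.
have E2 (J : {ffun 'I_k -> 'I_m}) : mlsym (RF (cf x g) \1%VF) (ee' J) =
   \sum_(I : {ffun 'I_k -> 'I_m}) (\prod_t A (I t) (J t)) * mlsym (RF g \1%VF) (ee' I).
  rewrite -(mlsym_expand (c := fun t i => A i (J t)) (Rprod_mlin r_gt0 hg one_Nbar0) e'_nbar
    (fun t => c2 (J t))).
  rewrite /mlsym; congr (_ * _); apply: eq_bigr => w _.
  by rewrite (Rprod_cf gx) /cf cl1 -map_comp.
under eq_bigr do rewrite E1 mulr_suml.
under [RHS]eq_bigr do rewrite E2 mulr_sumr.
rewrite exchange_big; apply: eq_bigr => J _; apply: eq_bigr => I _ /=.
by rewrite mulrAC mulrC mulrA mulrAC mulrA.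
Qed.

End Levi.

Context (s : R[i]).
Notation Phi X Y := (oper_comm (pi_s P s X) (OmegaM Y)).

Lemma Rop0 h (a : 'End(P)) : Rop 0 h a = 0.
Proof.
have R0 : Rreal 0 h a = 0.
  apply: derivC_val; rewrite (_ : (fun t : R => _) = fun=> h a).
    exact: is_derivC_cst.
  by apply/funext => t; rewrite scaler0 lexp_ad0 comp_lfun1r.
have [e1 e2] := rf_in_id (rf0 (pd_g0 P)); rewrite /Rop e1 e2.
by rewrite R0 mulr0 addr0.
Qed.

(* [X] lies in [n], where the character vanishes, so only one term of the
   commutator survives at the identity. *)
Lemma pi_s_e X h : X \in grd P 1 -> pi_s P s X h \1%VF = 0.
Proof.
move=> hX.
have i1 : (\1%VF : 'End(P))^-1%VF X = X.
  by rewrite -{1}[X]id_lfunE lker0_lfunK //; apply: Nbar0_ker0; exact: one_Nbar0.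
rewrite (pi_sE s h i1).
have Xq : X \in qq P.
  have l1 : (1 < (pd_r P).+1)%N by [].
  exact: (subvP (sumv_sup (Ordinal l1) isT (subvv _))).
have Xn : X \in par_n (vsval (pd_H0 P)) (pd_r P).
  exact: (subvP (sumv_sup (Ordinal r_gt0) isT (subvv _))).
have [p1 p2] := proj_q Xq (mem0v (nbar P)); rewrite addr0 in p1 p2.
rewrite p2 Rop0 subr0 p1 (pd_lamq_n Xn).
by rewrite mulr0 mul0r.
Qed.

Lemma PhiE X Y f : X \in grd P 1 -> Phi X Y f \1%VF = - OmegaM Y (pi_s P s X f) \1%VF.
Proof. by move=> hX; rewrite /oper_comm (pi_s_e _ hX) sub0r. Qed.

Definition comm_e X Y f : R[i] := - OmegaM Y (pi_s P s X f) \1%VF.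

Lemma Phi_linX (c : R[i]) X X' Y f : sm f ->
  comm_e (c *: X + X') Y f = c * comm_e X Y f + comm_e X' Y f.
Proof.
move=> hf.
have h1 := sm_pi_s r_gt0 s X hf; have h2 := sm_pi_s r_gt0 s X' hf.
rewrite /comm_e mulrN -opprD; congr (- _).
rewrite -(OmegaM_flin c Y h1 h2); apply: OmegaM_ext => a ha.
exact: (pi_s_lin r_gt0 s c X X' (hf 1%N) ha).
Qed.

Lemma Phi_linY (c : R[i]) X Y Y' f :
  comm_e X (c *: Y + Y') f = c * comm_e X Y f + comm_e X Y' f.
Proof.
by rewrite /comm_e OmegaM_linY mulrN opprD.
Qed.

Lemma Phi_act x X Y f : x \in ll P -> pd_g0 P x -> sm f ->
  comm_e (lexp (ad x) X) (bact val mk (lexp (ad x)) Y) f = comm_e X Y (cf x f).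
Proof.
move=> hx gx hf; rewrite /comm_e (OmegaM_act hx gx Y (sm_pi_s r_gt0 s _ hf)).
exact: (congr1 -%R (OmegaM_ext Y (fun a ha => esym (pi_s_cf hx gx s X f ha)))).
Qed.

Context (n : nat) (V : {vspace M}) (Yb : n.-tuple M).
Hypothesis hY : basis_of V Yb.

(** The condition of [in_span_e] for a functional instead of an operator, as the commutator gets
    replaced by its surviving term [comm_e]. *)
Definition in_Espan (Psi : fsec P -> R[i]) := exists c : 'I_n -> R[i],
  forall f, smooth_section f -> Psi f = \sum_(i < n) c i * OmegaM (tnth Yb i) f \1%VF.

Lemma Espan_ext Psi Psi' : (forall f, smooth_section f -> Psi f = Psi' f) ->
  in_Espan Psi -> in_Espan Psi'.
Proof. by move=> h [c hc]; exists c => f hf; rewrite -h // hc. Qed.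

Lemma Espan_lin (c : R[i]) Psi Psi' : in_Espan Psi -> in_Espan Psi' ->
  in_Espan (fun f => c * Psi f + Psi' f).
Proof.
move=> [a ha] [b hb]; exists (fun i => c * a i + b i) => f hf.
rewrite ha // hb // mulr_sumr -big_split; apply: eq_bigr => i _ /=.
by rewrite mulrDl mulrA.
Qed.

Lemma Espan0 : in_Espan (fun=> 0).
Proof. by exists (fun=> 0) => f hf; rewrite big1 // => i _; rewrite mul0r. Qed.

Lemma OmegaM_sum I (r : seq I) (c : I -> R[i]) (y : I -> M) f a :
  OmegaM (\sum_(i <- r) c i *: y i) f a = \sum_(i <- r) c i * OmegaM (y i) f a.
Proof.
have lin : linear (fun Y => OmegaM Y f a : R[i]^o).
  by move=> b Y Y'; exact: OmegaM_linY.
rewrite -(linfun_lin lin) linear_sum; apply: eq_bigr => i _.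
by rewrite linearZ /= linfun_lin.
Qed.

Lemma Espan_Omega Y : Y \in V -> in_Espan (fun f => OmegaM Y f \1%VF).
Proof.
move=> hYV; exists (fun i => coord Yb i Y) => f _.
rewrite {1}(coord_basis hY hYV) OmegaM_sum; apply: eq_bigr => i _.
by rewrite -tnth_nth.
Qed.

Lemma Espan_sum I (r : seq I) (c : I -> R[i]) (Psi : I -> fsec P -> R[i]) :
  (forall i, in_Espan (Psi i)) -> in_Espan (fun f => \sum_(i <- r) c i * Psi i f).
Proof.
move=> h; elim: r => [|i r IH].
  by apply: Espan_ext Espan0 => f _; rewrite big_nil.
by apply: Espan_ext (Espan_lin (c i) (h i) IH) => f _; rewrite big_cons.
Qed.

(** Shows that the functional depends on [X] and [Y] only through the rank one matrix of products of
    their coordinates. *)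
Lemma Phi_expand X Y f : smooth_section f -> X \in grd P 1 -> Y \in V ->
  comm_e X Y f = \sum_(i < m) \sum_(j < n)
    (coord e i X * coord Yb j Y) * comm_e (tnth e i) (tnth Yb j) f.
Proof.
move=> /smooth_sm hf hX hYV.
have sX (r : seq 'I_m) (c : 'I_m -> R[i]) : comm_e (\sum_(i <- r) c i *: tnth e i) Y f
   = \sum_(i <- r) c i * comm_e (tnth e i) Y f.
  elim: r => [|i r IH].
    rewrite !big_nil; have := Phi_linX (-1) 0 0 Y hf.
    by rewrite scaler0 addr0 mulN1r addNr.
  by rewrite !big_cons (Phi_linX (c i) _ _ Y hf) IH.
have sY X' : comm_e X' Y f =
    \sum_(j < n) coord Yb j Y * comm_e X' (tnth Yb j) f.
  have lin : linear (fun Y => comm_e X' Y f : R[i]^o).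
    by move=> b Z Z'; exact: Phi_linY.
  rewrite -(linfun_lin lin) {1}(coord_basis hY hYV) linear_sum; apply: eq_bigr => j _.
  by rewrite linearZ /= linfun_lin // -tnth_nth.
have [be _ _] := he.
have eX : X = \sum_(i < m) coord e i X *: tnth e i.
  by rewrite {1}(coord_basis be hX); apply: eq_bigr => i _; rewrite -tnth_nth.
rewrite {1}eX sX; apply: eq_bigr => i _.
rewrite sY mulr_sumr; apply: eq_bigr => j _; exact: mulrA.
Qed.

Hypothesis hirr : irreducible_L P (fun (a : 'End(P)) (x : P) => a x) (grd P 1).
Hypothesis hV : irreducible_L P (bact val mk) V.

Lemma gk_stable x y : x \in ll P -> y \in gk -> lie x y \in gk.
Proof. exact: ll_grd. Qed.

Lemma gt_stable x y : x \in ll P -> y \in gt -> lie x y \in gt.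
Proof. exact: ll_grd. Qed.

Notation rho := (glie_op val mk).

Lemma rhoE u Y : rho u Y = glie val mk u Y.
Proof. exact: (glie_opE val_bil val_linY val_mk val_eq). Qed.

Lemma rho_lin Y : linear (fun u => rho u Y).
Proof. by move=> c u v; rewrite !rhoE (glie_linl val_bil val_linY val_mk val_eq). Qed.

Lemma Espan_act x X Y : x \in ll P -> pd_g0 P x ->
  in_Espan (fun f => comm_e X Y f) ->
  in_Espan (fun f => comm_e (lexp (ad x) X) (bact val mk (lexp (ad x)) Y) f).
Proof.
move=> hx gx [c hc].
have [_ hVx _] := irreducible_L_lie val_bil val_linY val_mk val_eq gk_stable gt_stable hV.
(* Covariance turns each [Omega] of a basis vector into [Omega] of its translate, which is again in
   [V] and so expands over the basis. *)
have h := Espan_sum (index_enum _) c (fun i => Espan_Omega (hVx x (tnth Yb i) hx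
   (basis_mem hY (mem_tnth i Yb)))).
apply: Espan_ext h => f hf.
rewrite (Phi_act X Y hx gx (smooth_sm hf)) hc; last exact: smooth_cf.
by apply: eq_bigr => i _; rewrite (OmegaM_act hx gx (tnth Yb i) (smooth_sm hf)).
Qed.

Theorem span_propagates (Xh : P) (hXh : highest_weight_vector P (@lie _ P) (grd P 1) Xh)
  (Yl : M) (hYl : lowest_weight_vector P (glie val mk) V Yl) :
  in_Espan (fun f => Phi Xh Yl f \1%VF) ->
  forall X Y, X \in grd P 1 -> Y \in V -> in_Espan (fun f => Phi X Y f \1%VF).
Proof.
move=> h0.
have XhG : Xh \in grd P 1 by case: hXh.
have {}h0 : in_Espan (fun f => comm_e Xh Yl f).
  exact: (Espan_ext (fun f _ => PhiE Yl f XhG) h0).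
(* Matrices stand for tensors in [g(1)] times [V] in the bases [e] and [Yb]; [S] selects those whose
   functional lies in the span, and [T X Y] below is the pure tensor. *)
pose S (C : 'M[R[i]]_(m, n)) := in_Espan (fun f => \sum_(i < m) \sum_(j < n)
    C i j * comm_e (tnth e i) (tnth Yb j) f).
have [||W hW] := @pred_vspace _ 'M[R[i]]_(m, n) S.
- apply: Espan_ext Espan0 => f _; rewrite big1 // => i _; rewrite big1 // => j _.
  by rewrite mxE mul0r.
- move=> c u v hu hv; apply: Espan_ext (Espan_lin c hu hv) => f _.
  rewrite mulr_sumr -big_split; apply: eq_bigr => i _ /=.
  rewrite mulr_sumr -big_split; apply: eq_bigr => j _ /=.
  by rewrite !mxE mulrDl mulrA.
pose T (X : P) (Y : M) : 'M[R[i]]_(m, n) := \matrix_(i, j) (coord e i X * coord Yb j Y).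
have TW X Y : X \in grd P 1 -> Y \in V -> T X Y \in W <-> in_Espan (fun f => comm_e X Y f).
  move=> hX hYV; split=> [/hW h|h].
    apply: Espan_ext h => f hf; rewrite (Phi_expand hf hX hYV).
    by apply: eq_bigr => i _; apply: eq_bigr => j _; rewrite mxE.
  apply/hW; apply: Espan_ext h => f hf; rewrite (Phi_expand hf hX hYV).
  by apply: eq_bigr => i _; apply: eq_bigr => j _; rewrite mxE.
have linl Y : linear (T^~ Y).
  by move=> c u v; apply/matrixP => i j; rewrite !mxE linearP mulrDl mulrA.
have linr X : linear (T X).
  by move=> c u v; apply/matrixP => i j; rewrite !mxE linearP mulrDr mulrCA.
have [hV1 hV2 hV3] := irreducible_L_lie val_bil val_linY val_mk val_eq gk_stable gt_stable hV.
have rhoV u Y : u \in ll P -> Y \in V -> rho u Y \in V.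
  by move=> hu hYV; rewrite rhoE; apply: hV1.
(* The curve of translates by exp(tx), for real [x], stays in [W]; its derivative at 0 is the Lie
   algebra action on the tensor. *)
have stab_real x X Y : x \in ll P -> pd_g0 P x -> X \in grd P 1 -> Y \in V ->
    T X Y \in W -> T (lie x X) Y + T X (rho x Y) \in W.
  move=> hx gx hX hYV hT; rewrite -adE.
  apply: (bil_deriv_mem linl linr) => t.
  have hx' : t%:C *: x \in ll P := memvZ t%:C hx.
  have gx' : pd_g0 P (t%:C *: x) by apply: rfZ.
  rewrite -adZ -(glie_opZ val_bil val_linY val_mk val_eq).
  rewrite -(bact_lexp val_bil val_linY val_mk val_eq gk_stable gt_stable Y hx').
  apply/TW; [exact: (levi_grd hx' hX) | exact: (hV2 _ _ hx' hYV)|].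
  by apply: (Espan_act hx' gx'); apply/TW.
(* The action is complex linear in [x], and every element of [l] is a complex combination of two
   real elements of [l]. *)
have stab x X Y : x \in ll P -> X \in grd P 1 -> Y \in V ->
    T X Y \in W -> T (lie x X) Y + T X (rho x Y) \in W.
  move=> hx hX hYV hT; have [y [z [[gy hy] [gz hz] ->]]] := pd_l_real hx.
  have h1 := stab_real y X Y hy gy hX hYV hT.
  have h2 := stab_real z X Y hz gz hX hYV hT.
  rewrite [y + _]addrC lieDl lieZl linl (rho_lin Y) linr addrACA -scalerDr.
  by apply: memvD => //; apply: memvZ.
(* The nonzero [Xh] in [g(1)] makes the tuple [e] nonempty, and then a dual pair has Killing product
   1. *)
have nondeg : forall x : P, x != 0 -> exists y, killing x y != 0.
  apply: (killing_nondeg (pd_simple P)).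
  have [XG [X0 _] _] := hXh; have [be _ de] := he.
  case: (pickP (fun i : 'I_m => true)) => [i _|no].
    by exists (tnth e i), (tnth e' i); rewrite de eqxx oner_eq0.
  by case/eqP: X0; rewrite (coord_basis be XG) big1 // => i; have := no i.
have hYl' : lowest_weight_vector P (fun x => rho x) V Yl.
  have [h1 [h2 h3] h4] := hYl; split=> //; first split=> //.
    by move=> H hH; rewrite rhoE; apply: h3.
  by move=> a x pa ha hx; rewrite rhoE; apply: (h4 a).
have YlV : Yl \in V by case: hYl.
move=> X Y hX hYV; apply: (Espan_ext (fun f _ => esym (PhiE Y f hX))); apply/(TW X Y hX hYV).
apply: (tensor_cyclic (rho := rho) rho_lin _ nondeg linl linr _ rhoV _ _ hXh hYl' stab _ hX hYV).
- move=> u v Y' hu hv; rewrite !rhoE.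
  exact: (glie_rep val_bil val_linY val_mk val_eq gk_stable gt_stable).
- by move=> u Z; exact: ll_grd.
- exact: (irr_grd hirr).
- move=> U hU hst; apply: (hV3 U hU) => u Y' hu hY'.
  rewrite -(rhoE u Y'); exact: (hst u Y' hu hY').
- exact/(TW Xh Yl XhG YlV).
Qed.

End Main.

(** * Specialization to the bilinear forms of the theorem *)

Section Bidual.
Context {R : realType} (P : parabolicData R) (k : nat).
Notation gk := (grd P (k%:Z - (pd_r P)%:Z)).
Notation gt := (grd P (pd_r P)%:Z).

Definition bidualV : vectType R[i] := 'Hom(subvs_of gk, 'Hom(subvs_of gt, R[i]^o)).

Lemma bival_linY x z : linear (fun Y : bidualV => @bival R P k Y x z : R[i]^o).
Proof. exact: (@gbival_linY _ _ gk gt x z). Qed.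

Lemma bival_inj (Y Y' : bidualV) :
  (forall x z, x \in gk -> z \in gt -> @bival R P k Y x z = @bival R P k Y' x z) -> Y = Y'.
Proof. exact: (@gbd_eq _ _ gk gt Y Y'). Qed.

Lemma bival_bilform (Y : bidualV) : bilform (@bival R P k Y).
Proof. exact: (@gbival_bil _ _ gk gt Y). Qed.

Lemma bival_mk B x z : bilform B -> x \in gk -> z \in gt ->
  bival (mkbidual k B : bidual P k) x z = B x z.
Proof. exact: (@gbival_mk _ _ gk gt B x z). Qed.

End Bidual.

Theorem lemma3p12 (R : realType) (P : parabolicData R)
  (m : nat) (e e' : m.-tuple P) (d : nat) (xs xs' : d.-tuple P)
  (he : dual_bases (grd P 1) (grd P (-1)) e e')
  (hxs : dual_bases (grd P (pd_r P)%:Z) (grd P (- (pd_r P)%:Z)) xs xs')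
  (s : R[i]) (k : nat) (hk : (1 <= k <= 2 * pd_r P)%N)
  (hirr : irreducible_L P (fun (a : 'End(P)) (x : P) => a x) (grd P 1))
  (V : {vspace bidual P k})
  (hV : irreducible_L P (@bidual_act R P k) V)
  (Xh : P) (hXh : highest_weight_vector P (@lie _ P) (grd P 1) Xh)
  (Yl : bidual P k) (hYl : lowest_weight_vector P (@bidual_lie R P k) V Yl)
  (n : nat) (Y : n.-tuple (bidual P k)) (hY : basis_of V Y)
  (hspan : in_span_e
     (oper_comm (pi_s P s Xh) (Omega e e' xs xs' Yl))
     (fun i : 'I_n => Omega e e' xs xs' (tnth Y i))) :
  forall (X : P) (Y' : bidual P k), X \in grd P 1 -> Y' \in V ->
    in_span_e
      (oper_comm (pi_s P s X) (Omega e e' xs xs' Y'))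
      (fun i : 'I_n => Omega e e' xs xs' (tnth Y i)).
Proof.
(* From [1 <= 2r]; positivity of [r] puts [g(1)] inside [n] and [g(-1)] inside [nbar]. *)
have r_gt0 : (0 < pd_r P)%N.
  by have /andP[k1 k2] := hk; have := leq_trans k1 k2; rewrite muln_gt0.
exact: (@span_propagates R P r_gt0 m e e' d xs xs' he hxs k (bidualV P k)
  (@bival R P k) (@mkbidual R P k) (@bival_bilform R P k) (@bival_linY R P k)
  (@bival_mk R P k) (@bival_inj R P k) s n V Y hY hirr hV Xh hXh Yl hYl hspan).
Qed.
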